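(* Let $n\ge4$ and let $\lambda\in\mathrm{Hom}(\Lambda_n,\mathbb{C}^* )$ be a linear part such that $\iota(\lambda)=n$. (A) If some $[\rho]\in\mathrm{PH}_\lambda$ has a finite orbit under $\mathrm{PB}_n\mathbb{D}$, then $n\le6$. (B) If $n=5$ (resp. $n=6$), the representations $\rho$ with $[\rho]\in\mathrm{PH}_\lambda$ whose conjugacy classes have finite orbits are exactly those whose linear part is, up to permutation, $(\lambda_1,\dots,\lambda_5)=(\zeta,\zeta,\zeta,\zeta,\zeta^2)$ (resp. $(\lambda_1,\dots,\lambda_6)=(\zeta,\zeta,\zeta,\zeta,\zeta,\zeta)$), where $\zeta$ is any primitive 6th root of unity. (C) If $n=4$, then $\mathrm{PH}_\lambda$ contains a point with finite orbit if and only if, up to permutation, $\lambda=(\lambda_1,\dots,\lambda_4)$ is one of the tuples below. For $\lambda$ equal to one of these tuples, the finite orbits are exactly as follows; each listed translation part $(\tau_1,\dots,\tau_4)$ represents one orbit of the indicated size, distinct entries represent distinct orbits, and ''all others: $N$'' means that all points of $\mathrm{PH}_\lambda$ not in the listed orbits have orbits of size $N$. Imprimitive cases, $\lambda=(a,-a^{-1},-a^{-1},a)$ with $a^2\ne1$: (I1) $a$ a root of unity, $m$ the order of $a^2$: $(0,1,a,0)$ has size $2$; $(0,0,1,a)$ has size $m$; $(0,1,0,-a^2)$ if $m$ is even, respectively $(0,2,1+a,a-a^2)$ if $m$ is odd, has size $m$; all others: $2m$. (I2) $a$ not a root of unity: $(0,1,a,0)$ has size $2$; all other orbits are infinite. Tetrahedral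 cases: (T1) $\lambda=(\eta,\eta^5,\eta^3,\eta^3)$, $\eta$ a primitive 12th root of 1: $(\eta^3,0,0,1)$ and $(0,\eta^5,-1,0)$ have size 4; $(0,0,\eta^3,-1)$ has size 6; all others: 12. (T2) $\lambda=(-1,\zeta,\zeta,\zeta)$, $\zeta$ a primitive 6th root of 1: $(0,0,\zeta,-1)$ and $(0,1-\zeta^2,\zeta,\zeta)$ have size 4; $(0,1,\zeta+\eta,\zeta^2\eta+\zeta-1)$ with $\eta^2=\zeta$ has size 6; all others: 12. Octahedral cases: (O1) $\lambda=(\eta,\eta^5,\eta^7,\eta^{11})$, $\eta$ a primitive 24th root of 1: $(0,0,1,\eta^5)$ has size 6; $(0,1,0,1)$ has size 8; $(\eta,0,0,1)$ has size 12; all others: 24. (O2) $\lambda=(\eta,-\eta,\eta^2,\eta^2)$, $\eta$ a primitive 12th root of 1: $(\eta^4,0,0,1)$ has size 6; $(0,0,\eta^2,-1)$ has size 8; $(0,\nu+\eta^3,\nu^{-1},1)$ with $\nu^2=\eta$ has size 12; all others: 24. Icosahedral cases (in each case the three listed translation parts have sizes 12, 20, 30 in this order, and all others: 60; in (Y2)-(Y6), $\beta$ is a primitive 60th root of 1): (Y1) $\lambda=(\alpha,\alpha^{29},\alpha^{11},\alpha^{19})$, $\alpha$ of order 60: $(0,1,0,\alpha^{50})$; $(1,0,0,\alpha^{49})$; $(0,0,1,\alpha^{19})$. (Y2) $\lambda=(\alpha,\alpha^9,\alpha^7,\alpha^3)$, $\alpha=\beta^3$: $(\alpha^{12},0,0,\alpha^5)$;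 $(0,\beta+\alpha^5+\alpha^2+\alpha,1+\alpha^3,(\beta+\alpha)(1-\alpha^3\beta))$; $(0,0,\alpha^{17},1)$. (Y3) $\lambda=(\alpha^9,\alpha^9,\alpha,\alpha^{11})$, $\alpha=\beta^2$: $(0,0,\alpha^{16},1)$; $(\alpha^{10},0,0,\alpha^6)$; $(0,(\alpha+1)(\alpha^{11}+1),\beta+\alpha^{14}-\alpha^5+\alpha^4,(\beta+1)\alpha^{14}+\alpha^4)$. (Y4) $\lambda=(\alpha^5,\alpha^5,\alpha,\alpha^{19})$, $\alpha=\beta^2$: $(\alpha^{11},0,0,-1)$; $(0,0,1,\alpha^{14})$; $(0,1,\alpha^5(1+\beta),\alpha^4(\alpha^{10}-\beta))$. (Y5) $\lambda=(\alpha,\alpha^4,\alpha^2,\alpha^8)$, $\alpha=\beta^4$: $(\alpha^{12},0,0,-\alpha^5)$; $(0,0,\alpha^2,-1)$; $(0,\beta^{56}+\beta^{13}+\beta^{12}+\beta^8-\beta^6-\beta^2,1+\beta^{22},\beta^{19}+\beta^{18}-\beta^8)$. (Y6) $\lambda=(-\alpha,-\alpha,-\alpha,-\alpha^2)$, $\alpha=\beta^{12}$, $\gamma=\beta^2$: $(0,0,\alpha,1)$; $(0,\gamma^5+\gamma^4-1,\gamma^4+\gamma-\alpha,\alpha\gamma-\gamma^5)$; $(0,\beta^{11}+\beta^9-\beta,\beta^9-1,\alpha(\beta^6+\beta^3))$.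
   Context: $\Lambda_n$ is the fundamental group of the Riemann sphere minus $n$ points, $\Lambda_n=\langle\alpha_1,\dots,\alpha_n\mid\alpha_1\cdots\alpha_n=1\rangle$. $\mathrm{Aff}(\mathbb{C})$ is the group of maps $z\mapsto az+b$ of $\mathbb{C}$, $a\in\mathbb{C}^*$, $b\in\mathbb{C}$, under composition. For $\rho\in\mathrm{Hom}(\Lambda_n,\mathrm{Aff}(\mathbb{C}))$ write $\rho(\alpha_i):z\mapsto\lambda_iz+\tau_i$. The homomorphism $\lambda:\Lambda_n\to\mathbb{C}^*$, $\lambda(\alpha_i)=\lambda_i$, identified with $(\lambda_1,\dots,\lambda_n)$ (so $\lambda_1\cdots\lambda_n=1$), is the linear part of $\rho$; $(\tau_1,\dots,\tau_n)$ is its translation part (for $n=4$ it satisfies $\tau_1+\lambda_1\tau_2+\lambda_1\lambda_2\tau_3+\lambda_1\lambda_2\lambda_3\tau_4=0$). The nontriviality index $\iota(\lambda)$ is the number of $i$ with $\lambda_i\ne1$. $\mathrm{Hom}_\lambda(\Lambda_n,\mathrm{Aff}(\mathbb{C}))$ is the set of $\rho$ with linear part $\lambda$, a vector space with coordinates $(\tau_1,\dots,\tau_{n-1})$. Conjugation by $z\mapsto az+b$ replaces $(\tau_i)$ by $(a\tau_i+b(1-\lambda_i))$. For $\lambda$ nontrivial, $\mathrm{H}_\lambda:=\mathrm{Hom}_\lambda(\Lambda_n,\mathrm{Aff}(\mathbb{C}))/\mathbb{C}(1-\lambda_1,\dots,1-\lambda_{n-1})\cong\mathbb{C}^{n-2}$,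 and $\mathrm{PH}_\lambda\cong\mathbb{P}^{n-3}(\mathbb{C})$ is its projectivization. Its points are the $\mathrm{Aff}(\mathbb{C})$-conjugacy classes $[\rho]$ of those $\rho$ with linear part $\lambda$ that are not conjugate to a representation with all $\tau_i=0$. The braid group $\mathrm{B}_n\mathbb{D}$ of the disk (standard generators $\sigma_i=\sigma_{i,i+1}$) acts on $\mathrm{Hom}(\Lambda_n,\mathrm{Aff}(\mathbb{C}))$ by $\beta\cdot\rho=\rho\circ\mathrm{Hur}(\beta)$, where $\mathrm{Hur}$ is the antimorphism to $\mathrm{Aut}(\Lambda_n)$ (Hurwitz action) for which $\sigma_{i,j}$ acts by $\alpha_i\mapsto(\alpha_i\cdots\alpha_{j-1})\alpha_j(\alpha_i\cdots\alpha_{j-1})^{-1}$, $\alpha_j\mapsto(\alpha_{i+1}\cdots\alpha_{j-1})^{-1}\alpha_i(\alpha_{i+1}\cdots\alpha_{j-1})$, $\alpha_k\mapsto\alpha_k$ for $k\ne i,j$ $(1\le i<j\le n)$. The pure braid group $\mathrm{PB}_n\mathbb{D}$, kernel of $\mathrm{B}_n\mathbb{D}\to\mathfrak{S}_n$, is generated by the $\sigma_{i,j}^2$; it preserves linear parts and acts on $\mathrm{PH}_\lambda$. ''Orbit'' means $\mathrm{PB}_n\mathbb{D}$-orbit. A braid inducing a permutation $\sigma$ maps $\mathrm{PH}_\lambda$ bijectively onto $\mathrm{PH}_{\lambda^\sigma}$, with $\lambda^\sigma_i=\lambda_{\sigma^{-1}(i)}$, sending $\mathrm{PB}_n\mathbb{D}$-orbits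 to $\mathrm{PB}_n\mathbb{D}$-orbits; in this way the orbits for a permuted linear part are deduced from the listed ones. *)

(* Defs.v *)
From HB Require Import structures.
From mathcomp Require Import all_boot all_order all_fingroup all_algebra.
From mathcomp Require Import boolp classical_sets functions cardinality reals.
From mathcomp Require Import complex.

Set Implicit Arguments.
Unset Strict Implicit.
Unset Printing Implicit Defensive.

Import generic_quotient GRing.Theory Num.Theory.

Local Open Scope quotient_scope.
Local Open Scope classical_set_scope.
Local Open Scope group_scope.

(** * Groups given by generators and relations

    A letter [(x, true)] stands for the generator [x], [(x, false)] for its
    inverse.  The group presented by the generators [I] and the relations
    [l = r], for [rel l r], is the quotient of the words by the least
    congruence containing [rel] and the free cancellations. *)

Definition word (I : Type) := seq (I * bool).

Inductive word_eq (I : Type) (rel : word I -> word I -> Prop) :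
  word I -> word I -> Prop :=
| word_eq_refl w : word_eq rel w w
| word_eq_sym v w : word_eq rel v w -> word_eq rel w v
| word_eq_trans u v w : word_eq rel u v -> word_eq rel v w -> word_eq rel u w
| word_eq_cancel u v x b :
    word_eq rel (u ++ [:: (x, b), (x, ~~ b) & v]) (u ++ v)
| word_eq_rel u v l r : rel l r -> word_eq rel (u ++ l ++ v) (u ++ r ++ v).

Definition word_inv (I : Type) (w : word I) : word I :=
  rev [seq (a.1, ~~ a.2) | a <- w].

Lemma word_eq_ctx I rel (s t v w : word I) :
  word_eq rel v w -> word_eq rel (s ++ v ++ t) (s ++ w ++ t).
Proof.
move=> vw; elim: vw s t => {v w}
  [w|v w _ IH|u v w _ IH1 _ IH2|u v x b|u v l r lr] s t.
- exact: word_eq_refl.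
- exact/word_eq_sym/IH.
- exact: word_eq_trans (IH1 s t) (IH2 s t).
- by rewrite -!catA !(catA s) /=; apply: word_eq_cancel.
- by rewrite -!catA !(catA s); apply: word_eq_rel.
Qed.

Lemma word_eq_cat I rel (v v' w w' : word I) :
  word_eq rel v v' -> word_eq rel w w' -> word_eq rel (v ++ w) (v' ++ w').
Proof.
move=> vv' ww'; apply: (@word_eq_trans _ _ _ (v' ++ w)).
  exact: (word_eq_ctx [::] w vv').
by have := word_eq_ctx v' [::] ww'; rewrite !cats0.
Qed.

Lemma word_invK I : involutive (@word_inv I).
Proof.
move=> w; rewrite /word_inv map_rev revK -map_comp -[RHS]map_id.
by apply: eq_map => -[x b] /=; rewrite negbK.
Qed.

Lemma word_inv_cat I (v w : word I) :
  word_inv (v ++ w) = word_inv w ++ word_inv v.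
Proof. by rewrite /word_inv map_cat rev_cat. Qed.

Lemma word_eq_invr I rel (w : word I) : word_eq rel (w ++ word_inv w) [::].
Proof.
elim/last_ind: w => [|w [x b] IHw]; first exact: word_eq_refl.
rewrite -cats1 word_inv_cat -catA /=.
exact: word_eq_trans (word_eq_cancel _ _ _ _ _) IHw.
Qed.

Lemma word_eq_invl I rel (w : word I) : word_eq rel (word_inv w ++ w) [::].
Proof. by rewrite -{2}[w]word_invK; apply: word_eq_invr. Qed.

Lemma word_eq_inv I rel (v w : word I) :
  word_eq rel v w -> word_eq rel (word_inv v) (word_inv w).
Proof.
move=> vw; apply: (@word_eq_trans _ _ _ (word_inv v ++ w ++ word_inv w)).
  rewrite -{1}[word_inv v]cats0; apply: word_eq_cat (word_eq_refl _ _) _.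
  exact/word_eq_sym/word_eq_invr.
rewrite catA -[X in word_eq _ _ X]cat0s.
apply: word_eq_cat (word_eq_refl _ _).
apply: word_eq_trans (word_eq_invl _ v).
exact: word_eq_cat (word_eq_refl _ _) (word_eq_sym vw).
Qed.

Section PresentedGroup.
Variables (I : choiceType) (rel : word I -> word I -> Prop).

Definition word_eqb (v w : word I) : bool := `[< word_eq rel v w >].

Lemma word_eqb_equiv : equiv_class_of word_eqb.
Proof.
split=> [w|v w|v u w].
- exact/asboolP/word_eq_refl.
- by apply/asboolP/asboolP => /word_eq_sym.
- by move=> /asboolP uv /asboolP vw; apply/asboolP/(word_eq_trans uv vw).
Qed.
Canonical word_eqb_equiv_rel := EquivRelPack word_eqb_equiv.

Definition presented := {eq_quot word_eqb}%qT.
HB.instance Definition _ := Choice.on presented.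
HB.instance Definition _ : EqQuotient _ word_eqb presented :=
  EqQuotient.on presented.

Lemma presented_eqP (v w : word I) :
  reflect (word_eq rel v w) (\pi_presented v == \pi_presented w :> presented).
Proof. by rewrite eqmodE; apply: asboolP. Qed.

Lemma repr_word_eq w : word_eq rel (repr (\pi_presented w)) w.
Proof. by apply/presented_eqP; rewrite reprK. Qed.

Definition presented_one : presented := \pi_presented [::].
Definition presented_inv (x : presented) : presented :=
  \pi_presented (word_inv (repr x)).
Definition presented_mul (x y : presented) : presented :=
  \pi_presented (repr x ++ repr y).

Lemma presented_mulE v w :
  presented_mul (\pi v) (\pi w) = \pi_presented (v ++ w).
Proof. by apply/eqP/presented_eqP/word_eq_cat; apply: repr_word_eq. Qed.

Lemma presented_invE w : presented_inv (\pi w) = \pi_presented (word_inv w).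
Proof. by apply/eqP/presented_eqP/word_eq_inv/repr_word_eq. Qed.

Lemma presented_mulA : associative presented_mul.
Proof.
move=> x y z; rewrite -[x]reprK -[y]reprK -[z]reprK.
by rewrite !presented_mulE catA.
Qed.

Lemma presented_1mul : left_id presented_one presented_mul.
Proof. by move=> x; rewrite -[x]reprK presented_mulE. Qed.

Lemma presented_mul1 : right_id presented_one presented_mul.
Proof. by move=> x; rewrite -[x]reprK presented_mulE cats0. Qed.

Lemma presented_mulV : left_inverse presented_one presented_inv presented_mul.
Proof.
move=> x; rewrite -[x]reprK presented_invE presented_mulE.
exact/eqP/presented_eqP/word_eq_invl.
Qed.

Lemma presented_Vmul : right_inverse presented_one presented_inv presented_mul.
Proof.
move=> x; rewrite -[x]reprK presented_invE presented_mulE.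
exact/eqP/presented_eqP/word_eq_invr.
Qed.

HB.instance Definition _ := isGroup.Build presented
  presented_mulA presented_1mul presented_mul1 presented_mulV presented_Vmul.

Definition pgen (x : I) : presented := \pi_presented [:: (x, true)].

Section Lift.
Variables (G : groupType) (f : I -> G).

Definition word_eval (w : word I) : G :=
  \prod_(a <- w) (if a.2 then f a.1 else (f a.1)^-1).

(* The extension of [f] to a morphism, when [f] satisfies the relations. *)
Definition plift (x : presented) : G := word_eval (repr x).

Hypothesis f_rel : forall l r, rel l r -> word_eval l = word_eval r.

Lemma word_eval_cat v w : word_eval (v ++ w) = word_eval v * word_eval w.
Proof. exact: big_cat. Qed.

Lemma word_eval_eq v w : word_eq rel v w -> word_eval v = word_eval w.
Proof.
elim=> {v w} [//|v w _ -> //|u v w _ -> _ -> //|u v x b|u v l r /f_rel lr].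
  rewrite !word_eval_cat; congr (_ * _).
  by rewrite /word_eval !big_cons /=; case: b => /=; rewrite ?mulKg ?mulVKg.
by rewrite !word_eval_cat lr.
Qed.

Lemma plift_pi w : plift (\pi w) = word_eval w.
Proof. exact/word_eval_eq/repr_word_eq. Qed.

Lemma pliftM : {morph plift : x y / x * y}.
Proof.
move=> x y; rewrite -[x]reprK -[y]reprK.
by rewrite [_ * _]presented_mulE !plift_pi word_eval_cat.
Qed.

Lemma plift_gen x : plift (pgen x) = f x.
Proof. by rewrite plift_pi /word_eval big_seq1. Qed.

End Lift.

Lemma gmulf1_presented (G : groupType) (f : {multiplicative presented -> G}) :
  f 1 = 1.
Proof. by apply: (mulgI (f 1)); rewrite -gmulfM !mulg1. Qed.

Lemma gmulfV_presented (G : groupType) (f : {multiplicative presented -> G}) :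
  {morph f : x / x^-1}.
Proof.
move=> x; apply: (mulgI (f x)).
by rewrite mulgV -gmulfM mulgV gmulf1_presented.
Qed.

Lemma presented_ext (G : groupType) (f g : {multiplicative presented -> G}) :
  (forall x, f (pgen x) = g (pgen x)) -> f =1 g.
Proof.
move=> fg y; rewrite -[y]reprK; elim: (repr y) => {y} [|[x b] w IHw].
  by rewrite -[\pi _]/(1 : presented) !gmulf1_presented.
have -> : \pi_presented ((x, b) :: w) =
    (\pi_presented [:: (x, b)] : presented) * (\pi_presented w : presented).
  by rewrite [RHS]presented_mulE.
rewrite !gmulfM IHw; congr (_ * _); case: b; first exact: fg.
have -> : \pi_presented [:: (x, false)] = (pgen x)^-1.
  by rewrite [RHS]presented_invE.
by rewrite !gmulfV_presented fg.
Qed.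

End PresentedGroup.

(** * Automorphism groups *)

Lemma multiplicative_ext (G H : magmaType) (f g : {multiplicative G -> H}) :
  f =1 g -> f = g.
Proof.
case: f g => [f [[fM]]] [g [[gM]]] /= /funext fg.
by move: gM; rewrite -fg => gM; rewrite (Prop_irrelevance fM gM).
Qed.

Record autg (G : groupType) := Autg {
  autg_fun :> {multiplicative G -> G};
  autg_inv : {multiplicative G -> G};
  autgK : cancel autg_fun autg_inv;
  autgKV : cancel autg_inv autg_fun }.

Lemma autg_ext (G : groupType) (f g : autg G) : f =1 g -> f = g.
Proof.
case: f g => [f f' fK fKV] [g g' gK gKV] /= fg.
move: gK gKV; rewrite -(multiplicative_ext fg) => gK gKV.
have e : f' = g' by apply: multiplicative_ext => x; rewrite -{1}[x]gKV fK.
by move: gK gKV; rewrite -e => gK gKV; congr Autg; apply: Prop_irrelevance.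
Qed.

Section AutGroup.
Variable G : groupType.

HB.instance Definition _ := gen_eqMixin (autg G).
HB.instance Definition _ := gen_choiceMixin (autg G).

Definition autg_one : autg G :=
  @Autg G idfun idfun (fun=> erefl) (fun=> erefl).
Definition autg_opp (f : autg G) : autg G := Autg (@autgKV _ f) (@autgK _ f).
(* As for [{perm T}], the product composes from left to right:
   [(f * g) x = g (f x)]. *)
Definition autg_mul (f g : autg G) : autg G :=
  @Autg G (autg_fun g \o autg_fun f) (autg_inv f \o autg_inv g)
    (can_comp (@autgK _ g) (@autgK _ f)) (can_comp (@autgKV _ f) (@autgKV _ g)).

Lemma autg_mulA : associative autg_mul.
Proof. by move=> f g h; apply: autg_ext. Qed.
Lemma autg_1mul : left_id autg_one autg_mul.
Proof. by move=> f; apply: autg_ext. Qed.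
Lemma autg_mul1 : right_id autg_one autg_mul.
Proof. by move=> f; apply: autg_ext. Qed.
Lemma autg_mulV : left_inverse autg_one autg_opp autg_mul.
Proof. by move=> f; apply: autg_ext => x; apply: autgKV. Qed.
Lemma autg_Vmul : right_inverse autg_one autg_opp autg_mul.
Proof. by move=> f; apply: autg_ext => x; apply: autgK. Qed.

HB.instance Definition _ := isGroup.Build (autg G)
  autg_mulA autg_1mul autg_mul1 autg_mulV autg_Vmul.

End AutGroup.

(** * The group [Lambda n] and the braid group of the disk *)

Inductive sphere_rel (n : nat) : word 'I_n -> word 'I_n -> Prop :=
| SphereRel : sphere_rel [seq (k, true) | k <- enum 'I_n] [::].

Definition Lambda (n : nat) := presented (@sphere_rel n).
HB.instance Definition _ n := Group.on (Lambda n).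

Definition alpha (n : nat) (k : 'I_n) : Lambda n := pgen (@sphere_rel n) k.

(* Artin's presentation; the index [i : 'I_n.-1] stands for the generator
   exchanging the [i]-th and [i.+1]-th points, counted from 0. *)
Inductive braid_rel (n : nat) : word 'I_n.-1 -> word 'I_n.-1 -> Prop :=
| BraidFar (i j : 'I_n.-1) : i.+1 < j ->
    braid_rel [:: (i, true); (j, true)] [:: (j, true); (i, true)]
| BraidNear (i j : 'I_n.-1) : i.+1 = j :> nat ->
    braid_rel [:: (i, true); (j, true); (i, true)]
              [:: (j, true); (i, true); (j, true)].

Definition braid (n : nat) := presented (@braid_rel n).
HB.instance Definition _ n := Group.on (braid n).

Lemma pred_ord_proof (n : nat) (i : 'I_n.-1) : i.+1 < n.
Proof. by rewrite -ltn_predRL. Qed.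

Definition lo n (i : 'I_n.-1) : 'I_n := widen_ord (leq_pred n) i.
Definition hi n (i : 'I_n.-1) : 'I_n := Ordinal (pred_ord_proof i).

Definition braid_perm (n : nat) : braid n -> 'S_n :=
  plift (fun i => tperm (lo i) (hi i)).

Definition pure_braid (n : nat) : set (braid n) :=
  [set b | braid_perm b = 1].

Section Hurwitz.
Variables (n : nat) (i : 'I_n.-1).

Definition hurwitz_img (k : 'I_n) : Lambda n :=
  if k == lo i then alpha (lo i) * alpha (hi i) * (alpha (lo i))^-1
  else if k == hi i then alpha (lo i)
  else alpha k.

Definition hurwitz_img_inv (k : 'I_n) : Lambda n :=
  if k == lo i then alpha (hi i)
  else if k == hi i then (alpha (hi i))^-1 * alpha (lo i) * alpha (hi i)
  else alpha k.

Lemma lo_neq_hi : (lo i == hi i) = false.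
Proof. by apply/eqP => /(congr1 val) /= /eqP; rewrite ltn_eqF. Qed.

Lemma prod_lo_hi (G : groupType) (f g : 'I_n -> G) :
    f (lo i) * f (hi i) = g (lo i) * g (hi i) ->
    (forall k, k != lo i -> k != hi i -> f k = g k) ->
  \prod_(k <- enum 'I_n) f k = \prod_(k <- enum 'I_n) g k.
Proof.
move=> fg_i fg.
have i_lt : i < size (enum 'I_n) by rewrite size_enum_ord (ltn_ord (lo i)).
have i1_lt : i.+1 < size (enum 'I_n) by rewrite size_enum_ord (ltn_ord (hi i)).
have -> : enum 'I_n = take i (enum 'I_n)
    ++ [:: lo i, hi i & drop i.+2 (enum 'I_n)].
  rewrite -[LHS](cat_take_drop i) (drop_nth (lo i)) // (drop_nth (lo i)) //.
  congr (_ ++ [:: _, _ & _]); apply: val_inj; rewrite /= nth_enum_ord //.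
    exact: ltn_ord (lo i).
  exact: ltn_ord (hi i).
rewrite !big_cat !big_cons /= !mulgA -!(mulgA _ (_ (lo i))) fg_i.
have notin (s : seq 'I_n) : (forall k, k \in s -> k != lo i /\ k != hi i) ->
    \prod_(k <- s) f k = \prod_(k <- s) g k.
  by move=> sP; apply: eq_big_seq => k /sP[]; apply: fg.
congr (_ * _ * _); apply: notin => k.
  rewrite in_take ?mem_enum // index_enum_ord => ki.
  by split; rewrite -val_eqE /= ltn_eqF // ltnW.
move=> /(nthP (lo i)) [j]; rewrite size_drop size_enum_ord => jn <-.
rewrite nth_drop -!val_eqE /= nth_enum_ord; last by rewrite -ltn_subRL.
by rewrite !gtn_eqF // !addSn ltnS ?leq_addr // ltnW // ltnS leq_addr.
Qed.

Lemma word_eval_alphas (G : groupType) (f : 'I_n -> G) :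
  word_eval f [seq (k, true) | k <- enum 'I_n] = \prod_(k <- enum 'I_n) f k.
Proof. by rewrite /word_eval big_map. Qed.

Lemma prod_alpha : \prod_(k <- enum 'I_n) alpha k = 1.
Proof.
have pi_prod (s : seq 'I_n) : \prod_(k <- s) alpha k =
    \pi_(Lambda n) [seq (k, true) | k <- s].
  elim: s => [|k s IHs]; first by rewrite big_nil.
  by rewrite big_cons IHs [LHS]presented_mulE.
rewrite pi_prod; apply/eqP/presented_eqP.
have := word_eq_rel [::] [::] (SphereRel n).
by rewrite !cats0.
Qed.

Lemma hurwitz_img_rel l r : sphere_rel l r ->
  word_eval hurwitz_img l = word_eval hurwitz_img r.
Proof.
case; rewrite word_eval_alphas [RHS]big_nil -[RHS]prod_alpha.
apply: prod_lo_hi => [|k /negPf kl /negPf kh]; rewrite /hurwitz_img.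
  by rewrite eqxx eq_sym lo_neq_hi eqxx mulgVK.
by rewrite kl kh.
Qed.

Lemma hurwitz_img_inv_rel l r : sphere_rel l r ->
  word_eval hurwitz_img_inv l = word_eval hurwitz_img_inv r.
Proof.
case; rewrite word_eval_alphas [RHS]big_nil -[RHS]prod_alpha.
apply: prod_lo_hi => [|k /negPf kl /negPf kh]; rewrite /hurwitz_img_inv.
  by rewrite eqxx eq_sym lo_neq_hi eqxx !mulgA mulgV mul1g.
by rewrite kl kh.
Qed.

Definition hurwitz_fun : Lambda n -> Lambda n := plift hurwitz_img.
Definition hurwitz_fun_inv : Lambda n -> Lambda n := plift hurwitz_img_inv.

HB.instance Definition _ := isMultiplicative.Build (Lambda n) (Lambda n)
  hurwitz_fun (pliftM hurwitz_img_rel).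
HB.instance Definition _ := isMultiplicative.Build (Lambda n) (Lambda n)
  hurwitz_fun_inv (pliftM hurwitz_img_inv_rel).

Lemma hurwitz_lo : hurwitz_fun (alpha (lo i)) =
  alpha (lo i) * alpha (hi i) * (alpha (lo i))^-1.
Proof.
by rewrite [LHS](plift_gen hurwitz_img_rel) /hurwitz_img eqxx.
Qed.

Lemma hurwitz_hi : hurwitz_fun (alpha (hi i)) = alpha (lo i).
Proof.
rewrite [LHS](plift_gen hurwitz_img_rel) /hurwitz_img eqxx.
by rewrite eq_sym lo_neq_hi.
Qed.

Lemma hurwitz_other k :
  k != lo i -> k != hi i -> hurwitz_fun (alpha k) = alpha k.
Proof.
move=> /negPf kl /negPf kh.
by rewrite [LHS](plift_gen hurwitz_img_rel) /hurwitz_img kl kh.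
Qed.

Lemma hurwitz_inv_lo : hurwitz_fun_inv (alpha (lo i)) = alpha (hi i).
Proof.
by rewrite [LHS](plift_gen hurwitz_img_inv_rel) /hurwitz_img_inv eqxx.
Qed.

Lemma hurwitz_inv_hi : hurwitz_fun_inv (alpha (hi i)) =
  (alpha (hi i))^-1 * alpha (lo i) * alpha (hi i).
Proof.
rewrite [LHS](plift_gen hurwitz_img_inv_rel) /hurwitz_img_inv eqxx.
by rewrite eq_sym lo_neq_hi.
Qed.

Lemma hurwitz_inv_other k :
  k != lo i -> k != hi i -> hurwitz_fun_inv (alpha k) = alpha k.
Proof.
move=> /negPf kl /negPf kh.
by rewrite [LHS](plift_gen hurwitz_img_inv_rel) /hurwitz_img_inv kl kh.
Qed.

End Hurwitz.

Lemma hurwitz_funK n (i : 'I_n.-1) :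
  cancel (hurwitz_fun i) (hurwitz_fun_inv i).
Proof.
apply: (@presented_ext _ _ _ (hurwitz_fun_inv i \o hurwitz_fun i) idfun).
move=> k /=.
rewrite -[pgen _ k]/(alpha k).
have [->|kl] := eqVneq k (lo i).
  rewrite hurwitz_lo !gmulfM gmulfV_presented /= !hurwitz_inv_lo hurwitz_inv_hi.
  by rewrite !mulgA mulgV mul1g mulgK.
have [->|kh] := eqVneq k (hi i); first by rewrite hurwitz_hi hurwitz_inv_lo.
by rewrite hurwitz_other // hurwitz_inv_other.
Qed.

Lemma hurwitz_fun_invK n (i : 'I_n.-1) :
  cancel (hurwitz_fun_inv i) (hurwitz_fun i).
Proof.
apply: (@presented_ext _ _ _ (hurwitz_fun i \o hurwitz_fun_inv i) idfun).
move=> k /=.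
rewrite -[pgen _ k]/(alpha k).
have [->|kl] := eqVneq k (lo i); first by rewrite hurwitz_inv_lo hurwitz_hi.
have [->|kh] := eqVneq k (hi i).
  rewrite hurwitz_inv_hi !gmulfM gmulfV_presented /= !hurwitz_hi hurwitz_lo.
  by rewrite -!mulgA mulKg mulVg mulg1.
by rewrite hurwitz_inv_other // hurwitz_other.
Qed.

Definition hurwitz_gen n (i : 'I_n.-1) : autg (Lambda n) :=
  Autg (@hurwitz_funK n i) (@hurwitz_fun_invK n i).

(* An antimorphism for the composition of automorphisms, hence a morphism for
   the left-to-right product of [autg]. *)
Definition hurwitz n : braid n -> autg (Lambda n) := plift (@hurwitz_gen n).

Lemma hurwitz_gen_rel n l r : @braid_rel n l r ->
  word_eval (@hurwitz_gen n) l = word_eval (@hurwitz_gen n) r.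
Proof.
have hM (i : 'I_n.-1) : {morph hurwitz_fun i : x y / x * y} by exact: gmulfM.
have hV (i : 'I_n.-1) : {morph hurwitz_fun i : x / x^-1}.
  by move=> x; apply: (gmulfV_presented (hurwitz_fun i)).
case=> i j ij; apply: autg_ext; rewrite /word_eval !big_cons big_nil !mulg1.
- have lohi : ((lo i == hi j) = false) * ((hi i == lo j) = false).
    split; rewrite -val_eqE /= ltn_eqF //.
    exact: leq_trans (ltnW ij) (leqnSn j).
  have lolo : (lo i == lo j) = false by rewrite -val_eqE /= ltn_eqF // ltnW.
  have hihi : (hi i == hi j) = false.
    by rewrite -val_eqE /= ltn_eqF // ltnS ltnW.
  apply: (@presented_ext _ _ _ (hurwitz_fun j \o hurwitz_fun i)
    (hurwitz_fun i \o hurwitz_fun j)) => k /=; rewrite -[pgen _ k]/(alpha k).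
  have li : hurwitz_fun j (alpha (lo i)) = alpha (lo i).
    by apply: hurwitz_other; rewrite ?lolo ?lohi.
  have h_i : hurwitz_fun j (alpha (hi i)) = alpha (hi i).
    by apply: hurwitz_other; rewrite ?lohi ?hihi.
  have lj : hurwitz_fun i (alpha (lo j)) = alpha (lo j).
    by apply: hurwitz_other; rewrite eq_sym ?lolo ?lohi.
  have hj : hurwitz_fun i (alpha (hi j)) = alpha (hi j).
    by apply: hurwitz_other; rewrite eq_sym ?lohi ?hihi.
  have [->|kli] := eqVneq k (lo i).
    by rewrite li hurwitz_lo !hM hV li h_i.
  have [->|khi] := eqVneq k (hi i).
    by rewrite h_i hurwitz_hi li.
  have [->|klj] := eqVneq k (lo j).
    by rewrite lj hurwitz_lo !hM hV lj hj.
  have [->|khj] := eqVneq k (hi j).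
    by rewrite hj hurwitz_hi lj.
  by rewrite !hurwitz_other.
- have hilo : hi i = lo j by apply: val_inj; rewrite /= ij.
  have loi_loj : (lo i == lo j) = false by rewrite -val_eqE /= ltn_eqF // -ij.
  have loi_hij : (lo i == hi j) = false.
    by rewrite -val_eqE /= ltn_eqF // -ij ltnW.
  apply: (@presented_ext _ _ _
    (hurwitz_fun i \o (hurwitz_fun j \o hurwitz_fun i))
    (hurwitz_fun j \o (hurwitz_fun i \o hurwitz_fun j))) => k /=.
  rewrite -[pgen _ k]/(alpha k).
  have a_j : hurwitz_fun j (alpha (lo i)) = alpha (lo i).
    by apply: hurwitz_other; rewrite ?loi_loj ?loi_hij.
  have c_i : hurwitz_fun i (alpha (hi j)) = alpha (hi j).
    by apply: hurwitz_other; rewrite -?hilo eq_sym ?loi_hij // hilo lo_neq_hi.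
  have b_i : hurwitz_fun i (alpha (lo j)) = alpha (lo i).
    by rewrite -hilo hurwitz_hi.
  have a_i : hurwitz_fun i (alpha (lo i)) =
      alpha (lo i) * alpha (lo j) * (alpha (lo i))^-1.
    by rewrite hurwitz_lo hilo.
  have b_j := hurwitz_lo j.
  have [->|ka] := eqVneq k (lo i).
    rewrite a_j a_i !hM !hV a_j b_j !hM !hV a_i b_i c_i.
    by rewrite !invgM invgK !mulgA !mulgVK.
  have [->|kb] := eqVneq k (lo j).
    by rewrite b_i a_j a_i b_j !hM !hV b_i c_i hurwitz_hi a_j.
  have [->|kc] := eqVneq k (hi j).
    by rewrite c_i hurwitz_hi b_i a_j.
  by rewrite !hurwitz_other // hilo.
Qed.

HB.instance Definition _ n := isMultiplicative.Build (braid n)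
  (autg (Lambda n)) (@hurwitz n) (pliftM (@hurwitz_gen_rel n)).

Lemma braid_perm_rel n l r : @braid_rel n l r ->
  word_eval (fun i => tperm (lo i) (hi i)) l =
  word_eval (fun i => tperm (lo i) (hi i)) r.
Proof.
case=> i j ij; rewrite /word_eval !big_cons big_nil !mulg1 /=.
- have lohi : ((lo i == hi j) = false) * ((hi i == lo j) = false).
    split; rewrite -val_eqE /= ltn_eqF //.
    exact: leq_trans (ltnW ij) (leqnSn j).
  have lolo : (lo i == lo j) = false by rewrite -val_eqE /= ltn_eqF // ltnW.
  have hihi : (hi i == hi j) = false.
    by rewrite -val_eqE /= ltn_eqF // ltnS ltnW.
  have ne := (eq_sym (lo j), eq_sym (hi j), lolo, hihi, lohi).
  rewrite [LHS]conjgC tpermJ.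
  by rewrite (@tpermD _ _ _ (lo i)) ?(@tpermD _ _ _ (hi i)) ?ne.
- have hilo : hi i = lo j by apply: val_inj; rewrite /= ij.
  have loi_loj : (lo i == lo j) = false by rewrite -val_eqE /= ltn_eqF // -ij.
  have loi_hij : (lo i == hi j) = false.
    by rewrite -val_eqE /= ltn_eqF // -ij ltnW.
  have e (x y : 'S_n) : x * x = 1 -> x * (y * x) = y ^ x.
    by move=> xx; rewrite conjgE; congr (_ * _); apply: (mulgI x); rewrite mulgV.
  have ac : hi j != lo i by rewrite eq_sym loi_hij.
  have cb : hi j != lo j by rewrite eq_sym lo_neq_hi.
  rewrite !e ?tperm2 // !tpermJ hilo tpermL tpermR.
  by rewrite (tpermD (x := lo i)) 1?eq_sym // tpermD // eq_sym ?loi_loj.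
Qed.

HB.instance Definition _ n := isMultiplicative.Build (braid n) 'S_n
  (@braid_perm n) (pliftM (@braid_perm_rel n)).

(** * Affine representations *)

Local Open Scope ring_scope.

(* [(a, b)] stands for the map [z |-> a z + b]. *)
Definition aff (F : fieldType) := {g : F * F | g.1 != 0}.

Section Affine.
Variable F : fieldType.

HB.instance Definition _ := Choice.on (aff F).

Definition lin (g : aff F) : F := (val g).1.
Definition trans (g : aff F) : F := (val g).2.
Definition aff_fun (g : aff F) (z : F) : F := lin g * z + trans g.

Lemma lin_neq0 g : lin g != 0. Proof. by case: g. Qed.

Lemma aff_ext (g h : aff F) : lin g = lin h -> trans g = trans h -> g = h.
Proof.
move=> gh gh'; apply: val_inj; move: gh gh'; rewrite /lin /trans.
by case: (val g) (val h) => [a b] [c d] /= -> ->.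
Qed.

Definition mk_aff (a b : F) (a0 : a != 0) : aff F :=
  exist (fun g : F * F => g.1 != 0) (a, b) a0.

Definition aff_one : aff F := mk_aff 0 (oner_neq0 F).
Definition aff_mul (g h : aff F) : aff F :=
  mk_aff (lin g * trans h + trans g) (mulf_neq0 (lin_neq0 g) (lin_neq0 h)).
Definition aff_inv (g : aff F) : aff F :=
  mk_aff (- ((lin g)^-1 * trans g)) (invr_neq0 (lin_neq0 g)).

Lemma aff_funM (g h : aff F) : aff_fun (aff_mul g h) =1 aff_fun g \o aff_fun h.
Proof. by move=> z /=; rewrite /aff_fun /= mulrDr mulrA addrA. Qed.

Lemma aff_mulA : associative aff_mul.
Proof.
move=> f g h; apply: aff_ext; rewrite /lin /trans /=; first exact: mulrA.
by rewrite mulrDr mulrA addrA.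
Qed.
Lemma aff_1mul : left_id aff_one aff_mul.
Proof.
by move=> g; apply: aff_ext; rewrite /lin /trans /= mul1r ?addr0.
Qed.
Lemma aff_mul1 : right_id aff_one aff_mul.
Proof.
by move=> g; apply: aff_ext; rewrite /lin /trans /= ?mulr1 ?mulr0 ?add0r.
Qed.
Lemma aff_mulV : left_inverse aff_one aff_inv aff_mul.
Proof.
move=> g; apply: aff_ext; rewrite /lin /trans /= ?subrr //.
exact/mulVf/lin_neq0.
Qed.
Lemma aff_Vmul : right_inverse aff_one aff_inv aff_mul.
Proof.
move=> g; have g0 := lin_neq0 g.
apply: aff_ext; rewrite /lin /trans /=; first exact: mulfV.
by rewrite mulrN mulVKf // addNr.
Qed.

HB.instance Definition _ := isGroup.Build (aff F)
  aff_mulA aff_1mul aff_mul1 aff_mulV aff_Vmul.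

End Affine.

Section Representations.
Variables (F : fieldType) (n : nat).

Definition affrep := {multiplicative Lambda n -> aff F}.

Definition linear_part (rho : affrep) : n.-tuple F :=
  [tuple lin (rho (alpha k)) | k < n].
Definition translation_part (rho : affrep) : n.-tuple F :=
  [tuple trans (rho (alpha k)) | k < n].

Definition conj_class (rho : affrep) : set affrep :=
  [set rho' | exists g : aff F, forall x, rho' x = (g * rho x * g^-1)%g].

Definition nontriv_index (lam : seq F) : nat := count (fun x => x != 1) lam.

(* The points of the projective space PH_lambda. *)
Definition PH (lam : n.-tuple F) : set (set affrep) :=
  [set conj_class rho | rho in
    [set rho | linear_part rho = lam /\
       ~ exists2 rho', conj_class rho rho' &
           forall k, trans (rho' (alpha k)) = 0]].

Definition braid_act (b : braid n) (rho : affrep) : affrep :=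
  rho \o hurwitz b.

Lemma braid_act_class (b : braid n) (rho : affrep) :
  braid_act b @` conj_class rho = conj_class (braid_act b rho).
Proof.
apply/seteqP; split=> [_ [rho' [g gP] <-]|rho' [g gP]].
  by exists g => x /=; rewrite gP.
have M : {morph (fun x => (g * rho x * g^-1)%g) : x y / (x * y)%g}.
  by move=> x y /=; rewrite gmulfM !mulgA mulgVK.
pose rhog : affrep := HB.pack (fun x => (g * rho x * g^-1)%g)
  (isMultiplicative.Build _ _ _ M).
exists rhog; first by exists g.
by apply: multiplicative_ext => x; rewrite gP.
Qed.

(* The orbit under the pure braid group of a point of PH_lambda. *)
Definition pb_orbit (p : set affrep) : set (set affrep) :=
  [set braid_act b @` p | b in @pure_braid n].

Definition represents (lam : n.-tuple F) (tau : seq F) : set (set affrep) :=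
  [set p | exists rho, [/\ linear_part rho = lam,
                           translation_part rho = tau :> seq F
                         & p = conj_class rho]].

Definition has_size (T : Type) (A : set T) (N : option nat) : Prop :=
  if N is Some k then (A #= `I_k)%card else infinite_set A.

(* [L] lists translation parts with the sizes of their orbits; [N] is the size
   of all the other orbits, [None] meaning that these are infinite. *)
Definition orbits_listed (lam : n.-tuple F) (L : seq (seq F * nat))
    (N : option nat) : Prop :=
  [/\ forall tau k, (tau, k) \in L ->
        exists2 p, (PH lam `&` represents lam tau) p &
          has_size (pb_orbit p) (Some k),
      forall e0 i j p q, (i < j < size L)%N ->
        represents lam (nth e0 L i).1 p -> represents lam (nth e0 L j).1 q ->
        pb_orbit p <> pb_orbit q
    & forall p, PH lam p ->
        ~ (exists e q, [/\ e \in L, represents lam e.1 q & pb_orbit q p]) ->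
        has_size (pb_orbit p) N].

End Representations.

Definition root_of_unity (F : fieldType) (a : F) : Prop :=
  exists2 k, (0 < k)%N & a ^+ k = 1.

(* [finite_table lam L N]: [lam] is one of the linear parts for 4 punctures
   admitting finite orbits, with orbits described by [L] and [N] in the sense
   of [orbits_listed]. *)
Inductive finite_table (F : fieldType) :
  seq F -> seq (seq F * nat) -> option nat -> Prop :=
| ImprimEven (a : F) (m : nat) : a ^+ 2 != 1 -> root_of_unity a ->
    m.-primitive_root (a ^+ 2) -> ~~ odd m ->
    finite_table [:: a; - a^-1; - a^-1; a]
      [:: ([:: 0; 1; a; 0], 2%N); ([:: 0; 0; 1; a], m);
          ([:: 0; 1; 0; - a ^+ 2], m)] (Some (2 * m)%N)
| ImprimOdd (a : F) (m : nat) : a ^+ 2 != 1 -> root_of_unity a ->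
    m.-primitive_root (a ^+ 2) -> odd m ->
    finite_table [:: a; - a^-1; - a^-1; a]
      [:: ([:: 0; 1; a; 0], 2%N); ([:: 0; 0; 1; a], m);
          ([:: 0; 2; 1 + a; a - a ^+ 2], m)] (Some (2 * m)%N)
| ImprimInf (a : F) : a ^+ 2 != 1 -> ~ root_of_unity a ->
    finite_table [:: a; - a^-1; - a^-1; a] [:: ([:: 0; 1; a; 0], 2%N)] None
| Tetra1 (eta : F) : 12.-primitive_root eta ->
    finite_table [:: eta; eta ^+ 5; eta ^+ 3; eta ^+ 3]
      [:: ([:: eta ^+ 3; 0; 0; 1], 4%N); ([:: 0; eta ^+ 5; -1; 0], 4%N);
          ([:: 0; 0; eta ^+ 3; -1], 6%N)] (Some 12%N)
| Tetra2 (zeta eta : F) : 6.-primitive_root zeta -> eta ^+ 2 = zeta ->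
    finite_table [:: -1; zeta; zeta; zeta]
      [:: ([:: 0; 0; zeta; -1], 4%N); ([:: 0; 1 - zeta ^+ 2; zeta; zeta], 4%N);
          ([:: 0; 1; zeta + eta; zeta ^+ 2 * eta + zeta - 1], 6%N)] (Some 12%N)
| Octa1 (eta : F) : 24.-primitive_root eta ->
    finite_table [:: eta; eta ^+ 5; eta ^+ 7; eta ^+ 11]
      [:: ([:: 0; 0; 1; eta ^+ 5], 6%N); ([:: 0; 1; 0; 1], 8%N);
          ([:: eta; 0; 0; 1], 12%N)] (Some 24%N)
| Octa2 (eta nu : F) : 12.-primitive_root eta -> nu ^+ 2 = eta ->
    finite_table [:: eta; - eta; eta ^+ 2; eta ^+ 2]
      [:: ([:: eta ^+ 4; 0; 0; 1], 6%N); ([:: 0; 0; eta ^+ 2; -1], 8%N);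
          ([:: 0; nu + eta ^+ 3; nu^-1; 1], 12%N)] (Some 24%N)
| Icosa1 (a : F) : 60.-primitive_root a ->
    finite_table [:: a; a ^+ 29; a ^+ 11; a ^+ 19]
      [:: ([:: 0; 1; 0; a ^+ 50], 12%N); ([:: 1; 0; 0; a ^+ 49], 20%N);
          ([:: 0; 0; 1; a ^+ 19], 30%N)] (Some 60%N)
| Icosa2 (b a : F) : 60.-primitive_root b -> a = b ^+ 3 ->
    finite_table [:: a; a ^+ 9; a ^+ 7; a ^+ 3]
      [:: ([:: a ^+ 12; 0; 0; a ^+ 5], 12%N);
          ([:: 0; b + a ^+ 5 + a ^+ 2 + a; 1 + a ^+ 3;
               (b + a) * (1 - a ^+ 3 * b)], 20%N);
          ([:: 0; 0; a ^+ 17; 1], 30%N)] (Some 60%N)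
| Icosa3 (b a : F) : 60.-primitive_root b -> a = b ^+ 2 ->
    finite_table [:: a ^+ 9; a ^+ 9; a; a ^+ 11]
      [:: ([:: 0; 0; a ^+ 16; 1], 12%N); ([:: a ^+ 10; 0; 0; a ^+ 6], 20%N);
          ([:: 0; (a + 1) * (a ^+ 11 + 1); b + a ^+ 14 - a ^+ 5 + a ^+ 4;
               (b + 1) * a ^+ 14 + a ^+ 4], 30%N)] (Some 60%N)
| Icosa4 (b a : F) : 60.-primitive_root b -> a = b ^+ 2 ->
    finite_table [:: a ^+ 5; a ^+ 5; a; a ^+ 19]
      [:: ([:: a ^+ 11; 0; 0; -1], 12%N); ([:: 0; 0; 1; a ^+ 14], 20%N);
          ([:: 0; 1; a ^+ 5 * (1 + b); a ^+ 4 * (a ^+ 10 - b)], 30%N)]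
      (Some 60%N)
| Icosa5 (b a : F) : 60.-primitive_root b -> a = b ^+ 4 ->
    finite_table [:: a; a ^+ 4; a ^+ 2; a ^+ 8]
      [:: ([:: a ^+ 12; 0; 0; - a ^+ 5], 12%N); ([:: 0; 0; a ^+ 2; -1], 20%N);
          ([:: 0;
               b ^+ 56 + b ^+ 13 + b ^+ 12 + b ^+ 8 - b ^+ 6 - b ^+ 2;
               1 + b ^+ 22; b ^+ 19 + b ^+ 18 - b ^+ 8], 30%N)] (Some 60%N)
| Icosa6 (b a c : F) : 60.-primitive_root b -> a = b ^+ 12 -> c = b ^+ 2 ->
    finite_table [:: - a; - a; - a; - a ^+ 2]
      [:: ([:: 0; 0; a; 1], 12%N);
          ([:: 0; c ^+ 5 + c ^+ 4 - 1; c ^+ 4 + c - a; a * c - c ^+ 5], 20%N);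
          ([:: 0; b ^+ 11 + b ^+ 9 - b; b ^+ 9 - 1;
               a * (b ^+ 6 + b ^+ 3)], 30%N)] (Some 60%N).

(* Main.v *)
From Stdlib Require Import ZArith.
From HB Require Import structures.
Require Import Defs.
From mathcomp Require Import all_boot all_order all_fingroup all_algebra.
From mathcomp Require Import cyclic separable cyclotomic boolp.
From mathcomp Require Import ring lra zify ssrZ.
Set Implicit Arguments.
Unset Strict Implicit.
Unset Printing Implicit Defensive.
Import generic_quotient Order.TTheory GRing.Theory Num.Theory.
Local Open Scope ring_scope.


(** * Projective transformations of the line *)

(** A representation is a tuple of affine maps with product 1, and braids act on such tuples by
    Hurwitz moves ([imgs_sig]). Pure braids have finite index, so a point of PH_lambda has a finite
    orbit exactly when the full Hurwitz orbit of its tuple is finite up to simultaneous conjugation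
    ([fin_orb_finite], [finite_fin_orb]).

    For four punctures PH_lambda is a projective line, with coordinates the differences of the fixed
    points of the first three maps. The relation makes the square of the third generator act as that
    of the first and makes full twists of three strands act trivially, so pure orbits are the orbits
    of the group generated by two explicit matrices ([pure_erel], [pb_orbit_pts]). A finite orbit
    with at least three points makes this group finite modulo scalars, and counting fixed points
    leaves a common fixed point, a stable pair, or only elements of order at most 5
    ([finite_mobius]). No linear part being 1 excludes a common fixed point; a stable pair gives the
    imprimitive family, where suitable coordinates turn the generators into the inversion and a
    homothety. In the last case, polynomial conditions on the traces and determinants of a few words
    make the linear parts 120th roots of unity, and a search through the exponents leaves the
    tables, up to permutation and the choice of the primitive root ([classify_exps], [quad_table]).

    Conversely, the listed orbits of the tetrahedral, octahedral and icosahedral cases are computed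
    exactly in cyclotomic fields. Three orbits with N + 2 points in all, where N divides the lcm of
    their sizes, force the group to have order N and all other orbits to be free ([free_orbit]).

    For more punctures, multiplying two neighbours keeps orbits finite ([fin_orb_merge]); after
    suitable moves, the product is not a translation and the shorter tuple has no common fixed point
    ([fin_lin_merge]). So five punctures reduce to four, six to five, seven to six, where nothing
    survives. Conversely, for six maps with the same linear part of order 6, moves act on the
    differences of the translation parts through Eisenstein integers and preserve a finite set of
    linear forms containing the coordinates ([fin_orb_six]); five maps follow by splitting the
    special one into a square ([fin_orb_five]). *)

Section LinearCombination.
Variable R : comNzRingType.
Implicit Types k a b l r : R.

(** Certificates: the coefficients are supplied by hand and [ring] or [field] checks the
    combination. *)
Lemma lincomb1 k1 a1 b1 l r :
  a1 = b1 -> l - r = k1 * (a1 - b1) -> l = r.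
Proof. by move=> -> /eqP; rewrite subrr mulr0 subr_eq0 => /eqP. Qed.

Lemma lincomb2 k1 k2 a1 b1 a2 b2 l r : a1 = b1 -> a2 = b2 ->
  l - r = k1 * (a1 - b1) + k2 * (a2 - b2) -> l = r.
Proof. by move=> -> -> /eqP; rewrite !subrr !mulr0 addr0 subr_eq0 => /eqP. Qed.

End LinearCombination.

Section ProjLine.
Variable F : numClosedFieldType.
Implicit Types (p q r : F * F) (x y z : option F).

(* [(a, b, c, d)] is the matrix with rows [(a, b)] and [(c, d)]. *)
Definition mat2 := (F * F * F * F)%type.
Implicit Types M N : mat2.

Definition mapply M p : F * F :=
  let: (a, b, c, d) := M in (a * p.1 + b * p.2, c * p.1 + d * p.2).
Definition mmul M N : mat2 :=
  let: (a, b, c, d) := M in let: (a', b', c', d') := N in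
  (a * a' + b * c', a * b' + b * d', c * a' + d * c', c * b' + d * d').
Definition madj M : mat2 := let: (a, b, c, d) := M in (d, - b, - c, a).
Definition mone : mat2 := (1, 0, 0, 1).
Definition mdet M : F := let: (a, b, c, d) := M in a * d - b * c.
Definition mtr M : F := let: (a, b, c, d) := M in a + d.
Definition mscal M : bool :=
  let: (a, b, c, d) := M in [&& b == 0, c == 0 & a == d].
Definition mdisc M : F := mtr M ^+ 2 - 4 * mdet M.
Definition mexp M k : mat2 := iter k (mmul M) mone.
Arguments mexp : simpl never.
Definition cross p q : F := p.1 * q.2 - p.2 * q.1.

(* The point [(u : v)] of the projective line is [Some (v / u)], or [None] when
   [u = 0]. *)
Definition ppt p : option F := if p.1 == 0 then None else Some (p.2 / p.1).
Definition prep x : F * F := if x is Some s then (1, s) else (0, 1).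
Definition mob M x : option F := ppt (mapply M (prep x)).

Lemma mapplyM M N p : mapply (mmul M N) p = mapply M (mapply N p).
Proof.
by case: M N p => [[[a b] c] d] [[[a' b'] c'] d'] [u v] /=; congr pair; ring.
Qed.

Lemma mdetM M N : mdet (mmul M N) = mdet M * mdet N.
Proof. by case: M N => [[[a b] c] d] [[[a' b'] c'] d'] /=; ring. Qed.

Lemma mdet_adj M : mdet (madj M) = mdet M.
Proof. by case: M => [[[a b] c] d] /=; ring. Qed.

Lemma mmulA M N P : mmul M (mmul N P) = mmul (mmul M N) P.
Proof.
case: M N P => [[[a b] c] d] [[[a' b'] c'] d'] [[[a2 b2] c2] d2] /=.
by congr (_, _, _, _); ring.
Qed.

Lemma mapply_adj M p :
  mapply (madj M) (mapply M p) = (mdet M * p.1, mdet M * p.2).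
Proof. by case: M p => [[[a b] c] d] [u v] /=; congr pair; ring. Qed.

Lemma mapply_neq0 M p : mdet M != 0 -> p != 0 -> mapply M p != 0.
Proof.
move=> M0; apply: contraNneq => Mp0.
have := mapply_adj M p; rewrite Mp0.
have -> : mapply (madj M) 0 = 0.
  by case: (M) => [[[a b] c] d] /=; rewrite !mulr0 !addr0.
case: p {Mp0} => u v [] /= /esym/eqP + /esym/eqP.
by rewrite !mulf_eq0 (negPf M0) /= => /eqP -> /eqP ->.
Qed.

Lemma prep_neq0 x : prep x != 0.
Proof.
by case: x => [s|]; rewrite -[0]/(0, 0) xpair_eqE oner_eq0 ?andbF.
Qed.

Lemma prepK : cancel prep ppt.
Proof. by case=> [s|] /=; rewrite /ppt /= ?eqxx // oner_eq0 divr1. Qed.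

Lemma ppt_eq p q : p != 0 -> q != 0 -> (ppt p == ppt q) = (cross p q == 0).
Proof.
case: p q => u v [u' v'] p0 q0; rewrite /ppt /cross /=.
have [u0|u0] := eqVneq u 0; have [u'0|u'0] := eqVneq u' 0.
- by rewrite u0 u'0 mul0r mulr0 subrr !eqxx.
- rewrite u0 mul0r sub0r oppr_eq0 mulf_eq0 (negPf u'0) orbF.
  by apply/esym/negbTE; apply: contraNneq p0 => ->; rewrite u0.
- rewrite u'0 mulr0 subr0 mulf_eq0 (negPf u0) /=.
  by apply/esym/negbTE; apply: contraNneq q0 => ->; rewrite u'0.
- rewrite (inj_eq Some_inj) subr_eq0 eqr_div // [RHS]eq_sym.
  by rewrite (mulrC u v').
Qed.

Lemma cross_prep_ppt p : cross p (prep (ppt p)) = 0.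
Proof.
case: p => u v; rewrite /cross /ppt /=; have [->|u0] /= := eqVneq u 0.
  by rewrite mul0r mulr0 subrr.
by rewrite mulr1 mulrC divfK ?subrr.
Qed.

Lemma cross_mapply M p q : cross (mapply M p) (mapply M q) = mdet M * cross p q.
Proof. by case: M p q => [[[a b] c] d] [u v] [u' v']; rewrite /cross /=; ring. Qed.

Lemma mob_ppt M p : mdet M != 0 -> p != 0 -> mob M (ppt p) = ppt (mapply M p).
Proof.
move=> M0 p0; apply/eqP; rewrite eq_sym ppt_eq ?mapply_neq0 ?prep_neq0 //.
by rewrite cross_mapply cross_prep_ppt mulr0.
Qed.

Lemma mobM M N x : mdet M != 0 -> mdet N != 0 ->
  mob (mmul M N) x = mob M (mob N x).
Proof.
by move=> M0 N0; rewrite [mob N x]/mob mob_ppt ?mapply_neq0 ?prep_neq0 // -mapplyM.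
Qed.

Lemma mob1 x : mob mone x = x.
Proof.
rewrite /mob [mapply _ _](_ : _ = prep x) ?prepK //.
by case: (prep x) => u v /=; congr pair; ring.
Qed.

Lemma mob_adjK M : mdet M != 0 -> cancel (mob M) (mob (madj M)).
Proof.
move=> M0 x; rewrite -mobM ?mdet_adj // -[RHS]prepK; apply/eqP.
rewrite ppt_eq ?prep_neq0 ?mapply_neq0 ?prep_neq0 ?mdetM ?mdet_adj ?mulf_neq0 //.
by rewrite mapplyM mapply_adj /cross /=; apply/eqP; ring.
Qed.

Lemma madjK M : madj (madj M) = M.
Proof. by case: M => [[[a b] c] d] /=; rewrite !opprK. Qed.

Lemma mob_adjVK M : mdet M != 0 -> cancel (mob (madj M)) (mob M).
Proof. by move=> M0 x; rewrite -{1}[M]madjK mob_adjK ?mdet_adj. Qed.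

Lemma mob_inj M : mdet M != 0 -> injective (mob M).
Proof. by move=> M0; apply: can_inj (mob_adjK M0). Qed.

Lemma mob_fixE M x : mdet M != 0 ->
  (mob M x == x) = (cross (prep x) (mapply M (prep x)) == 0).
Proof.
move=> M0; rewrite -{2}[x]prepK eq_sym ppt_eq ?mapply_neq0 ?prep_neq0 //.
Qed.

Lemma mscal_mob M x : mdet M != 0 -> mscal M -> mob M x = x.
Proof.
case: M => [[[a b] c] d] M0 /and3P[/eqP b0 /eqP c0 /eqP ad].
by apply/eqP; rewrite mob_fixE // /cross b0 c0 ad /=; apply/eqP; ring.
Qed.


(** Fixed points are eigenlines, and a 2 by 2 matrix with three eigenlines is scalar. *)
Lemma three_fixed M x y z : mdet M != 0 -> x != y -> y != z -> x != z ->
  mob M x = x -> mob M y = y -> mob M z = z -> mscal M.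
Proof.
case: M => [[[a b] c] d] M0 xy yz xz /eqP + /eqP + /eqP.
rewrite !mob_fixE // /cross /mscal.
have key (s t : F) : Some s != Some t -> s - t != 0 by rewrite subr_eq0.
(* The point [None] is fixed exactly when b = 0; two finite fixed points then suffice. *)
have fin (s t : F) : Some s != Some t -> b = 0 -> c + d * s = s * a ->
    c + d * t = t * a -> [&& b == 0, c == 0 & a == d].
  move=> /key st -> es et; have : (s - t) * (d - a) = 0 by apply: (lincomb2 (k1 := 1) (k2 := -1) es et); ring.
  move/eqP; rewrite mulf_eq0 (negPf st) /= subr_eq0 eqxx => /eqP da.
  by move: es; rewrite da mulrC => /eqP; rewrite -subr_eq0 addrK => ->; rewrite eqxx.
case: x y z xy yz xz => [s|] [t|] [r|] // xy yz xz /=;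
  rewrite ?(mul0r, mulr0, mul1r, mulr1, add0r, sub0r, oppr_eq0).
- rewrite !subr_eq0 => /eqP e1 /eqP e2 /eqP e3.
  have e4 : (s - t) * (d - a - b * (s + t)) = 0 by apply: (lincomb2 (k1 := 1) (k2 := -1) e1 e2); ring.
  have e5 : (t - r) * (d - a - b * (t + r)) = 0 by apply: (lincomb2 (k1 := 1) (k2 := -1) e2 e3); ring.
  have /eqP := e4; rewrite mulf_eq0 (negPf (key _ _ xy)) /= => /eqP e6.
  have /eqP := e5; rewrite mulf_eq0 (negPf (key _ _ yz)) /= => /eqP e7.
  have : (s - r) * b = 0 by apply: (lincomb2 (k1 := -1) (k2 := 1) e6 e7); ring.
  move/eqP; rewrite mulf_eq0 (negPf (key _ _ xz)) /= => /eqP b0.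
  by apply: (fin s t) => //; rewrite ?e1 ?e2 b0 mul0r addr0.
- rewrite !subr_eq0 => /eqP e1 /eqP e2 /eqP b0.
  by apply: (fin s t) => //; rewrite ?e1 ?e2 b0 mul0r addr0.
- rewrite !subr_eq0 => /eqP e1 /eqP b0 /eqP e2.
  by apply: (fin s r) => //; rewrite ?e1 ?e2 b0 mul0r addr0.
- rewrite !subr_eq0 => /eqP b0 /eqP e1 /eqP e2.
  by apply: (fin t r) => //; rewrite ?e1 ?e2 b0 mul0r addr0.
Qed.

Lemma two_fixed M : mdet M != 0 -> mdisc M != 0 ->
  exists x y, [/\ x != y, mob M x = x & mob M y = y].
Proof.
case: M => [[[a b] c] d] M0; rewrite /mdisc /mtr => disc0.
(* If b = 0, infinity is one of the points; otherwise both are roots of b s^2 + (a - d) s - c, whose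
   discriminant is [mdisc]. *)
have [b0|b0] := eqVneq b 0.
  have da : a - d != 0.
    apply: contraNneq disc0 => ad; rewrite b0 /=; apply/eqP.
    by apply: (lincomb1 (k1 := a - d) ad); ring.
  exists None, (Some (c / (a - d))); split=> //; apply/eqP; rewrite mob_fixE //.
    by rewrite /cross /= b0; apply/eqP; ring.
  by rewrite /cross /= b0; apply/eqP; field.
pose s := sqrtC ((a + d) ^+ 2 - 4 * mdet (a, b, c, d)).
have s2 : s ^+ 2 = (a + d) ^+ 2 - 4 * (a * d - b * c) by rewrite sqrtCK.
have s0 : s != 0 by rewrite sqrtC_eq0.
have two : 2 != 0 :> F by rewrite pnatr_eq0.
have root t : t ^+ 2 = s ^+ 2 -> mob (a, b, c, d) (Some ((d - a + t) / (2 * b)))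
    = Some ((d - a + t) / (2 * b)).
  rewrite s2 => t2; apply/eqP; rewrite mob_fixE // /cross /=.
  have e : 4 * b * (1 * (c * 1 + d * ((d - a + t) / (2 * b))) -
    (d - a + t) / (2 * b) * (a * 1 + b * ((d - a + t) / (2 * b)))) = 0.
    by apply: (lincomb1 (k1 := -1) t2); field.
  move/eqP: e; rewrite mulf_eq0 mulf_eq0 (negPf b0) orbF.
  by rewrite pnatr_eq0 /=.
exists (Some ((d - a + s) / (2 * b))), (Some ((d - a - s) / (2 * b))).
split; [|exact: root|by apply: root; rewrite sqrrN].
rewrite (inj_eq Some_inj); apply: contraNneq s0 => e.
apply/eqP; have : 2 * s / (2 * b) = 0 by apply: (lincomb1 (k1 := 1) e); field.
by move/eqP; rewrite !mulf_eq0 invr_eq0 mulf_eq0 (negPf two) (negPf b0) /= orbF => /eqP.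
Qed.

Lemma mexpS M k : mexp M k.+1 = mmul M (mexp M k).
Proof. by []. Qed.

Lemma mdet_exp M k : mdet M != 0 -> mdet (mexp M k) != 0.
Proof.
move=> M0; elim: k => [|k IHk]; last by rewrite mexpS mdetM mulf_neq0.
by rewrite /= mul0r subr0 mulr1 oner_eq0.
Qed.

Lemma mob_exp M k x : mdet M != 0 -> mob (mexp M k) x = iter k (mob M) x.
Proof.
move=> M0; elim: k => [|k IHk]; first exact: mob1.
by rewrite mexpS mobM ?mdet_exp // IHk.
Qed.

(** With zero discriminant, M - e has square zero for the double eigenvalue e, so the binomial
    formula has only two terms. *)
Lemma mexp_disc0 a b c d k : let e := (a + d) / 2 in mdisc (a, b, c, d) = 0 ->
  mexp (a, b, c, d) k.+1 = (e ^+ k.+1 + k.+1%:R * e ^+ k * (a - e),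
    k.+1%:R * e ^+ k * b, k.+1%:R * e ^+ k * c,
    e ^+ k.+1 + k.+1%:R * e ^+ k * (d - e)).
Proof.
move=> e; rewrite /mdisc /= => disc0.
have two : 2 != 0 :> F by rewrite pnatr_eq0.
have d2 : 2 * e - a = d by rewrite /e; field.
have bc : b * c = - (a - e) ^+ 2.
  by apply: (lincomb1 (k1 := 1 / 4) disc0); rewrite -d2; field.
elim: k => [|k IHk].
  by rewrite /mexp /= ?expr0 ?expr1; congr (_, _, _, _); ring.
rewrite mexpS IHk /mmul -d2 !exprS -[k.+2]addn1 natrD.
move: (e ^+ k) (k.+1%:R) => ek n.
congr (_, _, _, _); first by apply: (lincomb1 (k1 := n * ek) bc); ring.
- by ring.
- by ring.
- by apply: (lincomb1 (k1 := n * ek) bc); ring.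
Qed.

(** In characteristic 0, a power of a nontrivial Jordan block is never scalar. *)
Lemma mscal_exp_disc M k : mdet M != 0 -> mscal (mexp M k.+1) -> ~~ mscal M ->
  mdisc M != 0.
Proof.
case: M => [[[a b] c] d] M0 + nM; apply: contraTneq => disc0.
rewrite mexp_disc0 //; set e := (a + d) / 2.
have two : 2 != 0 :> F by rewrite pnatr_eq0.
have e0 : e != 0.
  apply: contraNneq M0 => /eqP; rewrite mulf_eq0 invr_eq0 (negPf two) orbF => /eqP tr0.
  move: disc0; rewrite /mdisc /mtr tr0 expr0n /= sub0r => /eqP.
  by rewrite oppr_eq0 mulf_eq0 pnatr_eq0 /= => /eqP->.
have f0 : k.+1%:R * e ^+ k != 0 by rewrite mulf_neq0 ?pnatr_eq0 ?expf_neq0.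
apply: contra nM; rewrite /mscal => /and3P[].
rewrite !(mulf_eq0 (_ * _)) (negPf f0) /= => -> -> /=.
by rewrite (inj_eq (addrI _)) => /eqP /(mulfI f0) /addIr ->.
Qed.

End ProjLine.

(** * Groups generated by two projective transformations *)

Section Generated.
Variables (F : numClosedFieldType) (A B : mat2 F).
Implicit Types (M N : mat2 F) (x y z : option F).

(** Adjugates replace inverses, from which they differ by a scalar, so that words stay polynomial in
    the entries. *)
Inductive mgen : mat2 F -> Prop :=
| MgenOne : mgen (mone F)
| MgenL M : mgen M -> mgen (mmul A M)
| MgenR M : mgen M -> mgen (mmul B M)
| MgenLV M : mgen M -> mgen (mmul (madj A) M)
| MgenRV M : mgen M -> mgen (mmul (madj B) M).

Lemma mmul1 (M : mat2 F) : mmul M (mone F) = M.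
Proof. by case: M => [[[a b] c] d] /=; congr (_, _, _, _); ring. Qed.

Lemma mmul1l (M : mat2 F) : mmul (mone F) M = M.
Proof. by case: M => [[[a b] c] d] /=; congr (_, _, _, _); ring. Qed.

Lemma madjM (M N : mat2 F) : madj (mmul M N) = mmul (madj N) (madj M).
Proof.
by case: M N => [[[a b] c] d] [[[a' b'] c'] d'] /=; congr (_, _, _, _); ring.
Qed.

Lemma mgenM M N : mgen M -> mgen N -> mgen (mmul M N).
Proof.
elim=> [|M' _ IH|M' _ IH|M' _ IH|M' _ IH] gN; rewrite ?mmul1l -?mmulA //.
- by apply: MgenL; apply: IH.
- by apply: MgenR; apply: IH.
- by apply: MgenLV; apply: IH.
- by apply: MgenRV; apply: IH.
Qed.

Lemma mgen_genL : mgen A.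
Proof. by rewrite -[A]mmul1; apply/MgenL/MgenOne. Qed.
Lemma mgen_genR : mgen B.
Proof. by rewrite -[B]mmul1; apply/MgenR/MgenOne. Qed.

Lemma mgen_adj M : mgen M -> mgen (madj M).
Proof.
elim=> [|M' _ IH|M' _ IH|M' _ IH|M' _ IH].
- by rewrite (_ : madj _ = mone F); [apply: MgenOne | rewrite /= oppr0].
- by rewrite madjM; apply: mgenM IH _; rewrite -[madj A]mmul1; apply/MgenLV/MgenOne.
- by rewrite madjM; apply: mgenM IH _; rewrite -[madj B]mmul1; apply/MgenRV/MgenOne.
- by rewrite madjM madjK; apply: mgenM IH mgen_genL.
- by rewrite madjM madjK; apply: mgenM IH mgen_genR.
Qed.

Lemma mgen_exp M k : mgen M -> mgen (mexp M k).
Proof.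
move=> gM; elim: k => [|k IHk]; first exact: MgenOne.
by rewrite mexpS; apply: mgenM.
Qed.

Hypotheses (A0 : mdet A != 0) (B0 : mdet B != 0).

Lemma mgen_det M : mgen M -> mdet M != 0.
Proof.
by elim=> [|M' _ IH|M' _ IH|M' _ IH|M' _ IH];
  rewrite ?mdetM ?mdet_adj ?mulf_neq0 //= mulr1 mulr0 subr0 oner_eq0.
Qed.

Lemma mob_eq_three M N x y z : mdet M != 0 -> mdet N != 0 ->
  x != y -> y != z -> x != z -> mob M x = mob N x -> mob M y = mob N y ->
  mob M z = mob N z -> forall t, mob M t = mob N t.
Proof.
move=> M0 N0 xy yz xz ex ey ez t.
have D0 : mdet (mmul (madj N) M) != 0 by rewrite mdetM mdet_adj mulf_neq0.
have E w : mob (mmul (madj N) M) w = mob (madj N) (mob M w).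
  by rewrite mobM ?mdet_adj.
have sc : mscal (mmul (madj N) M).
  by apply: (three_fixed D0 xy yz xz); rewrite E ?ex ?ey ?ez mob_adjK.
by have := mscal_mob t D0 sc; rewrite E => e; rewrite -[t in RHS]e mob_adjVK.
Qed.

Section Stable.
Variable Om : seq (option F).
Hypotheses (OmA : {in Om, forall x, mob A x \in Om})
  (OmB : {in Om, forall x, mob B x \in Om}).

(** An injective map of a finite set to itself is onto. *)
Lemma stable_adj M : mdet M != 0 -> {in Om, forall x, mob M x \in Om} ->
  {in Om, forall x, mob (madj M) x \in Om}.
Proof.
move=> M0 OmM.
pose f (w : seq_sub Om) : seq_sub Om := SeqSub (OmM _ (valP w)).
have f_inj : injective f.
  by move=> v w /(congr1 val) /= /(mob_inj M0) /val_inj.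
move=> x xOm; have <- : mob M (val (invF f_inj (SeqSub xOm))) = x.
  by have /(congr1 val) := f_invF f_inj (SeqSub xOm).
by rewrite mob_adjK //; apply: valP.
Qed.

Lemma mgen_stable M : mgen M -> {in Om, forall x, mob M x \in Om}.
Proof.
elim=> [|M' gM IH|M' gM IH|M' gM IH|M' gM IH] x xOm; first by rewrite mob1.
- by rewrite mobM ?(mgen_det gM) //; apply/OmA/IH.
- by rewrite mobM ?(mgen_det gM) //; apply/OmB/IH.
- by rewrite mobM ?mdet_adj ?(mgen_det gM) //; apply/(stable_adj A0 OmA)/IH.
- by rewrite mobM ?mdet_adj ?(mgen_det gM) //; apply/(stable_adj B0 OmB)/IH.
Qed.

Local Notation T := (seq_sub Om).

Definition realizes (M : mat2 F) (h : {perm T}) : Prop :=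
  forall w : T, mob M (val w) = val (h w).

Lemma mgen_perm M : mgen M -> exists h, realizes M h.
Proof.
move=> gM; pose f (w : T) : T := SeqSub (mgen_stable gM (valP w)).
have f_inj : injective f.
  by move=> v w /(congr1 val) /= /(mob_inj (mgen_det gM)) /val_inj.
by exists (perm f_inj) => w; rewrite permE.
Qed.

(** The group is seen through its permutations of [Om], so that the theory of finite group actions
    applies. *)
Definition mob_set : {set {perm T}} :=
  [set h | `[< exists2 M, mgen M & realizes M h >]].

Lemma mob_set_group : group_set mob_set.
Proof.
apply/group_setP; split.
  rewrite inE; apply/asboolP; exists (mone F); first exact: MgenOne.
  by move=> w; rewrite mob1 perm1.
move=> g h; rewrite !inE => /asboolP[M gM Mg] /asboolP[N gN Nh].
apply/asboolP; exists (mmul N M); first exact: mgenM.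
by move=> w; rewrite mobM ?mgen_det // Mg Nh permM.
Qed.

Canonical mob_group : {group {perm T}} := Group mob_set_group.

Lemma mob_groupP h : h \in mob_group -> exists2 M, mgen M & realizes M h.
Proof. by rewrite inE => /asboolP. Qed.

Hypothesis (Om_uniq : uniq Om) (Om3 : (2 < size Om)%N).

(** [Om] has at least three points, so the permutation is trivial only for scalar matrices, by
    [three_fixed]. *)
Lemma realizes_one M h : mdet M != 0 -> realizes M h -> mscal M = (h == 1%g).
Proof.
move=> M0 Mh; apply/idP/eqP => [sM|h1].
  by apply/permP => w; apply: val_inj; rewrite -Mh mscal_mob // perm1.
have fix_ w : w \in Om -> mob M w = w.
  by move=> wOm; rewrite -[w]/(val (SeqSub wOm)) Mh h1 perm1.
have n x i j : (i < j < size Om)%N -> nth x Om i != nth x Om j.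
  by move=> /andP[ij js]; rewrite nth_uniq ?ltn_eqF // (ltn_trans ij).
by apply: (@three_fixed _ M (nth None Om 0) (nth None Om 1) (nth None Om 2));
   rewrite ?n ?fix_ ?mem_nth ?Om3 //; apply: leq_trans Om3.
Qed.

Lemma realizes_inj M N h : mgen M -> mgen N -> realizes M h -> realizes N h ->
  mob M =1 mob N.
Proof.
move=> gM gN Mh Nh.
have n x i j : (i < j < size Om)%N -> nth x Om i != nth x Om j.
  by move=> /andP[ij js]; rewrite nth_uniq ?ltn_eqF // (ltn_trans ij).
have e w : w \in Om -> mob M w = mob N w.
  by move=> wOm; rewrite -[w]/(val (SeqSub wOm)) Mh Nh.
by apply: (@mob_eq_three M N (nth None Om 0) (nth None Om 1) (nth None Om 2));
   rewrite ?n ?e ?mem_nth ?mgen_det ?Om3 //; apply: leq_trans Om3.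
Qed.

Lemma mem_fixE M h (S : {set T}) w : realizes M h ->
  (w \in 'Fix_(S | 'P)[h])%g = (w \in S) && (mob M (val w) == val w).
Proof.
by move=> Mh; rewrite inE Mh; congr (_ && _); rewrite (inj_eq val_inj);
  apply/afix1P/eqP.
Qed.

Lemma card_fix_le2 h (S : {set T}) : h \in mob_group -> h != 1%g ->
  (#|'Fix_(S | 'P)[h]%g| <= 2)%N.
Proof.
move=> /mob_groupP[M gM Mh] h1; rewrite leqNgt; apply/negP => /card_gt2P.
have fixE w : w \in ('Fix_(S | 'P)[h])%g -> mob M (val w) = val w.
  by rewrite (mem_fixE _ _ Mh) => /andP[_ /eqP].
case=> u [v [w [[/fixE fu /fixE fv /fixE fw] [uv vw wu]]]].
move: h1; rewrite -(realizes_one (mgen_det gM) Mh) => /negP; apply.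
by apply: (three_fixed (mgen_det gM) _ _ _ fu fv fw); rewrite (inj_eq val_inj) // eq_sym.
Qed.

Lemma realizes_exp M h k : mdet M != 0 -> realizes M h ->
  realizes (mexp M k) (h ^+ k)%g.
Proof.
move=> M0 Mh w; rewrite mob_exp // permX.
elim: k w => [//|k IHk] w; rewrite !iterSr Mh; exact: IHk.
Qed.

Lemma mob_group_disc M h : mgen M -> realizes M h -> h != 1%g -> mdisc M != 0.
Proof.
move=> gM Mh h1; have M0 := mgen_det gM.
apply: (@mscal_exp_disc _ M #[h]%g.-1) => //; last by rewrite (realizes_one M0 Mh).
rewrite prednK ?order_gt0 // (realizes_one (mdet_exp _ M0) (realizes_exp _ M0 Mh)).
by rewrite expg_order.
Qed.

End Stable.
End Generated.

(* The diophantine part of the classification of finite rotation groups: [os]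
   lists the sizes of the orbits with nontrivial stabilizers. *)
Lemma rotation_orbits (N : nat) (os : seq nat) : (1 < N)%N ->
    (forall o, o \in os -> exists2 n, (1 < n)%N & (o * n = N)%N) ->
    (size os * N = sumn os + 2 * N.-1)%N ->
  [\/ 1%N \in os, 2%N \in os |
      forall o n, o \in os -> (o * n = N)%N -> n \in [:: 2; 3; 4; 5]%N].
Proof.
move=> N1 os_dvd eN.
(* Stabilizers have order at least 2, so each orbit has at most N / 2 points; the counting equation
   then leaves fewer than four orbits. *)
have os_half : (2 * sumn os <= size os * N)%N.
  elim: os os_dvd {eN} => [//|o os IH] os_dvd /=.
  have [|n n1 oN] := os_dvd o; first by rewrite inE eqxx.
  have := IH (fun o' ho' => os_dvd o' (mem_behead (s := o :: os) ho')).
  nia.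
have : (size os < 4)%N by rewrite ltnNge; apply/negP => s4; nia.
case: os os_dvd eN os_half => [|o1 [|o2 [|o3 [|//]]]] os_dvd /= eN _ _.
- lia.
- have [|n1 n1_gt e1] := os_dvd o1; first by rewrite inE eqxx.
  have : (0 < o1)%N by nia. lia.
- have [|n1 n1_gt e1] := os_dvd o1; first by rewrite inE eqxx.
  have [|n2 n2_gt e2] := os_dvd o2; first by rewrite !inE eqxx orbT.
  constructor 1; rewrite !inE; have : (0 < o1)%N by nia. have : (0 < o2)%N by nia.
  lia.
have [->|o1_1] := eqVneq o1 1%N; first by constructor 1; rewrite !inE.
have [->|o2_1] := eqVneq o2 1%N; first by constructor 1; rewrite !inE orbT.
have [->|o3_1] := eqVneq o3 1%N; first by constructor 1; rewrite !inE !orbT.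
have [->|o1_2] := eqVneq o1 2%N; first by constructor 2; rewrite !inE.
have [->|o2_2] := eqVneq o2 2%N; first by constructor 2; rewrite !inE orbT.
have [->|o3_2] := eqVneq o3 2%N; first by constructor 2; rewrite !inE !orbT.
constructor 3.
have [|n1 n1_gt e1] := os_dvd o1; first by rewrite inE eqxx.
have [|n2 n2_gt e2] := os_dvd o2; first by rewrite !inE eqxx orbT.
have [|n3 n3_gt e3] := os_dvd o3; first by rewrite !inE eqxx !orbT.
have p1 : (2 < o1)%N by case: (o1) o1_1 o1_2 e1 => [|[|[|]]] //; lia.
have p2 : (2 < o2)%N by case: (o2) o2_1 o2_2 e2 => [|[|[|]]] //; lia.
have p3 : (2 < o3)%N by case: (o3) o3_1 o3_2 e3 => [|[|[|]]] //; lia.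
(* The classical inequality 1/k + 1/l + 1/m > 1 with k <= l <= m: it forces k = 2, then l = 2 would
   give c = 2, l = 3 gives m < 6, and l >= 4 contradicts m >= 6. *)
have key (a b c k l m : nat) : (2 < a)%N -> (2 < b)%N -> (2 < c)%N ->
    (1 < k)%N -> (1 < l)%N -> (1 < m)%N -> (a * k = N)%N -> (b * l = N)%N ->
    (c * m = N)%N -> (a + b + c = N + 2)%N -> (k <= l)%N -> (l <= m)%N -> (m < 6)%N.
  move=> a3 b3 c3 k1 l1 m1 ak bl cm abc kl lm; rewrite ltnNge; apply/negP => m6.
  have k2 : k = 2%N.
    apply/eqP; rewrite eqn_leq k1 andbT leqNgt; apply/negP => k3; nia.
  have [l2|l3] : l = 2%N \/ (3 <= l)%N by lia.
    by subst; lia.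
  have [l3'|l4] : l = 3%N \/ (4 <= l)%N by lia.
    by subst; nia.
  nia.
have e : (o1 + o2 + o3 = N + 2)%N by lia.
have [b1 [b2 b3]] : (n1 < 6 /\ n2 < 6 /\ n3 < 6)%N.
  have [l12|l21] := leqP n1 n2; have [l23|l32] := leqP n2 n3;
  have [l13|l31] := leqP n1 n3.
  - have := key o1 o2 o3 n1 n2 n3; lia.
  - lia.
  - have := key o1 o3 o2 n1 n3 n2; lia.
  - have := key o3 o1 o2 n3 n1 n2; lia.
  - have := key o2 o1 o3 n2 n1 n3; lia.
  - have := key o2 o3 o1 n2 n3 n1; lia.
  - lia.
  - have := key o3 o2 o1 n3 n2 n1; lia.
have fin o n m : (1 < n)%N -> (n < 6)%N -> (2 < o)%N -> (o * n = N)%N ->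
    (o * m = N)%N -> m \in [:: 2; 3; 4; 5]%N.
  move=> n_gt1 n_lt6 o0 on om.
  have -> : m = n by apply/eqP; rewrite -(@eqn_pmul2l o) ?om ?on //; lia.
  by move: n n_gt1 n_lt6 {on om} => [|[|[|[|[|[|]]]]]].
move=> o n o_os oN; move: o_os oN; rewrite in_cons in_cons inE => /or3P[] /eqP-> oN.
- exact: fin n1_gt b1 p1 e1 oN.
- exact: fin n2_gt b2 p2 e2 oN.
- exact: fin n3_gt b3 p3 e3 oN.
Qed.

(** * Finite groups of projective transformations *)

Section FiniteGroups.
Variables (F : numClosedFieldType) (A B : mat2 F).
Implicit Types (M N : mat2 F) (x y z : option F).
Hypotheses (A0 : mdet A != 0) (B0 : mdet B != 0).

Lemma fixed_points_seq M : mdet M != 0 -> ~~ mscal M ->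
  exists s : seq (option F), forall x, mob M x = x -> x \in s.
Proof.
move=> M0 nM.
have [[x fx]|nx] := pselect (exists x, mob M x = x); last first.
  by exists [::] => x fx; case: nx; exists x.
have [[y [fy xy]]|ny] := pselect (exists y, mob M y = y /\ x != y); last first.
  exists [:: x] => y fy; rewrite inE; apply: contraPT isT => yx _.
  by apply: ny; exists y; rewrite eq_sym.
exists [:: x; y] => z fz; rewrite !inE; apply: contraNT nM.
rewrite negb_or => /andP[zx zy].
by apply: (three_fixed M0 xy _ _ fx fy fz); rewrite eq_sym.
Qed.

Section Finite.
Variable O : seq (option F).
Hypotheses (O_uniq : uniq O) (O3 : (2 < size O)%N).
Hypotheses (OA : {in O, forall x, mob A x \in O})
  (OB : {in O, forall x, mob B x \in O}).

(** [O] has finitely many permutations, and two words inducing the same one agree on the whole line,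
    hence have the same fixed points. *)
Lemma all_fixed_points_seq : exists s : seq (option F),
  forall M, mgen A B M -> ~~ mscal M -> forall x, mob M x = x -> x \in s.
Proof.
have /choice[f fP] (h : {perm seq_sub O}) : exists s : seq (option F),
    forall M, mgen A B M -> realizes M h -> ~~ mscal M ->
    forall x, mob M x = x -> x \in s.
  have [[M [gM [Mh nM]]]|nM] := pselect
      (exists M, mgen A B M /\ realizes M h /\ ~~ mscal M); last first.
    by exists [::] => M gM Mh sM; case: nM; exists M.
  have [s sP] := fixed_points_seq (mgen_det A0 B0 gM) nM.
  exists s => N gN Nh _ x; rewrite -(realizes_inj A0 B0 O_uniq O3 gM gN Mh Nh).
  exact: sP.
exists (flatten [seq f h | h <- enum {perm seq_sub O}]) => M gM nM x fx.
have [h Mh] := mgen_perm A0 B0 OA OB gM.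
apply/flattenP; exists (f h); last exact: fP gM Mh nM x fx.
by apply: map_f; rewrite mem_enum.
Qed.

(** The fixed points of nontrivial elements are permuted by the group: if M fixes x, the conjugate
    of M by C fixes C x. Adding them to [O] makes every fixed point visible in the permutation
    action. *)
Lemma fixed_points_stable : exists Om : seq (option F),
  [/\ uniq Om, {subset O <= Om},
      {in Om, forall x, mob A x \in Om}, {in Om, forall x, mob B x \in Om}
    & forall M x, mgen A B M -> ~~ mscal M -> mob M x = x -> x \in Om].
Proof.
have [s sP] := all_fixed_points_seq.
pose P x := x \in O \/ exists M, [/\ mgen A B M, ~~ mscal M & mob M x = x].
pose Om := undup [seq x <- O ++ s | `[< P x >]].
have OmP x : x \in Om <-> P x.
  rewrite mem_undup mem_filter mem_cat; split => [/andP[/asboolP]//|Px].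
  apply/andP; split; first exact/asboolP.
  by case: Px => [->//|[M [gM nM fx]]]; rewrite (sP M) ?orbT.
have stab C : mgen A B C -> (forall x, x \in O -> mob C x \in O) ->
    forall x, x \in Om -> mob C x \in Om.
  move=> gC OC x /OmP Px; apply/OmP; case: Px => [/OC|[M [gM nM fx]]]; first by left.
  have C0 := mgen_det A0 B0 gC; have M0 := mgen_det A0 B0 gM; right.
  exists (mmul C (mmul M (madj C))); split.
  - by apply: mgenM gC (mgenM gM (mgen_adj gC)).
  - apply: contra nM => sc.
    have sc' y : mob M y = y.
      apply: (mob_inj C0); have := mscal_mob (mob C y) _ sc.
      rewrite !mobM ?mdetM ?mdet_adj ?mulf_neq0 // mob_adjK //; exact.
    by apply: (@three_fixed _ M None (Some 0) (Some 1)) => //;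
      rewrite (inj_eq Some_inj) eq_sym oner_eq0.
  - by rewrite !mobM ?mdetM ?mdet_adj ?mulf_neq0 // mob_adjK // fx.
exists Om; split.
- exact: undup_uniq.
- by move=> x Ox; apply/OmP; left.
- by apply: stab OA; apply: mgen_genL.
- by apply: stab OB; apply: mgen_genR.
- by move=> M x gM nM fx; apply/OmP; right; exists M.
Qed.

(* The classification of the finite groups of rotations of the sphere, by
   counting the pairs formed by a nontrivial element and a fixed point. *)
Theorem finite_mobius :
  [\/ exists x, mob A x = x /\ mob B x = x,
      exists x y, [/\ x != y, {subset [:: mob A x; mob A y] <= [:: x; y]}
        & {subset [:: mob B x; mob B y] <= [:: x; y]}]
    | forall M, mgen A B M ->
        exists2 k, k \in [:: 2; 3; 4; 5]%N & mscal (mexp M k)].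
Proof.
have [Om [Om_uniq OOm OmA OmB OmP]] := fixed_points_stable.
have Om3 : (2 < size Om)%N by apply: leq_trans O3 _; apply: uniq_leq_size.
pose G := mob_group A0 B0 Om; set N := #|G|.
have [N1|N_gt1] := leqP N 1.
  constructor 1; exists None.
  have G1 C : mgen A B C -> mob C None = None.
    move=> gC; have [h Ch] := mgen_perm A0 B0 OmA OmB gC.
    apply: (mscal_mob _ (mgen_det A0 B0 gC)).
    rewrite (realizes_one Om_uniq Om3 (mgen_det A0 B0 gC) Ch).
    have hG : h \in G by rewrite inE; apply/asboolP; exists C.
    by move: hG; rewrite (card_le1_trivg N1) => /set1P ->.
  by split; apply: G1; [apply: mgen_genL | apply: mgen_genR].
(* Only points with a nontrivial stabilizer enter the count. *)
pose S : {set seq_sub Om} := [set w | 'C_G[w | 'P]%g != 1%g].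
have Gact : [acts G, on S | 'P]%g.
  apply/actsP => h hG w; rewrite !inE; congr (~~ _).
  have -> : 'C_G['P%act w h | 'P]%g = ('C_G[w | 'P] :^ h)%g.
    by rewrite astab1_act -{1}(conjGid hG) -conjIg.
  by rewrite conjsg_eq1.
(* Burnside's count on [S]: the identity fixes all of [S], every other element exactly its two
   eigenlines. This is the equation of [rotation_orbits]. *)
have := Frobenius_Cauchy Gact.
rewrite (bigD1 1%g) ?group1 //= (eq_bigr (fun=> 2%N)); last first.
  move=> h /andP[hG h1]; apply/eqP; rewrite eqn_leq (@card_fix_le2 _ _ _ A0 B0 Om) //=.
  have [M gM Mh] := @mob_groupP _ _ _ A0 B0 Om h hG.
  have [x [y [xy fx fy]]] :=
    two_fixed (mgen_det A0 B0 gM) (mob_group_disc A0 B0 Om_uniq Om3 gM Mh h1).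
  have nM : ~~ mscal M by rewrite (realizes_one Om_uniq Om3 (mgen_det A0 B0 gM) Mh).
  have inFix z : mob M z = z -> exists2 w, w \in ('Fix_(S | 'P)[h])%g & val w = z.
    move=> fz; exists (SeqSub (OmP _ _ gM nM fz)) => //.
    rewrite (mem_fixE _ _ Mh) /= fz eqxx andbT inE.
    apply/trivgPn; exists h => //; rewrite inE hG; apply/astab1P.
    by apply: val_inj; rewrite /= -Mh.
  have [u uF ux] := inFix x fx; have [v vF vy] := inFix y fy.
  have uv : u != v by apply: contraNneq xy => uv; rewrite -ux -vy uv.
  have <- : #|[set u; v]| = 2%N by rewrite cards2 uv.
  apply: subset_leq_card.
  by apply/fintype.subsetP => w; rewrite in_set2 => /orP[]/eqP->.
rewrite [in X in (X + _)%N](_ : 'Fix_(S | 'P)[1]%g = S); last first.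
  by apply/finset.setP => w; rewrite in_setI; case: (w \in S) => //=; apply/afix1P; rewrite act1.
have oP := card_partition (orbit_partition Gact).
set P := orbit 'P G @: S in oP *.
have -> : (\sum_(h in G | h != 1%g) 2 = 2 * N.-1)%N.
  rewrite sum_nat_const mulnC /N (cardsD1 1%g G) group1 /=; congr (_ * _)%N.
  by apply: eq_card => h; rewrite in_setD1 andbC.
rewrite oP => /esym count_eq.
pose os := [seq #|C| | C : {set seq_sub Om} <- enum P].
have os_sum : sumn os = (\sum_(C in P) #|C|)%N.
  by rewrite /os sumnE big_map big_enum.
have orb_dvd o : o \in os -> exists2 w, w \in S & o = #|orbit 'P G w|.
  case/mapP => C; rewrite mem_enum => /imsetP[w wS ->] ->; by exists w.
have stab_gt1 w : w \in S -> (1 < #|'C_G[w | 'P]%g|)%N.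
  by rewrite inE trivg_card1 => h; rewrite ltn_neqAle eq_sym h cardG_gt0.
have orb_mob C w v : mgen A B C -> v \in orbit 'P G w ->
    exists2 v', v' \in orbit 'P G w & mob C (val v) = val v'.
  move=> gC vw; have [h Ch] := mgen_perm A0 B0 OmA OmB gC.
  have hG : h \in G by rewrite inE; apply/asboolP; exists C.
  exists (h v); last exact: Ch.
  by rewrite -[h v]/('P%act v h) -(orbit_eqP vw) mem_orbit.
have gA : mgen A B A := mgen_genL A B; have gB : mgen A B B := mgen_genR A B.
have [||o1|o2|ok] := @rotation_orbits N os N_gt1.
- move=> o /orb_dvd[w wS ->]; exists #|'C_G[w | 'P]%g|; first exact: stab_gt1.
  exact: card_orbit_stab.
- by rewrite os_sum -count_eq /os size_map -cardE.
- constructor 1; have [w wS /esym/card_orbit1 ow] := orb_dvd _ o1.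
  have fixw C : mgen A B C -> mob C (val w) = val w.
    move=> gC; have [v] := orb_mob C w w gC (orbit_refl _ _ _).
    by rewrite ow => /set1P ->.
  by exists (val w); split; apply: fixw.
- constructor 2; have [w wS /esym/eqP/cards2P[u [v [uv ow]]]] := orb_dvd _ o2.
  exists (val u), (val v); split; first by rewrite (inj_eq val_inj).
    move=> x; rewrite !inE => /orP[]/eqP->.
      have [|z] := orb_mob A w u gA; first by rewrite ow set21.
      by rewrite ow !inE => /orP[]/eqP-> ->; rewrite eqxx ?orbT.
    have [|z] := orb_mob A w v gA; first by rewrite ow set22.
    by rewrite ow !inE => /orP[]/eqP-> ->; rewrite eqxx ?orbT.
  move=> x; rewrite !inE => /orP[]/eqP->.
    have [|z] := orb_mob B w u gB; first by rewrite ow set21.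
    by rewrite ow !inE => /orP[]/eqP-> ->; rewrite eqxx ?orbT.
  have [|z] := orb_mob B w v gB; first by rewrite ow set22.
  by rewrite ow !inE => /orP[]/eqP-> ->; rewrite eqxx ?orbT.
constructor 3 => M gM; have M0 := mgen_det A0 B0 gM.
have [h Mh] := mgen_perm A0 B0 OmA OmB gM.
have hG : h \in G by rewrite inE; apply/asboolP; exists M.
have [h1|h1] := eqVneq h 1%g.
  by exists 2%N => //; rewrite (realizes_one Om_uniq Om3 (mdet_exp _ M0)
    (realizes_exp _ M0 Mh)) h1 expg1n.
have [x [_ [_ fx _]]] := two_fixed M0 (mob_group_disc A0 B0 Om_uniq Om3 gM Mh h1).
have nM : ~~ mscal M by rewrite (realizes_one Om_uniq Om3 M0 Mh).
pose w : seq_sub Om := SeqSub (OmP _ _ gM nM fx).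
have hw : h \in 'C_G[w | 'P]%g.
  rewrite inE hG; apply/astab1P; apply: val_inj.
  by rewrite /= -Mh.
have wS : w \in S by rewrite inE; apply/trivgPn; exists h.
(* The order of h divides that of the stabilizer of its fixed point w, which [rotation_orbits]
   bounds. *)
exists #|'C_G[w | 'P]%g|.
  apply: (ok #|orbit 'P G w|); last exact: card_orbit_stab.
  by apply/mapP; exists (orbit 'P G w) => //; rewrite mem_enum imset_f.
rewrite (realizes_one Om_uniq Om3 (mdet_exp _ M0) (realizes_exp _ M0 Mh)).
by rewrite -order_dvdn order_dvdG.
Qed.
End Finite.
End FiniteGroups.

(** * Three special orbits determine the order of the group *)

Section FreeOrbits.
Variables (F : numClosedFieldType) (A B : mat2 F).
Implicit Types (M : mat2 F) (x y z : option F).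
Hypotheses (A0 : mdet A != 0) (B0 : mdet B != 0).

Definition morb x y : Prop := exists2 M, mgen A B M & mob M x = y.

Lemma morb_refl x : morb x x.
Proof. by exists (mone F); [apply: MgenOne | apply: mob1]. Qed.

Lemma morb_sym x y : morb x y -> morb y x.
Proof.
case=> M gM <-; exists (madj M); first exact: mgen_adj.
by rewrite mob_adjK // (mgen_det A0 B0).
Qed.

Lemma morb_trans x y z : morb x y -> morb y z -> morb x z.
Proof.
case=> M gM <- [N gN <-]; exists (mmul N M); first exact: mgenM.
by rewrite mobM // (mgen_det A0 B0).
Qed.

Lemma morb_stable (O : seq (option F)) x y :
  {in O, forall z, mob A z \in O} -> {in O, forall z, mob B z \in O} ->
  x \in O -> morb x y -> y \in O.
Proof. by move=> OA OB xO [M gM <-]; apply: (mgen_stable A0 B0 OA OB gM). Qed.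

Definition orbit_list (s : seq (option F)) x : Prop :=
  uniq s /\ forall y, y \in s <-> morb x y.

Variables (O1 O2 O3 : seq (option F)) (x1 x2 x3 : option F) (N : nat).
Let Om := O1 ++ O2 ++ O3.
Hypotheses (P1 : orbit_list O1 x1) (P2 : orbit_list O2 x2)
  (P3 : orbit_list O3 x3) (Om_uniq : uniq Om) (N_gt0 : (0 < N)%N)
  (Om_size : size Om = N.+2)
  (N_lcm : forall m, (size O1 %| m -> size O2 %| m -> size O3 %| m -> N %| m)%N).

Lemma orbit_list_closed s x M : orbit_list s x -> mgen A B M ->
  {in s, forall z, mob M z \in s}.
Proof.
case=> _ sP gM z /sP xz; apply/sP; apply: morb_trans xz _.
by exists M.
Qed.

Lemma free_closed M : mgen A B M -> {in Om, forall z, mob M z \in Om}.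
Proof.
move=> gM z; rewrite /Om !mem_cat => /or3P[] h.
- by rewrite (orbit_list_closed P1).
- by rewrite (orbit_list_closed P2) ?orbT.
- by rewrite (orbit_list_closed P3) ?orbT.
Qed.

Let OmA : {in Om, forall z, mob A z \in Om} := free_closed (mgen_genL A B).
Let OmB : {in Om, forall z, mob B z \in Om} := free_closed (mgen_genR A B).
Let Om3 : (2 < size Om)%N. Proof. by rewrite Om_size. Qed.
Let G := mob_group A0 B0 Om.

Lemma orbit_list_orbit s x (w : seq_sub Om) : {subset s <= Om} ->
  orbit_list s x -> val w \in s -> [set v | val v \in s] = orbit 'P G w.
Proof.
move=> sOm [_ sP] /sP xw; apply/finset.setP => v; rewrite inE; apply/idP/idP.
  move=> /sP /(morb_trans (morb_sym xw))[M gM wv].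
  have [h Mh] := mgen_perm A0 B0 OmA OmB gM.
  have hG : h \in G by rewrite inE; apply/asboolP; exists M.
  have -> : v = 'P%act w h by apply: val_inj; rewrite /= -wv Mh.
  exact: mem_orbit.
case/orbitP => h /(@mob_groupP _ _ _ A0 B0)[M gM Mh] <- /=.
apply/sP; apply: morb_trans xw _; exists M => //; exact: Mh.
Qed.

Lemma card_orbit_list s x (w : seq_sub Om) : {subset s <= Om} ->
  orbit_list s x -> val w \in s -> #|orbit 'P G w| = size s.
Proof.
move=> sOm sP ws; rewrite -(orbit_list_orbit sOm sP ws).
rewrite cardE -(size_map val); apply: perm_size; apply: uniq_perm.
- by rewrite (map_inj_uniq val_inj) enum_uniq.
- by case: sP.
move=> y; apply/mapP/idP => [[v]|ys].
  by rewrite mem_enum inE => vs ->.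
by exists (SeqSub (sOm _ ys)); rewrite // mem_enum inE.
Qed.

Let s1 : {subset O1 <= Om}.
Proof. by move=> y yO; rewrite /Om mem_cat yO. Qed.
Let s2 : {subset O2 <= Om}.
Proof. by move=> y yO; rewrite /Om !mem_cat yO orbT. Qed.
Let s3 : {subset O3 <= Om}.
Proof. by move=> y yO; rewrite /Om !mem_cat yO !orbT. Qed.

Lemma orbit_list_mem s x : orbit_list s x -> x \in s.
Proof. by case=> _ sP; apply/sP/morb_refl. Qed.

Let w1 : seq_sub Om := SeqSub (s1 (orbit_list_mem P1)).
Let w2 : seq_sub Om := SeqSub (s2 (orbit_list_mem P2)).
Let w3 : seq_sub Om := SeqSub (s3 (orbit_list_mem P3)).

Lemma three_orbits : (3 <= #|orbit 'P G @: [set: seq_sub Om]|)%N.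
Proof.
have := Om_uniq; rewrite /Om !cat_uniq has_cat negb_or.
move=> /and5P[_ /andP[/hasPn d12 /hasPn d13] _ /hasPn d23 _].
have e1 := orbit_list_orbit s1 P1 (orbit_list_mem P1 : val w1 \in O1).
have e2 := orbit_list_orbit s2 P2 (orbit_list_mem P2 : val w2 \in O2).
have e3 := orbit_list_orbit s3 P3 (orbit_list_mem P3 : val w3 \in O3).
apply/card_gt2P; exists (orbit 'P G w1), (orbit 'P G w2), (orbit 'P G w3).
split; first by rewrite !imset_f ?inE.
rewrite -e1 -e2 -e3; split; apply/eqP => /finset.setP.
- move=> /(_ w2); rewrite !inE /= (orbit_list_mem P2) => h.
  by have := d12 _ (orbit_list_mem P2); rewrite /= h.
- move=> /(_ w3); rewrite !inE /= (orbit_list_mem P3) => h.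
  by have := d23 _ (orbit_list_mem P3); rewrite /= h.
- move=> /(_ w3); rewrite !inE /= (orbit_list_mem P3) => h.
  by have := d13 _ (orbit_list_mem P3); rewrite /= -h.
Qed.

Lemma fix_count :
  (#|orbit 'P G @: [set: seq_sub Om]| * #|G| =
   N.+2 + \sum_(h in G | h != 1%g) #|'Fix_([set: seq_sub Om] | 'P)[h]%g|)%N.
Proof.
have actT : [acts G, on [set: seq_sub Om] | 'P]%g.
  by apply/actsP => h _ w; rewrite !in_setT.
rewrite -(Frobenius_Cauchy actT) (bigD1 1%g) ?group1 //=; congr (_ + _)%N.
rewrite -Om_size -(card_seq_sub Om_uniq) -cardsT; apply: eq_card => w.
by rewrite in_setI !in_setT; apply/afix1P; rewrite act1.
Qed.

(** Burnside's count on [Om]: at least three orbits and at most two fixed points per nontrivial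
    element give 3 |G| <= N + 2 + 2 (|G| - 1), so |G| <= N. The orbit sizes divide |G|, hence so
    does N. *)
Lemma free_card : #|G| = N.
Proof.
have le_N : (#|G| <= N)%N.
  have : (\sum_(h in G | h != 1%g) #|'Fix_([set: seq_sub Om] | 'P)[h]%g| <=
      2 * #|G|.-1)%N.
    apply: (@leq_trans (\sum_(h in G | h != 1%g) 2)); last first.
      rewrite sum_nat_const mulnC (cardsD1 1%g G) group1 /= leq_mul2l /=.
      by apply: eq_leq; apply: eq_card => h; rewrite in_setD1 andbC.
    apply: leq_sum => h /andP[hG h1].
    exact: (@card_fix_le2 _ _ _ A0 B0 Om).
  have := fix_count; have := three_orbits; have := cardG_gt0 G; nia.
apply/eqP; rewrite eqn_leq le_N; apply: dvdn_leq; first exact: cardG_gt0.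
apply: N_lcm.
- by rewrite -(@card_orbit_list O1 x1 w1) ?dvdn_orbit // (orbit_list_mem P1).
- by rewrite -(@card_orbit_list O2 x2 w2) ?dvdn_orbit // (orbit_list_mem P2).
- by rewrite -(@card_orbit_list O3 x3 w3) ?dvdn_orbit // (orbit_list_mem P3).
Qed.

(** As |G| = N, equality holds throughout the count of [free_card]. *)
Lemma free_fix2 h : h \in G -> h != 1%g ->
  #|'Fix_([set: seq_sub Om] | 'P)[h]%g| = 2%N.
Proof.
move=> hG h1; apply/eqP; rewrite eqn_leq (@card_fix_le2 _ _ _ A0 B0 Om) //=.
have := fix_count; have := three_orbits; rewrite free_card => r3.
rewrite (bigD1 h) /=; last by rewrite h1 hG.
have : (\sum_(i in G | (i != 1%g) && (i != h)) #|'Fix_([set: seq_sub Om] | 'P)[i]%g|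
    <= 2 * #|G|.-2)%N.
  apply: (@leq_trans (\sum_(i in G | (i != 1%g) && (i != h)) 2)).
    by apply: leq_sum => i /and3P[iG i1 _]; apply: (@card_fix_le2 _ _ _ A0 B0 Om).
  rewrite sum_nat_const mulnC leq_mul2l /= (cardsD1 1%g G) group1 /=.
  rewrite (cardsD1 h) in_setD1 h1 hG /=; apply: eq_leq; apply: eq_card => i.
  rewrite !in_setD1 -topredE /=. by case: (i == h); case: (i == 1%g); rewrite ?andbT ?andbF.
rewrite free_card => le_sum.
under eq_bigl => i do rewrite -andbA.
have : (1 < #|G|)%N.
  by rewrite (cardsD1 1%g G) group1 (cardsD1 h) in_setD1 h1 hG.
rewrite free_card; move: le_sum r3; rewrite /G /=.
set X := (\sum_(i in _ | _) _)%N; set Y := #|_|; set Z := #|_|; nia.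
Qed.

(** Each nontrivial element already has two fixed points in [Om]; a third one, outside, would make
    it scalar. So x has a trivial stabilizer and its orbit is in bijection with the group. *)
Theorem free_orbit x : x \notin Om -> exists2 s, size s = N & orbit_list s x.
Proof.
move=> xOm.
have free M : mgen A B M -> mob M x = x -> mscal M.
  move=> gM fx; have M0 := mgen_det A0 B0 gM; apply: contraNT xOm => nM.
  have [h Mh] := mgen_perm A0 B0 OmA OmB gM.
  have hG : h \in G by rewrite inE; apply/asboolP; exists M.
  have h1 : h != 1%g by rewrite -(realizes_one Om_uniq Om3 M0 Mh).
  have /eqP/cards2P[u [v [uv fix_uv]]] := free_fix2 hG h1.
  have fixE w : w \in [set u; v] -> mob M (val w) = val w.
    by rewrite -fix_uv (mem_fixE _ _ Mh) => /andP[_ /eqP].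
  have fu := fixE u (set21 _ _); have fv := fixE v (set22 _ _).
  have [<-|xu] := eqVneq (val u) x; first exact: valP.
  have [<-|xv] := eqVneq (val v) x; first exact: valP.
  by case/negP: nM; apply: (three_fixed M0 _ xv xu fu fv fx);
    rewrite (inj_eq val_inj).
have /choice[lift liftP] (h : {perm seq_sub Om}) : exists M,
    h \in G -> mgen A B M /\ realizes M h.
  have [hG|hG] := boolP (h \in G); last by exists (mone F).
  by have [M gM Mh] := @mob_groupP _ _ _ A0 B0 Om h hG; exists M.
exists [seq mob (lift h) x | h <- enum G]; first by rewrite size_map -cardE free_card.
split=> [|y].
  rewrite map_inj_in_uniq ?enum_uniq // => g h; rewrite !mem_enum.
  move=> /liftP[gM Mg] /liftP[gN Nh] eq_x.
  have M0 := mgen_det A0 B0 gM; have N0 := mgen_det A0 B0 gN.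
  have sc : mscal (mmul (madj (lift h)) (lift g)).
    apply: free; first by apply: mgenM gM; apply: mgen_adj.
    by rewrite mobM ?mdet_adj // eq_x mob_adjK.
  apply/permP => w; apply: val_inj; rewrite -Mg -Nh.
  have := mscal_mob (val w) _ sc; rewrite mobM ?mdetM ?mdet_adj ?mulf_neq0 //.
  by move=> e; rewrite -[in RHS]e // mob_adjVK.
split=> [/mapP[h]|[M gM <-]].
  by rewrite mem_enum => /liftP[gM _] ->; exists (lift h).
have [h Mh] := mgen_perm A0 B0 OmA OmB gM.
have hG : h \in G by rewrite inE; apply/asboolP; exists M.
have [gN Nh] := liftP _ hG.
rewrite (realizes_inj A0 B0 Om_uniq Om3 gM gN Mh Nh).
by apply: map_f; rewrite mem_enum.
Qed.

End FreeOrbits.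

From mathcomp Require Import classical_sets functions cardinality reals complex.
Import Order.TTheory GRing.Theory Num.Theory.
Local Open Scope ring_scope.

(** * Hurwitz moves on tuples of a group *)

Section Hurwitz.
Variable G : groupType.
Implicit Types (s t u v : seq G) (x y g : G).

(** The generators act on the list of the images of the [alpha k]. A move past the end of the list
    does nothing ([hmove_big]), so indices need no bound. *)
Definition hmove (i : nat) s : seq G :=
  take i s ++
  (if drop i s is [:: x, y & v] then [:: (x * y * x^-1)%g, x & v] else drop i s).
Definition hmoveV (i : nat) s : seq G :=
  take i s ++
  (if drop i s is [:: x, y & v] then [:: y, (y^-1 * x * y)%g & v] else drop i s).

Definition conjs g s : seq G := [seq (g * x * g^-1)%g | x <- s].

Lemma hmove_cat u x y v i : size u = i ->
  hmove i (u ++ [:: x, y & v]) = u ++ [:: (x * y * x^-1)%g, x & v].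
Proof. by move=> <-; rewrite /hmove take_size_cat // drop_size_cat. Qed.

Lemma hmoveV_cat u x y v i : size u = i ->
  hmoveV i (u ++ [:: x, y & v]) = u ++ [:: y, (y^-1 * x * y)%g & v].
Proof. by move=> <-; rewrite /hmoveV take_size_cat // drop_size_cat. Qed.

Lemma split_at i s : (i.+1 < size s)%N ->
  exists u x y v, s = u ++ [:: x, y & v] /\ size u = i.
Proof.
move=> si; exists (take i s).
have := size_drop i s; case E: (drop i s) => [|x [|y v]] /=; try lia.
exists x, y, v; split; last by rewrite size_take; case: ltnP => //; lia.
by rewrite -E cat_take_drop.
Qed.

Lemma size_hmove i s : size (hmove i s) = size s.
Proof.
rewrite /hmove size_cat -[in RHS](cat_take_drop i s) [RHS]size_cat.
by case: (drop i s) => [|x [|y v]].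
Qed.

Lemma size_hmoveV i s : size (hmoveV i s) = size s.
Proof.
rewrite /hmoveV size_cat -[in RHS](cat_take_drop i s) [RHS]size_cat.
by case: (drop i s) => [|x [|y v]].
Qed.

Lemma hmove_big i s : (size s <= i.+1)%N ->
  hmove i s = s /\ hmoveV i s = s.
Proof.
rewrite /hmove /hmoveV => si.
have := size_drop i s; case E: (drop i s) => [|x [|y v]] /=; try lia.
  by rewrite -E cat_take_drop.
by rewrite -E cat_take_drop.
Qed.


Lemma hmoveK i : cancel (hmove i) (hmoveV i).
Proof.
move=> s; have [si|si] := ltnP i.+1 (size s).
  have [u [x [y [v [-> ui]]]]] := split_at si.
  by rewrite hmove_cat // hmoveV_cat // !mulgA mulVg mul1g mulgVK.
by have [h hV] := hmove_big si; rewrite ?h ?hV ?h.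
Qed.

Lemma hmoveVK i : cancel (hmoveV i) (hmove i).
Proof.
move=> s; have [si|si] := ltnP i.+1 (size s).
  have [u [x [y [v [-> ui]]]]] := split_at si.
  by rewrite hmoveV_cat // hmove_cat // !mulgA mulgV mul1g mulgK.
by have [h hV] := hmove_big si; rewrite ?h ?hV ?h.
Qed.

Lemma size_conjs g s : size (conjs g s) = size s.
Proof. exact: size_map. Qed.

Lemma conjs1 s : conjs 1%g s = s.
Proof.
by rewrite -[RHS]map_id; apply: eq_map => x; rewrite mul1g invg1 mulg1.
Qed.

Lemma conjsM g h s : conjs (g * h)%g s = conjs g (conjs h s).
Proof. by rewrite /conjs -map_comp; apply: eq_map => x /=; rewrite invgM !mulgA. Qed.

Lemma conjsK g s : conjs g^-1%g (conjs g s) = s.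
Proof. by rewrite -conjsM mulVg conjs1. Qed.

Lemma conjsVK g s : conjs g (conjs g^-1%g s) = s.
Proof. by rewrite -conjsM mulgV conjs1. Qed.

Lemma hmove_conjs i g s : hmove i (conjs g s) = conjs g (hmove i s).
Proof.
rewrite /hmove /conjs map_cat -map_take -map_drop; congr (_ ++ _).
case: (drop i s) => [|x [|y v]] //=.
by rewrite !invgM invgK !mulgA !mulgVK.
Qed.

Lemma hmoveV_conjs i g s : hmoveV i (conjs g s) = conjs g (hmoveV i s).
Proof. by apply: (can_inj (hmoveK i)); rewrite hmove_conjs !hmoveVK. Qed.

Lemma prod_hmove i s : (\prod_(x <- hmove i s) x = \prod_(x <- s) x)%g.
Proof.
rewrite /hmove big_cat -[in RHS](cat_take_drop i s) [RHS]big_cat /=.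
congr (_ * _)%g; case: (drop i s) => [|x [|y v]] //.
by rewrite !big_cons !mulgA mulgVK.
Qed.

Definition conjugate s t : Prop := exists g, t = conjs g s.

Lemma conjugate_refl s : conjugate s s.
Proof. by exists 1%g; rewrite conjs1. Qed.
Lemma conjugate_sym s t : conjugate s t -> conjugate t s.
Proof. by case=> g ->; exists g^-1%g; rewrite conjsK. Qed.
Lemma conjugate_trans s t u : conjugate s t -> conjugate t u -> conjugate s u.
Proof. by case=> g -> [h ->]; exists (h * g)%g; rewrite conjsM. Qed.
Lemma conjugate_hmove i s t : conjugate s t -> conjugate (hmove i s) (hmove i t).
Proof. by case=> g ->; exists g; rewrite hmove_conjs. Qed.
Lemma conjugate_hmoveV i s t : conjugate s t -> conjugate (hmoveV i s) (hmoveV i t).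
Proof. by case=> g ->; exists g; rewrite hmoveV_conjs. Qed.

(* The Hurwitz orbit of [s] is finite up to simultaneous conjugation. *)
Definition fin_orb s : Prop := exists X : seq (seq G), s \in X /\
  forall t i, t \in X ->
    (exists2 t', t' \in X & conjugate t' (hmove i t)) /\
    (exists2 t', t' \in X & conjugate t' (hmoveV i t)).

Inductive hreach s : seq G -> Prop :=
| HreachRefl : hreach s s
| HreachMove t i : hreach s t -> hreach s (hmove i t)
| HreachMoveV t i : hreach s t -> hreach s (hmoveV i t).

Lemma hreach_trans s t u : hreach s t -> hreach t u -> hreach s u.
Proof.
by move=> st; elim=> {u} [|u i _ IH|u i _ IH] //;
   [apply: HreachMove | apply: HreachMoveV].
Qed.

Lemma fin_orb_reach s t : fin_orb s -> hreach s t -> fin_orb t.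
Proof.
case=> X [sX XP] st.
have [t' t'X [g tE]] : exists2 t', t' \in X & conjugate t' t.
  elim: st => [|t0 i _ [t' t'X t'c]|t0 i _ [t' t'X t'c]].
  - by exists s => //; apply: conjugate_refl.
  - have [[u uX u_c] _] := XP _ i t'X; exists u => //.
    exact: conjugate_trans u_c (conjugate_hmove _ t'c).
  - have [_ [u uX u_c]] := XP _ i t'X; exists u => //.
    exact: conjugate_trans u_c (conjugate_hmoveV _ t'c).
exists (map (conjs g) X); split; first by rewrite tE map_f.
move=> _ i /mapP[u uX ->].
have [[v vX uv] [w wX uw]] := XP _ i uX.
rewrite hmove_conjs hmoveV_conjs; split.
  exists (conjs g v); first exact: map_f.
  apply: conjugate_trans (conjugate_sym _) (conjugate_trans uv _); by exists g.
exists (conjs g w); first exact: map_f.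
apply: conjugate_trans (conjugate_sym _) (conjugate_trans uw _); by exists g.
Qed.

End Hurwitz.

(** * From representations to tuples *)

Section Bridge.
Variables (F : fieldType) (n : nat).
Implicit Types (rho : affrep F n) (b : braid n).

Definition imgs rho : seq (aff F) := [seq rho (alpha k) | k <- enum 'I_n].

Lemma size_imgs rho : size (imgs rho) = n.
Proof. by rewrite size_map size_enum_ord. Qed.

Lemma nth_imgs rho (k : 'I_n) : nth 1%g (imgs rho) k = rho (alpha k).
Proof. by rewrite (nth_map k) ?size_enum_ord // nth_ord_enum. Qed.

Lemma imgs_inj rho rho' : imgs rho = imgs rho' -> rho = rho'.
Proof.
move=> e; apply: multiplicative_ext; apply: presented_ext => k.
by rewrite -[pgen _ k]/(alpha k) -!nth_imgs e.
Qed.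

Lemma prod_imgs rho : (\prod_(g <- imgs rho) g = 1)%g.
Proof.
rewrite big_map -[RHS](gmulf1_presented rho) -[in RHS](prod_alpha n).
elim: (enum _) => [|k s IHs]; first by rewrite !big_nil gmulf1_presented.
by rewrite !big_cons gmulfM IHs.
Qed.

Lemma imgs_surj (s : seq (aff F)) : size s = n -> (\prod_(g <- s) g = 1)%g ->
  exists rho, imgs rho = s.
Proof.
move=> sn s1; pose f (k : 'I_n) := nth 1%g s k.
have f_rel l r : @sphere_rel n l r -> word_eval f l = word_eval f r.
  case; rewrite word_eval_alphas [RHS]big_nil -[RHS]s1.
  have -> : s = [seq f k | k <- enum 'I_n].
    rewrite -[LHS](mkseq_nth 1%g s) /mkseq sn -val_enum_ord -map_comp.
    exact: eq_map.
  by rewrite [RHS]big_map.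
pose rho : affrep F n := HB.pack (plift f)
  (isMultiplicative.Build _ _ _ (pliftM f_rel)).
exists rho; apply: (@eq_from_nth _ 1%g); rewrite size_imgs // => k kn.
rewrite -[k]/(val (Ordinal kn)) nth_imgs; exact: (plift_gen f_rel).
Qed.

Lemma conj_classP rho rho' :
  conj_class rho rho' <-> conjugate (imgs rho) (imgs rho').
Proof.
split=> [[g gP]|[g gP]]; exists g.
  by rewrite /imgs /conjs -[RHS]map_comp; apply: eq_map => k /=; rewrite gP.
have M : {morph (fun x => (g * rho x * g^-1)%g) : x y / (x * y)%g}.
  by move=> x y /=; rewrite gmulfM !mulgA mulgVK.
pose rhog : affrep F n := HB.pack (fun x => (g * rho x * g^-1)%g)
  (isMultiplicative.Build _ _ _ M).
have -> : rho' = rhog; last by [].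
by apply: imgs_inj; rewrite gP /imgs /conjs -[LHS]map_comp; apply: eq_map.
Qed.

Lemma conj_class_eq rho rho' :
  conj_class rho = conj_class rho' <-> conjugate (imgs rho) (imgs rho').
Proof.
split=> [e|c].
  apply/conj_classP; rewrite e; exists 1%g => x; by rewrite mul1g invg1 mulg1.
apply/seteqP; split=> r /conj_classP h; apply/conj_classP.
  exact: conjugate_trans (conjugate_sym c) h.
exact: conjugate_trans c h.
Qed.

Definition sig (i : 'I_n.-1) : braid n := pgen (@braid_rel n) i.

Lemma act_mul b b' rho : braid_act (b * b')%g rho = braid_act b (braid_act b' rho).
Proof. by apply: multiplicative_ext => x; rewrite /= gmulfM. Qed.

Lemma act_one rho : braid_act 1%g rho = rho.
Proof. by apply: multiplicative_ext => x; rewrite /= gmulf1_presented. Qed.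

Lemma hurwitz_sig i : hurwitz (sig i) = hurwitz_gen i.
Proof. exact: (plift_gen (@hurwitz_gen_rel n)). Qed.

Lemma imgs_sig i rho : imgs (braid_act (sig i) rho) = hmove i (imgs rho).
Proof.
apply: (@eq_from_nth _ 1%g); rewrite ?size_hmove !size_imgs // => k kn.
rewrite -[k]/(val (Ordinal kn)) nth_imgs /= hurwitz_sig /=.
have lo_s : (i.+1 < size (imgs rho))%N by rewrite size_imgs (ltn_ord (hi i)).
have [u [x [y [v [E ui]]]]] := split_at lo_s.
have ex : rho (alpha (lo i)) = x.
  by rewrite -nth_imgs E nth_cat /= ui ltnn subnn.
have ey : rho (alpha (hi i)) = y.
  by rewrite -nth_imgs E nth_cat /= ui ltnNge leqnSn /= subSnn.
rewrite E hmove_cat // nth_cat ui.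
have [kl|kl] := eqVneq (Ordinal kn) (lo i).
  rewrite kl; have -> : k = i := congr1 val kl.
  by rewrite hurwitz_lo !gmulfM gmulfV_presented ex ey /= ltnn subnn.
have [kh|kh] := eqVneq (Ordinal kn) (hi i).
  rewrite kh; have -> : k = i.+1 := congr1 val kh.
  by rewrite hurwitz_hi ex /= ltnNge leqnSn /= subSnn.
rewrite hurwitz_other // -nth_imgs E nth_cat ui /=.
case: ltnP => // ki; move: kl kh; rewrite -!val_eqE /= => kl kh.
have -> : (k - i = (k - i).-2.+2)%N by lia.
by [].
Qed.

Lemma imgs_sigV i rho : imgs (braid_act (sig i)^-1%g rho) = hmoveV i (imgs rho).
Proof.
apply: (can_inj (@hmoveK _ i)).
by rewrite -imgs_sig -act_mul mulgV act_one hmoveVK.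
Qed.

Local Open Scope quotient_scope.
Lemma braid_ind (P : braid n -> Prop) : P 1%g ->
  (forall i b, P b -> P (sig i * b)%g) ->
  (forall i b, P b -> P ((sig i)^-1 * b)%g) -> forall b, P b.
Proof.
move=> P1 PM PV b; rewrite -[b]generic_quotient.reprK.
elim: (generic_quotient.repr b) => {b} [//|[i e] w IHw].
have -> : \pi_(braid n) ((i, e) :: w) =
    (\pi_(braid n) [:: (i, e)] * \pi_(braid n) w)%g.
  by rewrite [RHS]presented_mulE.
case: e; first exact: PM.
have -> : \pi_(braid n) [:: (i, false)] = (sig i)^-1%g.
  by rewrite [RHS]presented_invE.
exact: PV.
Qed.

Local Close Scope quotient_scope.

Lemma hreach_act b rho : hreach (imgs rho) (imgs (braid_act b rho)).
Proof.
elim/braid_ind: b => [|i b IHb|i b IHb]; first by rewrite act_one; apply: HreachRefl.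
  by rewrite act_mul imgs_sig; apply: HreachMove.
by rewrite act_mul imgs_sigV; apply: HreachMoveV.
Qed.

Lemma act_hreach s rho : hreach (imgs rho) s ->
  exists b, imgs (braid_act b rho) = s.
Proof.
elim=> [|t i _ [b <-]|t i _ [b <-]]; first by exists 1%g; rewrite act_one.
  have [ni|ni] := ltnP i n.-1.
    by exists (sig (Ordinal ni) * b)%g; rewrite act_mul imgs_sig.
  by exists b; rewrite (proj1 (hmove_big _)) // size_imgs; lia.
have [ni|ni] := ltnP i n.-1.
  by exists ((sig (Ordinal ni))^-1 * b)%g; rewrite act_mul imgs_sigV.
by exists b; rewrite (proj2 (hmove_big _)) // size_imgs; lia.
Qed.

Lemma pb_orbitE rho :
  pb_orbit (conj_class rho) =
  [set conj_class (braid_act b rho) | b in @pure_braid n]%classic.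
Proof.
by apply/seteqP; split=> [_ [b bp <-]|_ [b bp <-]]; exists b => //;
  rewrite braid_act_class.
Qed.

Lemma fin_orb_finite rho :
  fin_orb (imgs rho) -> finite_set (pb_orbit (conj_class rho)).
Proof.
case=> X [rX XP].
pose cl (s : seq (aff F)) : set (affrep F n) :=
  [set rho' | conjugate s (imgs rho')]%classic.
apply: (@sub_finite_set _ _ (cl @` [set` X])%classic); last first.
  exact/finite_image/finite_seq.
rewrite pb_orbitE => _ [b _ <-].
have [t tX tc] : exists2 t, t \in X & conjugate t (imgs (braid_act b rho)).
  elim/braid_ind: b => [|i b [t tX tc]|i b [t tX tc]].
  - by exists (imgs rho); rewrite ?act_one //; apply: conjugate_refl.
  - have [[u uX u_c] _] := XP _ i tX; exists u => //.
    by rewrite act_mul imgs_sig; apply: conjugate_trans u_c (conjugate_hmove _ tc).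
  - have [_ [u uX u_c]] := XP _ i tX; exists u => //.
    by rewrite act_mul imgs_sigV; apply: conjugate_trans u_c (conjugate_hmoveV _ tc).
exists t => //; apply/seteqP; split=> r /= h.
  by apply/conj_classP; apply: conjugate_trans (conjugate_sym tc) h.
by apply: conjugate_trans tc _; apply/conj_classP.
Qed.

(** The pure braids are the kernel of a map to a finite group: with one braid chosen over each
    permutation in the image, the full orbit is a union of finitely many translates of the pure
    orbit. *)
Lemma finite_fin_orb rho :
  finite_set (pb_orbit (conj_class rho)) -> fin_orb (imgs rho).
Proof.
move=> fin.
have /choice[c cP] (s : 'S_n) : exists b : braid n,
    forall b', braid_perm b' = s -> braid_perm b = s.
  have [[b bs]|nb] := pselect (exists b : braid n, braid_perm b = s).
    by exists b.
  by exists 1%g => b' b's; case: nb; exists b'.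
pose act b (p : set (affrep F n)) := (braid_act b @` p)%classic.
pose Y := (\bigcup_(s in [set: 'S_n]) (act (c s) @` pb_orbit (conj_class rho)))%classic.
have Yfin : finite_set Y.
  by apply: bigcup_finite => [|s _]; [exact: finite_finset | exact: finite_image].
have Yall b : Y (conj_class (braid_act b rho)).
  exists (braid_perm b) => //; set d := c _.
  have db : braid_perm d = braid_perm b by apply: cP.
  exists (conj_class (braid_act (d^-1 * b)%g rho)); last first.
    by rewrite /act braid_act_class -act_mul mulgA mulgV mul1g.
  rewrite pb_orbitE; exists (d^-1 * b)%g => //.
  by rewrite /pure_braid /= gmulfM gmulfV_presented /= db mulVg.
have /choice[r rP] (p : set (affrep F n)) : exists r : affrep F n,
    forall b, p = conj_class (braid_act b rho) -> p r.
  have [[b bp]|nb] := pselect (exists b, p = conj_class (braid_act b rho)).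
    exists (braid_act b rho) => _ _; rewrite bp; apply/conj_classP.
    exact: conjugate_refl.
  by exists rho => b pb; case: nb; exists b.
have : finite_set ((imgs \o r) @` Y)%classic by exact: finite_image.
move=> /finite_seqP[X XE].
have XP b : exists2 t, t \in X & conjugate t (imgs (braid_act b rho)).
  exists (imgs (r (conj_class (braid_act b rho)))).
    have : ((imgs \o r) @` Y)%classic (imgs (r (conj_class (braid_act b rho)))).
      by exists (conj_class (braid_act b rho)).
    by rewrite XE.
  apply: conjugate_sym; apply/conj_classP.
  exact: (rP _ b).
(* Only the representatives conjugate to a tuple of the orbit are kept: a move applied to any other
   one could leave the list. *)
have XQ t : t \in [seq t <- X | `[< exists b, conjugate t (imgs (braid_act b rho)) >]]
  <-> t \in X /\ exists b, conjugate t (imgs (braid_act b rho)).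
  by rewrite mem_filter; split=> [/andP[/asboolP]|[-> /asboolP ->]].
pose X' := [seq t <- X | `[< exists b, conjugate t (imgs (braid_act b rho)) >]].
exists (imgs rho :: X'); split; first by rewrite mem_head.
have X'P b : exists2 t, t \in imgs rho :: X' & conjugate t (imgs (braid_act b rho)).
  have [t tX tb] := XP b; exists t => //; rewrite inE; apply/orP; right.
  by apply/XQ; split=> //; exists b.
move=> t i tX'.
have [b tb] : exists b, conjugate t (imgs (braid_act b rho)).
  move: tX'; rewrite inE => /orP[/eqP->|/XQ[]//].
  by exists 1%g; rewrite act_one; apply: conjugate_refl.
have [b1 e1] := act_hreach (HreachMove i (hreach_act b rho)).
have [b2 e2] := act_hreach (HreachMoveV i (hreach_act b rho)).
have [t1 t1X t1c] := X'P b1; have [t2 t2X t2c] := X'P b2.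
split.
  exists t1 => //; apply: conjugate_trans t1c _; rewrite e1.
  exact/conjugate_hmove/conjugate_sym.
exists t2 => //; apply: conjugate_trans t2c _; rewrite e2.
exact/conjugate_hmoveV/conjugate_sym.
Qed.

End Bridge.

(** * Four strands: the squares of two generators suffice *)

Section FourStrands.
Variable G : groupType.
Implicit Types (s t u : seq G) (a b c d g : G).

(* The pure braid orbit up to conjugation, described by the squares of the first
   two generators only. *)
Inductive erel s : seq G -> Prop :=
| ErelConj t : conjugate s t -> erel s t
| ErelMove t i : (i < 2)%N -> erel s t -> erel s (hmove i (hmove i t))
| ErelMoveV t i : (i < 2)%N -> erel s t -> erel s (hmoveV i (hmoveV i t)).

Lemma erel_refl s : erel s s.
Proof. exact/ErelConj/conjugate_refl. Qed.

Lemma erel_conj s t u : erel s t -> conjugate t u -> erel s u.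
Proof.
move=> st; elim: st u => {t} [t st|t i i2 _ IH|t i i2 _ IH] u tu.
- exact/ErelConj/(conjugate_trans st).
- rewrite -[u](hmoveVK i) -[hmoveV i u](hmoveVK i); apply: ErelMove => //.
  apply: IH; have := conjugate_hmoveV i (conjugate_hmoveV i tu).
  by rewrite !hmoveK.
- rewrite -[u](hmoveK i) -[hmove i u](hmoveK i); apply: ErelMoveV => //.
  apply: IH; have := conjugate_hmove i (conjugate_hmove i tu).
  by rewrite !hmoveVK.
Qed.

Lemma erel_trans s t u : erel s t -> erel t u -> erel s u.
Proof.
move=> st; elim=> {u} [u|u i i2 _ IH|u i i2 _ IH].
- exact: erel_conj.
- exact: ErelMove.
- exact: ErelMoveV.
Qed.

Lemma erel_move s i : (i < 2)%N -> erel s (hmove i (hmove i s)).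
Proof. by move=> i2; apply: ErelMove => //; apply: erel_refl. Qed.

Lemma erel_moveV s i : (i < 2)%N -> erel s (hmoveV i (hmoveV i s)).
Proof. by move=> i2; apply: ErelMoveV => //; apply: erel_refl. Qed.

Lemma erel_sym s t : erel s t -> erel t s.
Proof.
elim=> {t} [t st|t i i2 _ IH|t i i2 _ IH].
- exact/ErelConj/conjugate_sym.
- by apply: erel_trans IH; rewrite -{2}[t](hmoveK i) -{2}[hmove i t](hmoveK i); apply: erel_moveV.
- by apply: erel_trans IH; rewrite -{2}[t](hmoveVK i) -{2}[hmoveV i t](hmoveVK i); apply: erel_move.
Qed.

Definition quad s : Prop := size s = 4 /\ (\prod_(x <- s) x = 1)%g.

Lemma quadP s : quad s -> exists a b c, s = [:: a; b; c; (a * b * c)^-1%g].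
Proof.
case=> s4; case: s s4 => [|a [|b [|c [|d [|e s]]]]] //= _ s1; exists a, b, c.
congr [:: _; _; _; _]; apply: (mulgI (a * b * c)%g); rewrite mulgV.
by move: s1; rewrite !big_cons big_nil mulg1 !mulgA.
Qed.

Lemma quad_hmove s i : quad s -> quad (hmove i s).
Proof. by case=> s4 s1; split; rewrite ?size_hmove ?prod_hmove. Qed.

Lemma quad_hmoveV s i : quad s -> quad (hmoveV i s).
Proof.
by case=> s4 s1; split; rewrite ?size_hmoveV // -(prod_hmove i) hmoveVK.
Qed.

Ltac gsimpl := rewrite ?(invgM, invgK, mulgA, mulgVK, mulgK, mulVg, mulgV,
  mul1g, mulg1).

(** The word is the full twist of the first three strands, which conjugates them by their product.
    This product is the inverse of the fourth entry, so the whole tuple gets conjugated. *)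
Lemma full_twist01 s : quad s ->
  conjugate s (hmove 1 (hmove 1 (hmove 0 (hmove 1 (hmove 1 (hmove 0 s)))))).
Proof.
case/quadP=> a [b [c ->]]; exists (a * b * c)%g.
by rewrite /hmove /=; congr [:: _; _; _; _]; gsimpl.
Qed.

Lemma full_twist10 s : quad s ->
  conjugate s (hmove 0 (hmove 0 (hmove 1 (hmove 0 (hmove 0 (hmove 1 s)))))).
Proof.
case/quadP=> a [b [c ->]]; exists (a * b * c)%g.
by rewrite /hmove /=; congr [:: _; _; _; _]; gsimpl.
Qed.

Lemma full_twist21 s : quad s ->
  conjugate s (hmove 1 (hmove 1 (hmove 2 (hmove 1 (hmove 1 (hmove 2 s)))))).
Proof.
case/quadP=> a [b [c ->]]; exists (a^-1)%g.
by rewrite /hmove /=; congr [:: _; _; _; _]; gsimpl.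
Qed.

(** One square conjugates the first pair by a b, the other the last pair by c d, which is the
    inverse of a b. *)
Lemma twist2 s : quad s -> conjugate (hmove 0 (hmove 0 s)) (hmove 2 (hmove 2 s)).
Proof.
case/quadP=> a [b [c ->]]; exists (b^-1 * a^-1)%g.
by rewrite /hmove /=; congr [:: _; _; _; _]; gsimpl.
Qed.

Lemma erel_twist2 s : quad s -> erel s (hmove 2 (hmove 2 s)).
Proof. by move=> /twist2; apply: erel_conj; apply: erel_move. Qed.

Lemma hmove_comm02 s : quad s -> hmove 2 (hmove 0 s) = hmove 0 (hmove 2 s).
Proof. by case/quadP=> a [b [c ->]]. Qed.

(** Conjugating a square by a generator gives nothing new: since the full twist is trivial here, s_k
    s_l^2 s_k acts as the inverse of s_l^2, and generators 0 and 2 commute. *)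
Lemma erel_hmove_sq s i j : quad s -> (i < 3)%N -> (j < 2)%N ->
  erel (hmove i s) (hmove i (hmove j (hmove j s))).
Proof.
move=> sq i3 j2; have [->|ij] := eqVneq i j; first exact: erel_move.
have twist k l t : (l < 2)%N -> quad t ->
    conjugate t (hmove l (hmove l (hmove k (hmove l (hmove l (hmove k t)))))) ->
    erel (hmove k (hmove k t)) t ->
    erel (hmove k (hmove k t)) (hmove k (hmove l (hmove l (hmove k t)))).
  move=> l2 tq tc tt; apply: erel_trans tt _.
  have := erel_moveV (hmove l (hmove l (hmove k (hmove l (hmove l (hmove k t)))))) l2.
  by rewrite !hmoveK; apply: erel_trans; apply: ErelConj.
have wl k l : (l < 2)%N ->
    (forall t, quad t ->
      conjugate t (hmove l (hmove l (hmove k (hmove l (hmove l (hmove k t))))))) ->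
    (forall t, quad t -> erel (hmove k (hmove k t)) t) ->
    erel (hmove k s) (hmove k (hmove l (hmove l s))).
  move=> l2 tc tt; have := twist k l (hmoveV k s) l2.
  rewrite !hmoveVK; apply; first exact: quad_hmoveV.
    by have := tc _ (quad_hmoveV k sq); rewrite !hmoveVK.
  by have := tt _ (quad_hmoveV k sq); rewrite hmoveVK.
case: i j i3 j2 ij => [|[|[|//]]] [|[|//]] _ _ // _.
- apply: wl => // [t|t _]; [exact: full_twist01 | exact/erel_sym/erel_move].
- apply: wl => // [t|t _]; [exact: full_twist10 | exact/erel_sym/erel_move].
- rewrite !hmove_comm02 //; first exact: erel_move.
  exact: quad_hmove.
- by apply: wl => // [t|t tq]; [exact: full_twist21 | exact/erel_sym/erel_twist2].
Qed.

Lemma quad_conj s t : conjugate s t -> quad s -> quad t.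
Proof.
case=> g -> [s4 s1]; split; first by rewrite size_conjs.
have -> : (\prod_(x <- conjs g s) x = g * (\prod_(x <- s) x) * g^-1)%g.
  elim: (s) => [|x s' IH]; first by rewrite !big_nil mulg1 mulgV.
  by rewrite /= !big_cons IH; gsimpl.
by rewrite s1 mulg1 mulgV.
Qed.

Lemma quad_erel s t : erel s t -> quad s -> quad t.
Proof.
elim=> {t} [t st|t i _ _ IH|t i _ _ IH] sq.
- exact: quad_conj st sq.
- exact/quad_hmove/quad_hmove/IH.
- exact/quad_hmoveV/quad_hmoveV/IH.
Qed.

Lemma erel_hmove s t i : (i < 3)%N -> quad s -> erel s t ->
  erel (hmove i s) (hmove i t).
Proof.
move=> i3 sq st; elim: st => {t} [t st|t j j2 st IH|t j j2 st IH].
- exact/ErelConj/conjugate_hmove.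
- apply: erel_trans IH _; apply: erel_hmove_sq => //; exact: quad_erel st sq.
- apply: erel_trans IH (erel_sym _).
  have := @erel_hmove_sq (hmoveV j (hmoveV j t)) i j _ i3 j2.
  by rewrite !hmoveVK; apply; apply/quad_hmoveV/quad_hmoveV/(quad_erel st).
Qed.

Lemma erel_twist s i : (i < 3)%N -> quad s -> erel s (hmove i (hmove i s)).
Proof.
case: i => [|[|[|//]]] _ sq; [exact: erel_move|exact: erel_move|exact: erel_twist2].
Qed.

End FourStrands.

Section PureBraids4.
Variable F : fieldType.
Implicit Types (rho : affrep F 4) (b c : braid 4).

Local Notation sg := (@sig 4).

Lemma quad_imgs rho : quad (imgs rho).
Proof. by split; [apply: size_imgs | apply: prod_imgs]. Qed.

(** Equality of braids up to the effect of the first two squares; the aim is to show that the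
    quotient is the symmetric group. *)
Definition braid_eqv b c : Prop := braid_perm b = braid_perm c /\
  forall rho, erel (imgs (braid_act b rho)) (imgs (braid_act c rho)).

Lemma braid_eqv_refl b : braid_eqv b b.
Proof. by split=> // rho; apply: erel_refl. Qed.

Lemma braid_eqv_sym b c : braid_eqv b c -> braid_eqv c b.
Proof. by case=> p e; split=> // rho; apply: erel_sym. Qed.

Lemma braid_eqv_trans b c d : braid_eqv b c -> braid_eqv c d -> braid_eqv b d.
Proof.
move=> [p e] [p' e']; split=> [|rho]; first by rewrite p.
exact: erel_trans (e rho) (e' rho).
Qed.

Lemma braid_eqv_mulr b c d : braid_eqv b c -> braid_eqv (b * d)%g (c * d)%g.
Proof.
move=> [p e]; split=> [|rho]; last by rewrite !act_mul; apply: e.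
by rewrite !gmulfM /= p.
Qed.

Lemma braid_eqv_sig i b c : braid_eqv b c -> braid_eqv (sg i * b)%g (sg i * c)%g.
Proof.
move=> [p e]; split=> [|rho]; first by rewrite !gmulfM /= p.
by rewrite !act_mul !imgs_sig; apply: erel_hmove => //; apply: quad_imgs.
Qed.

Lemma braid_eqv_sq i b : braid_eqv (sg i * (sg i * b))%g b.
Proof.
split=> [|rho].
  rewrite mulgA gmulfM gmulfM /= [braid_perm (sg i)](plift_gen (@braid_perm_rel 4)).
  by rewrite tperm2 mul1g.
rewrite !act_mul !imgs_sig; apply/erel_sym/erel_twist => //.
exact: quad_imgs.
Qed.

Definition bword (w : seq 'I_3) : braid 4 := (\prod_(i <- w) sig (i : 'I_(4.-1)))%g.

Lemma bword_cons i w : bword (i :: w) = (sig (i : 'I_(4.-1)) * bword w)%g.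
Proof. exact: big_cons. Qed.

Lemma bword_eqv_cat v w w' : braid_eqv (bword w) (bword w') ->
  braid_eqv (bword (v ++ w)) (bword (v ++ w')).
Proof.
by move=> ww'; elim: v => [//|i v IHv]; rewrite !cat_cons !bword_cons; apply: braid_eqv_sig.
Qed.

Lemma bword_cat v w : bword (v ++ w) = (bword v * bword w)%g.
Proof. exact: big_cat. Qed.

Let s0 : 'I_3 := @Ordinal 3 0 isT.
Let s1 : 'I_3 := @Ordinal 3 1 isT.
Let s2 : 'I_3 := @Ordinal 3 2 isT.

Lemma braid_pi l r : @braid_rel 4 l r ->
  \pi_(braid 4)%qT l = \pi_(braid 4)%qT r.
Proof.
move=> lr; apply/eqP/presented_eqP.
by have := word_eq_rel [::] [::] lr; rewrite !cats0.
Qed.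

Lemma bword_pi w : bword w = \pi_(braid 4)%qT [seq (i, true) | i <- w].
Proof.
elim: w => [|i w IHw]; first exact: big_nil.
by rewrite bword_cons IHw [LHS]presented_mulE.
Qed.

Lemma bword_far : bword [:: s0; s2] = bword [:: s2; s0].
Proof. by rewrite !bword_pi; apply: braid_pi; apply: BraidFar. Qed.
Lemma bword_near01 : bword [:: s0; s1; s0] = bword [:: s1; s0; s1].
Proof. by rewrite !bword_pi; apply: braid_pi; apply: BraidNear. Qed.
Lemma bword_near12 : bword [:: s1; s2; s1] = bword [:: s2; s1; s2].
Proof. by rewrite !bword_pi; apply: braid_pi; apply: BraidNear. Qed.

(* Representatives of the cosets of [S_2] in [S_3] and of [S_3] in [S_4]. *)
Definition nf2 : seq (seq 'I_3) := [:: [::]; [:: s0]].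
Definition nf3 : seq (seq 'I_3) := [:: [::]; [:: s1]; [:: s0; s1]].
Definition nf4 : seq (seq 'I_3) := [:: [::]; [:: s2]; [:: s1; s2]; [:: s0; s1; s2]].

Lemma nf2_closed w : w \in nf2 ->
  exists2 w', w' \in nf2 & braid_eqv (bword (s0 :: w)) (bword w').
Proof.
rewrite !inE => /orP[]/eqP->.
  by exists [:: s0]; [rewrite !inE eqxx ?orbT | apply: braid_eqv_refl].
by exists [::]; [rewrite !inE | rewrite !bword_cons; apply: braid_eqv_sq].
Qed.

Lemma eqv_eq b c : b = c -> braid_eqv b c.
Proof. by move=> ->; apply: braid_eqv_refl. Qed.

Lemma nf3_closed (i : 'I_3) q : (i < 2)%N -> q \in nf3 ->
  exists q' p, [/\ q' \in nf3, all (pred1 s0) p &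
    braid_eqv (bword (i :: q)) (bword (q' ++ p))].
Proof.
have [e|[e|e]] : i = s0 \/ i = s1 \/ i = s2.
- case: i => -[|[|[|//]]] i3; [left|right; left|right; right]; exact: val_inj.
all: rewrite {}e // => _; rewrite !inE => /or3P[] /eqP->.
- by exists [::], [:: s0]; split=> //; apply: braid_eqv_refl.
- by exists [:: s0; s1], [::]; split=> //; apply: braid_eqv_refl.
- exists [:: s1], [::]; split=> //; rewrite !bword_cons; exact: braid_eqv_sq.
- by exists [:: s1], [::]; split=> //; apply: braid_eqv_refl.
- exists [::], [::]; split=> //; rewrite !bword_cons; exact: braid_eqv_sq.
- exists [:: s0; s1], [:: s0]; split=> //; apply: eqv_eq; exact/esym/bword_near01.
Qed.

(** Coset enumeration: squares of generators being trivial for [braid_eqv], the braid relations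
    become the Coxeter presentation of the symmetric group. *)
Lemma nf4_closed (i : 'I_3) r : r \in nf4 ->
  exists r' p, [/\ r' \in nf4, all (fun j : 'I_3 => j < 2)%N p &
    braid_eqv (bword (i :: r)) (bword (r' ++ p))].
Proof.
have [e|[e|e]] : i = s0 \/ i = s1 \/ i = s2.
- case: i => -[|[|[|//]]] i3; [left|right; left|right; right]; exact: val_inj.
all: rewrite {}e !inE => /or4P[] /eqP->.
- by exists [::], [:: s0]; split=> //; apply: braid_eqv_refl.
- exists [:: s2], [:: s0]; split=> //; apply: eqv_eq; exact: bword_far.
- by exists [:: s0; s1; s2], [::]; split=> //; apply: braid_eqv_refl.
- exists [:: s1; s2], [::]; split=> //; rewrite !bword_cons; exact: braid_eqv_sq.
- by exists [::], [:: s1]; split=> //; apply: braid_eqv_refl.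
- by exists [:: s1; s2], [::]; split=> //; apply: braid_eqv_refl.
- exists [:: s2], [::]; split=> //; rewrite !bword_cons; exact: braid_eqv_sq.
- exists [:: s0; s1; s2], [:: s0]; split=> //; apply: eqv_eq.
  rewrite -(cat1s s1) -[[:: s0; s1; s2]]/([:: s0; s1] ++ [:: s2]) catA bword_cat.
  rewrite -[_ ++ _]/[:: s1; s0; s1] -bword_near01 -bword_cat.
  rewrite -[_ ++ _]/([:: s0; s1] ++ [:: s0; s2]) bword_cat bword_far -bword_cat.
  by [].
- by exists [:: s2], [::]; split=> //; apply: braid_eqv_refl.
- exists [::], [::]; split=> //; rewrite !bword_cons; exact: braid_eqv_sq.
- exists [:: s1; s2], [:: s1]; split=> //; apply: eqv_eq; exact/esym/bword_near12.
- exists [:: s0; s1; s2], [:: s1]; split=> //; apply: eqv_eq.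
  rewrite -[[:: s2; _; _; _]]/([:: s2; s0] ++ [:: s1; s2]) bword_cat -bword_far.
  rewrite -bword_cat -[_ ++ _]/([:: s0] ++ [:: s2; s1; s2]) bword_cat.
  by rewrite -bword_near12 -bword_cat.
Qed.

Lemma low_word p : all (fun j : 'I_3 => j < 2)%N p ->
  exists q t, [/\ q \in nf3, t \in nf2 & braid_eqv (bword p) (bword (q ++ t))].
Proof.
elim: p => [_|i p IHp /andP[i2 /IHp[q [t [q3 t2 pqt]]]]].
  by exists [::], [::]; split=> //; apply: braid_eqv_refl.
have [q' [u [q'3 us0 iq]]] := nf3_closed i2 q3.
have [t' t'2 ut] : exists2 t', t' \in nf2 & braid_eqv (bword (u ++ t)) (bword t').
  elim: u us0 {iq} => [_|j u IHu /andP[/eqP-> /IHu[t' t'2 ut]]].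
    by exists t => //; apply: braid_eqv_refl.
  have [t'' t''2 st] := nf2_closed t'2; exists t'' => //.
  by apply: braid_eqv_trans st; rewrite cat_cons !bword_cons; apply: braid_eqv_sig.
exists q', t'; split=> //.
rewrite bword_cons; apply: braid_eqv_trans (braid_eqv_sig _ pqt) _.
rewrite -bword_cons -cat_cons bword_cat.
apply: braid_eqv_trans (braid_eqv_mulr _ iq) _.
by rewrite -bword_cat -catA; apply: bword_eqv_cat.
Qed.

Lemma braid_eqv_nf b : exists r q t,
  [/\ r \in nf4, q \in nf3, t \in nf2 & braid_eqv b (bword (r ++ q ++ t))].
Proof.
have step (i : 'I_3) c : (exists r q t, [/\ r \in nf4, q \in nf3, t \in nf2 &
      braid_eqv c (bword (r ++ q ++ t))]) ->
    exists r q t, [/\ r \in nf4, q \in nf3, t \in nf2 &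
      braid_eqv (sg i * c)%g (bword (r ++ q ++ t))].
  case=> r [q [t [r4 q3 t2 cE]]]; have [r' [p [r'4 p2 ir]]] := nf4_closed i r4.
  have p'2 : all (fun j : 'I_3 => j < 2)%N (p ++ q ++ t).
    by rewrite !all_cat p2; move: q3 t2; rewrite !inE => /or3P[]/eqP-> /orP[]/eqP->.
  have [q' [t' [q'3 t'2 pq]]] := low_word p'2.
  exists r', q', t'; split=> //; apply: braid_eqv_trans (braid_eqv_sig i cE) _.
  rewrite -bword_cons -cat_cons bword_cat.
  apply: braid_eqv_trans (braid_eqv_mulr _ ir) _.
  by rewrite -bword_cat -catA; apply: bword_eqv_cat.
elim/braid_ind: b => [|i b|i b IHb].
- exists [::], [::], [::]; split=> //; rewrite /bword big_nil; exact: braid_eqv_refl.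
- exact: step.
have [r [q [t [r4 q3 t2 e]]]] := step i b IHb.
exists r, q, t; split=> //; apply: braid_eqv_trans e.
have -> : (sg i * b = sg i * (sg i * ((sg i)^-1 * b)))%g by rewrite mulVKg.
exact/braid_eqv_sym/braid_eqv_sq.
Qed.

Definition swap (k i : nat) : nat :=
  if k == i then i.+1 else if k == i.+1 then i else k.

Lemma bword_perm w (k : 'I_4) :
  val (braid_perm (bword w) k) = foldl swap k [seq val i | i <- w].
Proof.
elim: w k => [|i w IHw] k.
  by rewrite /bword big_nil (gmulf1_presented (@braid_perm 4)) perm1.
rewrite bword_cons gmulfM permM IHw /=; congr foldl.
rewrite [braid_perm (sg _)](plift_gen (@braid_perm_rel 4)).
rewrite /swap; case: tpermP => [->|->|/eqP ki /eqP kh] /=.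
- by rewrite eqxx.
- by rewrite eqxx (gtn_eqF (ltnSn _)).
- by move: ki kh; rewrite -!val_eqE /= => /negPf-> /negPf->.
Qed.

(** Every braid is equivalent to one of 24 normal forms; among these only the empty word induces the
    identity permutation. *)
Lemma pure_erel b rho : pure_braid b -> erel (imgs rho) (imgs (braid_act b rho)).
Proof.
move=> bp; have [r [q [t [r4 q3 t2 [pE actE]]]]] := braid_eqv_nf b.
have w1 : r ++ q ++ t = [::].
  have id_w k : (k < 4)%N -> foldl swap k [seq val i | i <- r ++ q ++ t] = k.
    by move=> k4; rewrite -(bword_perm _ (Ordinal k4)) -pE bp perm1.
  move: (id_w 0 isT) (id_w 1 isT) (id_w 2 isT) (id_w 3 isT).
  by move: r4 q3 t2; rewrite !inE => /or4P[]/eqP-> /or3P[]/eqP-> /orP[]/eqP->.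
have := actE rho; rewrite w1 /bword big_nil act_one; exact: erel_sym.
Qed.

Lemma erel_pure s rho : erel (imgs rho) s ->
  exists2 b, pure_braid b & conjugate (imgs (braid_act b rho)) s.
Proof.
have sq i : braid_perm (sg i * sg i : braid 4)%g = 1%g.
  by rewrite gmulfM /= [braid_perm (sg i)](plift_gen (@braid_perm_rel 4)) tperm2.
elim=> {s} [s rs|s i i2 _ [b bp bs]|s i i2 _ [b bp bs]].
- exists 1%g; last by rewrite act_one.
  exact: (gmulf1_presented (@braid_perm 4)).
- pose j : 'I_(4.-1) := @Ordinal 3 i (ltnW i2); exists (sg j * sg j * b)%g.
    by rewrite /pure_braid /= gmulfM /= sq mul1g.
  by rewrite -mulgA !act_mul !(imgs_sig j); do 2!apply: conjugate_hmove.
- pose j : 'I_(4.-1) := @Ordinal 3 i (ltnW i2); exists ((sg j * sg j)^-1 * b)%g.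
    by rewrite /pure_braid /= gmulfM /= (gmulfV_presented (@braid_perm 4)) /= sq invg1 mul1g.
  by rewrite invgM -mulgA !act_mul !(imgs_sigV j); do 2!apply: conjugate_hmoveV.
Qed.

Lemma pb_orbit4 rho :
  pb_orbit (conj_class rho) =
  [set conj_class rho' | rho' in [set rho' | erel (imgs rho) (imgs rho')]]%classic.
Proof.
rewrite pb_orbitE; apply/seteqP; split=> [_ [b bp <-]|_ [rho' /= rr <-]].
  by exists (braid_act b rho) => //; apply: pure_erel.
have [b bp bc] := erel_pure rr; exists b => //; exact/conj_class_eq.
Qed.

End PureBraids4.

(** * Affine tuples and coordinates on PH_lambda *)

Section AffineTuples.
Variable F : fieldType.
Implicit Types (x y g : aff F) (s t : seq (aff F)).

Lemma lin1 : lin (1%g : aff F) = 1. Proof. by []. Qed.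
Lemma trans1 : trans (1%g : aff F) = 0. Proof. by []. Qed.
Lemma linM x y : lin (x * y)%g = lin x * lin y. Proof. by []. Qed.
Lemma transM x y : trans (x * y)%g = lin x * trans y + trans x. Proof. by []. Qed.
Lemma linV x : lin (x^-1)%g = (lin x)^-1. Proof. by []. Qed.
Lemma transV x : trans (x^-1)%g = - ((lin x)^-1 * trans x). Proof. by []. Qed.

Lemma lin_conj x y : lin (x * y * x^-1)%g = lin y.
Proof. by rewrite !linM linV mulrAC mulfV ?mul1r ?lin_neq0. Qed.

Lemma trans_conj x y :
  trans (x * y * x^-1)%g = lin x * trans y + (1 - lin y) * trans x.
Proof.
rewrite !(transM, linM) transV; have := lin_neq0 x.
by move: (lin x) => a a0; field.
Qed.

Lemma lin_conjV x y : lin (x^-1 * y * x)%g = lin y.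
Proof. by rewrite -{2}[x]invgK lin_conj. Qed.

Lemma linear_conjs g s : map (@lin F) (conjs g s) = map (@lin F) s.
Proof. by rewrite -map_comp; apply: eq_map => x /=; rewrite lin_conj. Qed.

Lemma lin_prod s : lin (\prod_(x <- s) x)%g = \prod_(x <- s) lin x.
Proof. by elim: s => [|x s IHs]; rewrite ?big_nil // !big_cons linM IHs. Qed.

Definition fixes x (c : F) : Prop := lin x * c + trans x = c.

(** These are the tuples excluded from PH_lambda: moving the common fixed point to 0 kills all
    translation parts ([centered_trans0]). *)
Definition centered s : Prop := exists c, forall x, x \in s -> fixes x c.

Lemma fixes_trans x c : fixes x c <-> trans x = (1 - lin x) * c.
Proof.
rewrite /fixes; split=> [e|->]; last by ring.
by apply: (lincomb1 (k1 := 1) e); ring.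
Qed.

Lemma fixes_mul x y c : fixes x c -> fixes y c -> fixes (x * y)%g c.
Proof.
rewrite !fixes_trans linM transM => -> ->; ring.
Qed.

Lemma fixes_inv x c : fixes x c -> fixes (x^-1)%g c.
Proof.
rewrite !fixes_trans linV transV => ->; have := lin_neq0 x.
by move: (lin x) => a a0; field.
Qed.

Lemma fixes_conj g x c : fixes x c -> fixes (g * x * g^-1)%g (aff_fun g c).
Proof.
rewrite !fixes_trans lin_conj trans_conj /aff_fun => ->; ring.
Qed.

Lemma centered_conj g s : centered s -> centered (conjs g s).
Proof.
case=> c cP; exists (aff_fun g c) => _ /mapP[x xs ->]; exact/fixes_conj/cP.
Qed.

Lemma centered_trans0 s : centered s <->
  exists g, forall x, x \in conjs g s -> trans x = 0.
Proof.
split=> [[c cP]|[g gP]].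
  exists (mk_aff (- c) (oner_neq0 F)) => _ /mapP[x /cP/fixes_trans xc ->].
  by rewrite trans_conj xc /lin /trans /=; ring.
rewrite -(conjsK g s); apply: centered_conj; exists 0 => x /gP x0.
by apply/fixes_trans; rewrite x0 mulr0.
Qed.

End AffineTuples.

Section QuadCoordinates.
Variable F : numClosedFieldType.
Implicit Types (x y g : aff F) (s t : seq (aff F)).

(* With [c_i] the fixed point of the [i]-th map, this is the pair
   [(c_0 - c_1, c_1 - c_2)] up to the factor [(1-l_0)(1-l_1)(1-l_2)]. *)
Definition vec_of (l t : seq F) : F * F :=
  ((t`_0 * (1 - l`_1) - t`_1 * (1 - l`_0)) * (1 - l`_2),
   (t`_1 * (1 - l`_2) - t`_2 * (1 - l`_1)) * (1 - l`_0)).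
Definition vec s : F * F := vec_of (map (@lin F) s) (map (@trans F) s).

Lemma vec_conj g s : size s = 4 ->
  vec (conjs g s) = (lin g * (vec s).1, lin g * (vec s).2).
Proof.
case: s => [|a [|b [|c [|d [|//]]]]] // _.
rewrite /vec linear_conjs /vec_of /= !trans_conj.
by congr pair; ring.
Qed.

(** [matA] and [matB] are the actions of the squares of the first two generators on [vec]
    ([vec_hmove0], [vec_hmove1]). *)
Definition matA (l : seq F) : mat2 F := (l`_0 * l`_1, 0, 1 - l`_0, 1).
Definition matB (l : seq F) : mat2 F := (1, l`_1 * (1 - l`_2), 0, l`_1 * l`_2).

Lemma linear_hmove2 i s : map (@lin F) (hmove i (hmove i s)) = map (@lin F) s.
Proof.
have [si|si] := ltnP i.+1 (size s); last by rewrite !(hmove_big si).1.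
have [u [x [y [v [-> ui]]]]] := split_at si.
by rewrite !hmove_cat // !map_cat /= !lin_conj.
Qed.

Lemma linear_hmoveV2 i s : map (@lin F) (hmoveV i (hmoveV i s)) = map (@lin F) s.
Proof. by rewrite -[in RHS](hmoveVK i s) -[in RHS](hmoveVK i (hmoveV i s)) linear_hmove2. Qed.

Lemma linear_erel s t : erel s t -> map (@lin F) t = map (@lin F) s.
Proof.
elim=> {t} [t [g ->]|t i _ _ <-|t i _ _ <-].
- exact: linear_conjs.
- exact: linear_hmove2.
- exact: linear_hmoveV2.
Qed.

Lemma vec_hmove0 s : size s = 4 ->
  vec (hmove 0 (hmove 0 s)) = mapply (matA (map (@lin F) s)) (vec s).
Proof.
case: s => [|a [|b [|c [|d [|//]]]]] // _.
rewrite /vec /vec_of /hmove /= !lin_conj !trans_conj !lin_conj.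
by congr pair; ring.
Qed.

Lemma vec_hmove1 s : size s = 4 ->
  vec (hmove 1 (hmove 1 s)) = mapply (matB (map (@lin F) s)) (vec s).
Proof.
case: s => [|a [|b [|c [|d [|//]]]]] // _.
rewrite /vec /vec_of /hmove /= !lin_conj !trans_conj !lin_conj.
by congr pair; ring.
Qed.

(** Zero coordinates say that the first three maps share their fixed point; the fourth, the inverse
    of their product, then fixes it too. *)
Lemma vec_eq0 s : quad s -> all (fun z => z != 1) (map (@lin F) s) ->
  vec s = 0 <-> centered s.
Proof.
move=> sq; have [a [b [c sE]]] := quadP sq.
rewrite sE /vec /vec_of /= => /and5P[a1 b1 c1 _ _].
have a0 : 1 - lin a != 0 by rewrite subr_eq0 eq_sym.
have b0 : 1 - lin b != 0 by rewrite subr_eq0 eq_sym.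
have c0 : 1 - lin c != 0 by rewrite subr_eq0 eq_sym.
split=> [[/eqP + /eqP]|[z zP]].
  rewrite !mulf_eq0 (negPf a0) (negPf c0) !orbF !subr_eq0 => /eqP e1 /eqP e2.
  exists (trans b / (1 - lin b)).
  have fa : fixes a (trans b / (1 - lin b)).
    by apply/fixes_trans; apply: (mulIf b0); rewrite e1; field.
  have fb : fixes b (trans b / (1 - lin b)) by apply/fixes_trans; field.
  have fc : fixes c (trans b / (1 - lin b)).
    by apply/fixes_trans; apply: (mulIf b0); rewrite -e2; field.
  move=> x; rewrite !inE => /or4P[]/eqP-> //.
  exact/fixes_inv/fixes_mul/fc/fixes_mul.
have /fixes_trans-> := zP a (mem_head _ _).
have /fixes_trans-> : fixes b z by apply: zP; rewrite !inE eqxx ?orbT.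
have /fixes_trans-> : fixes c z by apply: zP; rewrite !inE eqxx ?orbT.
by congr pair; ring.
Qed.

(** The ratio k of the two vectors is the linear part of the conjugating map, whose translation part
    is then fitted on one entry. *)
Lemma conj_of_vec s t : quad s -> quad t ->
  all (fun z => z != 1) (map (@lin F) s) ->
  map (@lin F) t = map (@lin F) s -> vec s != 0 -> vec t != 0 ->
  cross (vec s) (vec t) = 0 -> conjugate s t.
Proof.
move=> sq tq; have [a [b [c ->]]] := quadP sq; have [a' [b' [c' ->]]] := quadP tq.
move=> /= /and5P[a1 b1 c1 _ _] [la lb lc _] s0 t0 cr.
have a0 : 1 - lin a != 0 by rewrite subr_eq0 eq_sym.
have b0 : 1 - lin b != 0 by rewrite subr_eq0 eq_sym.
have c0 : 1 - lin c != 0 by rewrite subr_eq0 eq_sym.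
have [k k0 [ku kv]] : exists2 k, k != 0 &
    vec [:: a'; b'; c'; (a' * b' * c')^-1%g] =
    (k * (vec [:: a; b; c; (a * b * c)^-1%g]).1,
     k * (vec [:: a; b; c; (a * b * c)^-1%g]).2).
  move: s0 t0 cr; move: (vec _) (vec _) => [u' v'] [u v].
  rewrite -[0]/(0, 0) /cross !xpair_eqE !negb_and /= => uv uv' cr.
  have [u0|u0] := eqVneq u 0.
    have v0 : v != 0 by move: uv; rewrite u0 eqxx.
    have u'0 : u' = 0.
      by move: cr; rewrite u0 mul0r sub0r => /eqP; rewrite oppr_eq0 mulf_eq0 (negPf v0) => /eqP.
    exists (v' / v); last by rewrite u0 u'0 mulr0 divfK.
    by rewrite mulf_neq0 ?invr_eq0 //; move: uv'; rewrite u'0 eqxx.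
  have v'E : v' = u' / u * v.
    by apply: (mulfI u0); apply: (lincomb1 (k1 := 1) cr); field.
  exists (u' / u); last by rewrite divfK // -v'E.
  rewrite mulf_neq0 ?invr_eq0 //; apply: contraTneq uv' => u'0.
  by rewrite v'E u'0 !mul0r eqxx.
move: ku kv; rewrite /= la lb lc => ku kv.
(* Chosen to send a to a'; the equations [ku] and [kv] carry b, then c, to b' and c'. *)
pose e := (trans a' - k * trans a) / (1 - lin a).
have ta : trans a' = k * trans a + (1 - lin a) * e by rewrite /e; field.
have tb : trans b' = k * trans b + (1 - lin b) * e.
  apply: (mulIf (mulf_neq0 c0 a0)).
  by apply: (lincomb1 (k1 := -1) ku); rewrite ta; ring.
have tc : trans c' = k * trans c + (1 - lin c) * e.
  apply: (mulIf (mulf_neq0 a0 b0)).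
  by apply: (lincomb1 (k1 := -1) kv); rewrite tb; ring.
pose g : aff F := mk_aff e k0.
have ca : (g * a * g^-1)%g = a' by apply: aff_ext; rewrite ?lin_conj // trans_conj ta.
have cb : (g * b * g^-1)%g = b' by apply: aff_ext; rewrite ?lin_conj // trans_conj tb.
have cc : (g * c * g^-1)%g = c' by apply: aff_ext; rewrite ?lin_conj // trans_conj tc.
exists g; rewrite /= -ca -cb -cc !invgM !invgK !mulgA !mulgVK.
by [].
Qed.

(** Inverts the coordinates, with the second map normalized to fix 0. *)
Lemma quad_of_vec (l : seq F) (u v : F) : size l = 4 -> \prod_(z <- l) z = 1 ->
  all (fun z => z != 1) l -> (u, v) != 0 ->
  exists s, [/\ quad s, map (@lin F) s = l, vec s != 0 & cross (vec s) (u, v) = 0].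
Proof.
case: l => [|l0 [|l1 [|l2 [|l3 [|//]]]]] // _; rewrite !big_cons big_nil mulr1 => l1E.
move=> /and5P[a1 b1 c1 _ _] uv.
have a0 : 1 - l0 != 0 by rewrite subr_eq0 eq_sym.
have b0 : 1 - l1 != 0 by rewrite subr_eq0 eq_sym.
have c0 : 1 - l2 != 0 by rewrite subr_eq0 eq_sym.
have l0n : l0 != 0 by apply: contra_eqN l1E => /eqP->; rewrite mul0r eq_sym oner_eq0.
have l1n : l1 != 0 by apply: contra_eqN l1E => /eqP->; rewrite mul0r mulr0 eq_sym oner_eq0.
have l2n : l2 != 0 by apply: contra_eqN l1E => /eqP->; rewrite mul0r !mulr0 eq_sym oner_eq0.
pose a : aff F := mk_aff (u / ((1 - l1) * (1 - l2))) l0n.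
pose b : aff F := mk_aff 0 l1n.
pose c : aff F := mk_aff (- v / ((1 - l1) * (1 - l0))) l2n.
have vE : vec [:: a; b; c; (a * b * c)^-1%g] = (u, v).
  rewrite /vec /vec_of /= /lin /trans /=; congr pair; field; exact/andP.
exists [:: a; b; c; (a * b * c)^-1%g]; split.
- by split=> //; rewrite !big_cons big_nil mulg1 !mulgA mulgV.
- rewrite /= linV !linM; congr [:: _; _; _; _].
  by apply: (mulfI (mulf_neq0 (mulf_neq0 l0n l1n) l2n)); rewrite mulfV ?mulf_neq0 // -!mulrA.
- by rewrite vE.
- by rewrite vE /cross /=; ring.
Qed.

End QuadCoordinates.

Section ProjectiveSpace.
Variables (F : fieldType) (n : nat).
Implicit Types (rho : affrep F n) (lam : n.-tuple F).

Lemma linear_partE rho : linear_part rho = map (@lin F) (imgs rho) :> seq F.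
Proof. by rewrite /imgs -[RHS]map_comp. Qed.

Lemma translation_partE rho :
  translation_part rho = map (@trans F) (imgs rho) :> seq F.
Proof. by rewrite /imgs -[RHS]map_comp. Qed.

Lemma mem_imgs rho k : rho (alpha k) \in imgs rho.
Proof. by apply: (map_f (fun k => rho (alpha k))); rewrite mem_enum. Qed.

Lemma PH_class lam rho : PH lam (conj_class rho) <->
  map (@lin F) (imgs rho) = lam /\ ~ centered (imgs rho).
Proof.
have cen (r : affrep F n) : centered (imgs r) <-> exists2 r', conj_class r r' &
    forall k, trans (r' (alpha k)) = 0.
  rewrite centered_trans0; split=> [[g gP]|[r' /conj_classP[g gr] r'0]].
    have [r' r'E] : exists r' : affrep F n, imgs r' = conjs g (imgs r).
      apply: imgs_surj; first by rewrite size_conjs size_imgs.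
      have -> : (\prod_(x <- conjs g (imgs r)) x =
          g * (\prod_(x <- imgs r) x) * g^-1)%g.
        elim: (imgs r) => [|x s IH]; first by rewrite !big_nil mulg1 mulgV.
        by rewrite /= !big_cons IH !mulgA mulgVK.
      by rewrite prod_imgs mulg1 mulgV.
    exists r'; first by apply/conj_classP; exists g.
    by move=> k; apply: gP; rewrite -r'E mem_imgs.
  exists g => x; rewrite -gr => /mapP[k _ ->]; exact: r'0.
split=> [[r [rl nr] /conj_class_eq c]|[rl nr]].
  split.
    rewrite -rl linear_partE.
    by case: c => g ->; rewrite linear_conjs.
  move=> crho; apply: nr; apply/cen; case/conjugate_sym: c => g ->.
  exact: centered_conj.
exists rho => //; split; first by apply: val_inj; rewrite /= linear_partE.
by move/cen.
Qed.

Lemma PH_inv lam p : PH lam p -> exists2 rho, p = conj_class rho &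
  map (@lin F) (imgs rho) = lam /\ ~ centered (imgs rho).
Proof.
move=> pP; have [r _ rE] := pP; exists r => //.
by apply/PH_class; rewrite rE.
Qed.

End ProjectiveSpace.

(** * Pure braid orbits as orbits on the projective line *)

Section QuadOrbits.
Variables (F : numClosedFieldType) (l : seq F).
Implicit Types (s t : seq (aff F)) (rho : affrep F 4).
Hypotheses (l4 : size l = 4) (l_prod : \prod_(z <- l) z = 1)
  (l_neq1 : all (fun z => z != 1) l).

Let A := matA l.
Let B := matB l.

Lemma lam_neq0 i : (i < 4)%N -> l`_i != 0.
Proof.
move=> i4; apply: contra_eqN l_prod => /eqP li.
rewrite (big_nth 0) big_mkord l4 (bigD1 (Ordinal i4)) //= li mul0r eq_sym.
exact: oner_neq0.
Qed.

Lemma matA_det : mdet A != 0.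
Proof. by rewrite /= mulr1 mul0r subr0 mulf_neq0 // lam_neq0. Qed.
Lemma matB_det : mdet B != 0.
Proof. by rewrite /= mul1r mulr0 subr0 mulf_neq0 // lam_neq0. Qed.

Definition pt s : option F := ppt (vec s).

Definition good s : Prop :=
  [/\ quad s, map (@lin F) s = l & ~ centered s].

Lemma good_vec s : good s -> vec s != 0.
Proof.
case=> sq sl nc; apply/eqP => v0; apply: nc; apply/vec_eq0 => //.
by rewrite sl.
Qed.

Lemma ppt_scale (k : F) (p : F * F) : k != 0 -> ppt (k * p.1, k * p.2) = ppt p.
Proof.
move=> k0; rewrite /ppt /= mulf_eq0 (negPf k0) /=; case: eqP => // _.
by rewrite invfM mulrACA mulfV // mul1r.
Qed.

Lemma pt_conj s t : size s = 4 -> conjugate s t -> pt t = pt s.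
Proof. by move=> s4 [g ->]; rewrite /pt vec_conj // ppt_scale // lin_neq0. Qed.

Lemma good_erel s t : good s -> erel s t -> good t.
Proof.
have aux s' t' : good s' -> erel s' t' -> vec t' != 0 -> good t'.
  move=> [sq sl nc] st t0; have tq := quad_erel st sq.
  have tl : map (@lin F) t' = l by rewrite (linear_erel st).
  split=> // c; case/eqP: t0; apply/vec_eq0 => //; by rewrite tl.
move=> sg st; elim: st => {t} [t st|t i i2 st tg|t i i2 st tg].
- apply: aux (ErelConj st) _ => //; case: st => g ->; case: (sg) => -[s4 _] _ _.
  rewrite vec_conj //; have := good_vec sg; case: (vec s) => u v.
  by rewrite -[0]/(0, 0) !xpair_eqE /= !mulf_eq0 !(negPf (lin_neq0 g)).
- have [[t4 _] tl _] := tg; apply: (aux t) => //; first exact: erel_move.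
  case: i i2 st => [|[|//]] _ _; rewrite ?vec_hmove0 ?vec_hmove1 // tl.
    exact: mapply_neq0 matA_det (good_vec tg).
  exact: mapply_neq0 matB_det (good_vec tg).
- have tt := erel_moveV t i2; apply: (aux t) => //; apply/eqP => v0.
  have [[t4 _] tl _] := tg.
  have := good_vec tg; rewrite -(hmoveVK i t) -(hmoveVK i (hmoveV i t)).
  case/eqP; case: i i2 st {tt} v0 => [|[|//]] _ _ v0;
    rewrite ?vec_hmove0 ?vec_hmove1 ?size_hmoveV // v0 /mapply /=;
    by rewrite !mulr0 !addr0.
Qed.

Lemma pt_move0 s : good s -> pt (hmove 0 (hmove 0 s)) = mob A (pt s).
Proof.
move=> sg; have [[s4 _] sl _] := sg.
by rewrite /pt vec_hmove0 // sl mob_ppt ?matA_det ?good_vec.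
Qed.

Lemma pt_move1 s : good s -> pt (hmove 1 (hmove 1 s)) = mob B (pt s).
Proof.
move=> sg; have [[s4 _] sl _] := sg.
by rewrite /pt vec_hmove1 // sl mob_ppt ?matB_det ?good_vec.
Qed.

Lemma pt_moveV0 s : good s -> pt (hmoveV 0 (hmoveV 0 s)) = mob (madj A) (pt s).
Proof.
move=> sg; have sg' := good_erel sg (@erel_moveV _ s 0 isT).
by rewrite -[s in RHS](hmoveVK 0) -[hmoveV 0 s in RHS](hmoveVK 0)
  pt_move0 // mob_adjK ?matA_det.
Qed.

Lemma pt_moveV1 s : good s -> pt (hmoveV 1 (hmoveV 1 s)) = mob (madj B) (pt s).
Proof.
move=> sg; have sg' := good_erel sg (@erel_moveV _ s 1 isT).
by rewrite -[s in RHS](hmoveVK 1) -[hmoveV 1 s in RHS](hmoveVK 1)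
  pt_move1 // mob_adjK ?matB_det.
Qed.

Lemma erel_morb s t : good s -> erel s t -> morb A B (pt s) (pt t).
Proof.
move=> sg; elim=> {t} [t st|t i i2 st IH|t i i2 st IH].
- by rewrite (pt_conj _ st); [apply: morb_refl | case: sg => -[]].
- apply: (morb_trans matA_det matB_det IH).
  have tg := good_erel sg st; case: i i2 => [|[|//]] _.
    by exists A; [apply: mgen_genL | rewrite pt_move0].
  by exists B; [apply: mgen_genR | rewrite pt_move1].
- apply: (morb_trans matA_det matB_det IH).
  have tg := good_erel sg st; case: i i2 => [|[|//]] _.
    by exists (madj A); [apply/mgen_adj/mgen_genL | rewrite pt_moveV0].
  by exists (madj B); [apply/mgen_adj/mgen_genR | rewrite pt_moveV1].
Qed.

Lemma morb_erel s x : good s -> morb A B (pt s) x -> exists2 t, erel s t & pt t = x.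
Proof.
move=> sg [M gM <-]; elim: gM => [|N gN [t st tE]|N gN [t st tE]|N gN [t st tE]|N gN [t st tE]].
- by exists s; [apply: erel_refl | rewrite mob1].
- have tg := good_erel sg st; exists (hmove 0 (hmove 0 t)); first exact: ErelMove.
  by rewrite pt_move0 // tE mobM ?matA_det // (mgen_det matA_det matB_det gN).
- have tg := good_erel sg st; exists (hmove 1 (hmove 1 t)); first exact: ErelMove.
  by rewrite pt_move1 // tE mobM ?matB_det // (mgen_det matA_det matB_det gN).
- have tg := good_erel sg st; exists (hmoveV 0 (hmoveV 0 t)); first exact: ErelMoveV.
  by rewrite pt_moveV0 // tE mobM ?mdet_adj ?matA_det // (mgen_det matA_det matB_det gN).
- have tg := good_erel sg st; exists (hmoveV 1 (hmoveV 1 t)); first exact: ErelMoveV.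
  by rewrite pt_moveV1 // tE mobM ?mdet_adj ?matB_det // (mgen_det matA_det matB_det gN).
Qed.

Lemma pt_inj s t : good s -> good t -> pt s = pt t -> conjugate s t.
Proof.
move=> sg tg e; have [sq sl _] := sg; have [tq tl _] := tg.
apply: conj_of_vec; rewrite ?sl ?tl ?good_vec //.
by apply/eqP; rewrite -ppt_eq ?good_vec //; apply/eqP.
Qed.

Lemma pt_surj x : exists2 s, good s & pt s = x.
Proof.
have x0 := prep_neq0 x.
have [s [sq sl s0 sx]] : exists s, [/\ quad s, map (@lin F) s = l, vec s != 0 &
    cross (vec s) (prep x) = 0].
  by case E: (prep x) x0 => [u v] x0; apply: quad_of_vec.
exists s.
  split=> // c; case/eqP: s0; apply/vec_eq0 => //; by rewrite sl.
by rewrite -[RHS]prepK; apply/eqP; rewrite ppt_eq // sx.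
Qed.

Lemma imgs_quad s : quad s -> exists rho, imgs rho = s.
Proof. by case=> s4 s1; apply: imgs_surj. Qed.

(** Transports the problem: a pure braid orbit is in bijection with the orbit of its coordinate
    under the group generated by [A] and [B]. *)
Lemma pb_orbit_pts rho : good (imgs rho) -> exists f : option F -> set (affrep F 4),
  [/\ pb_orbit (conj_class rho) = (f @` morb A B (pt (imgs rho)))%classic,
      forall x y, morb A B (pt (imgs rho)) x -> morb A B (pt (imgs rho)) y ->
        f x = f y -> x = y &
      forall x, morb A B (pt (imgs rho)) x -> exists2 rho',
        f x = conj_class rho' & pt (imgs rho') = x /\ good (imgs rho')].
Proof.
move=> rg.
have /choice[f fP] x : exists p : set (affrep F 4), morb A B (pt (imgs rho)) x ->
    exists2 rho', p = conj_class rho' & pt (imgs rho') = x /\ good (imgs rho').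
  have [rx|nx] := pselect (morb A B (pt (imgs rho)) x); last by exists set0.
  have [t rt tx] := morb_erel rg rx; have tg := good_erel rg rt.
  have [r rE] := imgs_quad (quad_erel rt (quad_imgs rho)).
  by exists (conj_class r) => _; exists r; rewrite ?rE.
exists f; split=> //.
- rewrite pb_orbit4; apply/seteqP; split=> [_ [r /= er <-]|_ [x rx <-]].
    have rx := erel_morb rg er; exists (pt (imgs r)) => //.
    have [r' -> [r'x r'g]] := fP _ rx; apply/conj_class_eq.
    by apply: pt_inj => //; apply: good_erel er.
  have [r' -> [r'x r'g]] := fP _ rx; exists r' => //=.
  have [t rt tx] := morb_erel rg rx.
  apply: (erel_conj rt); apply: pt_inj => //; last by rewrite r'x.
  exact: good_erel rt.
- move=> x y /fP[r -> [rx rg']] /fP[r' -> [r'y r'g]].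
  move/conj_class_eq; rewrite -rx -r'y => c.
  by rewrite (pt_conj _ c) // size_imgs.
Qed.

Lemma orbit_size rho (sl : seq (option F)) : good (imgs rho) ->
  orbit_list A B sl (pt (imgs rho)) ->
  has_size (pb_orbit (conj_class rho)) (Some (size sl)).
Proof.
move=> rg [sl_uniq slP]; have [f [-> f_inj _]] := pb_orbit_pts rg.
rewrite /has_size.
have -> : morb A B (pt (imgs rho)) = [set` sl]%classic.
  by apply/seteqP; split=> x /slP.
have e : (f @` [set` sl] #= [set` sl])%classic%card.
  by apply: inj_card_eq => x y /set_mem /slP xs /set_mem /slP ys; apply: f_inj.
apply: card_eq_trans e _; rewrite card_eq_sym.
have -> : [set` sl]%classic = (nth None sl @` `I_(size sl))%classic.
  apply/seteqP; split=> [x /= xs|_ [i /= i_lt <-]]; last exact: mem_nth.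
  by exists (index x sl); rewrite /= ?index_mem ?nth_index.
rewrite card_eq_sym; apply: inj_card_eq => i j /set_mem /= i_lt /set_mem /= j_lt.
by move/eqP; rewrite nth_uniq // => /eqP.
Qed.

Lemma orbit_finite_list rho : good (imgs rho) ->
  finite_set (pb_orbit (conj_class rho)) ->
  exists sl, orbit_list A B sl (pt (imgs rho)).
Proof.
move=> rg; have [f [-> f_inj fP]] := pb_orbit_pts rg.
have f_inj' : set_inj (morb A B (pt (imgs rho))) f.
  by move=> x y /set_mem xs /set_mem ys; apply: f_inj.
rewrite (eq_finite_set (inj_card_eq f_inj')) => /finite_seqP[sl slE].
exists (undup sl); split=> [|x]; first exact: undup_uniq.
by rewrite mem_undup; split=> [xs|]; [rewrite slE | rewrite slE].
Qed.

Lemma good_PH (lam : 4.-tuple F) rho : tval lam = l ->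
  PH lam (conj_class rho) <-> good (imgs rho).
Proof.
move=> e; split=> [/PH_class[rl nc]|[_ rl nc]]; last by apply/PH_class; rewrite e.
by split=> //; [apply: quad_imgs | rewrite -e].
Qed.

End QuadOrbits.

Delimit Scope Z_scope with coqZ.

(** * Computing in cyclotomic fields *)

(* [dg], [Rd], [nn], [ks]: an element of [Z[x]/(Phi)] is the list of its
   coefficients; [Rd] is [x ^ dg] reduced modulo [Phi], [nn] the order of [x], and
   the successive products with the conjugates [x -> x ^ k], [k] in [ks], compute
   the norm. *)
Record cyc_field := CycField {
  dg : nat; Rd : seq Z; nn : nat; ks : seq nat }.

Fixpoint cadd (p q : seq Z) : seq Z :=
  match p, q with
  | [::], _ => q
  | _, [::] => p
  | a :: p', b :: q' => Z.add a b :: cadd p' q'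
  end.
Definition cscale (c : Z) (p : seq Z) : seq Z := [seq Z.mul c a | a <- p].
Definition copp (p : seq Z) : seq Z := [seq Z.opp a | a <- p].
Definition csub (p q : seq Z) : seq Z := cadd p (copp q).
Definition czero (p : seq Z) : bool := all (fun a => Z.eqb a Z0) p.

Section CycOps.
Variable K : cyc_field.

Definition cmulX (p : seq Z) : seq Z :=
  if size p == dg K then
    cadd (Z0 :: take (dg K).-1 p) (cscale (last Z0 p) (Rd K))
  else Z0 :: p.
Definition cmul (p q : seq Z) : seq Z :=
  foldr (fun c acc => cadd (cscale c q) (cmulX acc)) [::] p.
Definition cX (k : nat) : seq Z := iter k cmulX [:: 1%coqZ].
Definition ctab : seq (seq Z) := traject cmulX [:: 1%coqZ] (nn K).

(** Substitutes x^k for x: [tab] holds the reduced powers of x, and j is the exponent of the image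
    of the current monomial, reduced modulo the order of x. *)
Fixpoint csubst (tab : seq (seq Z)) (k j : nat) (p : seq Z) : seq Z :=
  if p is c :: p' then
    cadd (cscale c (nth [::] tab j))
      (csubst tab k (if (nn K <= j + k)%N then j + k - nn K else j + k)%N p')
  else [::].
Definition cnorm (tab : seq (seq Z)) (p : seq Z) : seq Z :=
  foldl (fun p k => cmul p (csubst tab k 0 p)) p (ks K).
Definition cunit (tab : seq (seq Z)) (p : seq Z) : bool :=
  if cnorm tab p is c :: r then ~~ Z.eqb c Z0 && czero r else false.

End CycOps.

Section CycEval.
Variables (F : numFieldType) (K : cyc_field) (z : F).

Definition zr (c : Z) : F := (int_of_Z c)%:~R.

Lemma zrD a b : zr (Z.add a b) = zr a + zr b.
Proof. by rewrite /zr -intrD; congr (_%:~R); lia. Qed.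
Lemma zrM a b : zr (Z.mul a b) = zr a * zr b.
Proof. by rewrite /zr -intrM; congr (_%:~R); lia. Qed.
Lemma zrN a : zr (Z.opp a) = - zr a.
Proof. by rewrite /zr -mulrNz; congr (_%:~R); lia. Qed.
Lemma zr_eq0 a : (zr a == 0) = Z.eqb a Z0.
Proof. by rewrite /zr intr_eq0; lia. Qed.

Definition ev (p : seq Z) : F := foldr (fun c r => zr c + z * r) 0 p.

Lemma ev_cons c p : ev (c :: p) = zr c + z * ev p. Proof. by []. Qed.

Lemma evD p q : ev (cadd p q) = ev p + ev q.
Proof.
elim: p q => [|a p IHp] [|b q]; rewrite ?add0r ?addr0 //=.
by rewrite zrD IHp; ring.
Qed.

Lemma evZ c p : ev (cscale c p) = zr c * ev p.
Proof. by elim: p => [|a p IHp] /=; rewrite ?mulr0 // zrM IHp; ring. Qed.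

Lemma evN p : ev (copp p) = - ev p.
Proof. by elim: p => [|a p IHp] /=; rewrite ?oppr0 // zrN IHp; ring. Qed.

Lemma evB p q : ev (csub p q) = ev p - ev q.
Proof. by rewrite evD evN. Qed.

Lemma ev_zero p : czero p -> ev p = 0.
Proof.
by elim: p => [//|a p IHp] /= /andP[/Z.eqb_spec-> /IHp->]; rewrite /zr mulr0 addr0.
Qed.

Lemma ev_rcons p c : ev (rcons p c) = ev p + zr c * z ^+ size p.
Proof.
elim: p => [|a p IHp] /=; first by rewrite expr0 mulr0 addr0 add0r mulr1.
by rewrite IHp exprS; ring.
Qed.

Hypotheses (z_red : z ^+ dg K = ev (Rd K)) (dg_gt0 : (0 < dg K)%N).

Lemma evX p : ev (cmulX K p) = z * ev p.
Proof.
rewrite /cmulX; case: eqP => [sp|_]; last by rewrite ev_cons /zr add0r.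
case/lastP: p sp => [|p c]; rewrite ?size_rcons => sp.
  by move: dg_gt0; rewrite -sp.
rewrite last_rcons -cats1 take_size_cat -?sp // cats1 evD ev_cons evZ -z_red ev_rcons.
by rewrite -sp exprS /zr; ring.
Qed.

Lemma evM p q : ev (cmul K p q) = ev p * ev q.
Proof.
elim: p => [|a p IHp] /=; first by rewrite mul0r.
by rewrite evD evZ evX IHp; ring.
Qed.

Lemma ev_cX k : ev (cX K k) = z ^+ k.
Proof.
elim: k => [|k IHk]; first by rewrite /cX /= /zr; ring.
by rewrite /cX iterS evX IHk exprS.
Qed.

Lemma ev_norm0 p : ev p = 0 -> ev (cnorm K (ctab K) p) = 0.
Proof.
rewrite /cnorm; elim: (ks K) p => [//|k l IHl] p p0 /=; apply: IHl.
by rewrite evM p0 mul0r.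
Qed.

(** A nonvanishing certificate: if p vanished at z, so would every multiple of p, whereas the
    computed product is a nonzero integer. The conjugates need not be known to be conjugates. *)
Lemma ev_unit p : cunit K (ctab K) p -> ev p != 0.
Proof.
move=> pu; apply/eqP => p0; move: pu; rewrite /cunit.
have := ev_norm0 p0; case: (cnorm _ _ p) => [//|c r] /=.
move=> e /andP[c0 /ev_zero r0]; move: e; rewrite r0 mulr0 addr0 => /eqP.
by rewrite zr_eq0 (negPf c0).
Qed.

End CycEval.

(** * Listed orbits in terms of points of the line *)

Section ListedOrbits.
Variables (F : numClosedFieldType) (lam : 4.-tuple F).
Hypotheses (l_prod : \prod_(z <- lam) z = 1)
  (l_neq1 : all (fun z => z != 1) lam).

Let l4 : size lam = 4 := size_tuple lam.
Let A := matA lam.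
Let B := matB lam.
Let A0 := matA_det l4 l_prod.
Let B0 := matB_det l4 l_prod.

Lemma pb_orbit_mem (rho rho' : affrep F 4) : good lam (imgs rho) ->
  good lam (imgs rho') ->
  pb_orbit (conj_class rho) (conj_class rho') <->
  morb A B (pt (imgs rho)) (pt (imgs rho')).
Proof.
move=> rg r'g; rewrite pb_orbit4; split=> [[r /= er /conj_class_eq c]|m].
  by apply: (erel_morb l4 l_prod l_neq1 rg); apply: erel_conj er c.
have [t rt tx] := morb_erel l4 l_prod l_neq1 rg m.
exists rho' => //=; apply: (erel_conj rt).
apply: (pt_inj l_neq1) => //; exact: (good_erel l4 l_prod l_neq1 rg rt).
Qed.

(** The translation part of the relation that the product of the four maps is 1. *)
Definition trans_rel (tau : seq F) : Prop := size tau = 4 /\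
  tau`_0 + lam`_0 * tau`_1 + lam`_0 * lam`_1 * tau`_2 +
  lam`_0 * lam`_1 * lam`_2 * tau`_3 = 0.

Lemma represents_pt tau p : represents lam tau p -> exists2 rho,
  p = conj_class rho & map (@lin F) (imgs rho) = lam /\
    pt (imgs rho) = ppt (vec_of lam tau).
Proof.
case=> rho [rl rt ->]; exists rho => //.
have e : map (@lin F) (imgs rho) = lam by rewrite -rl linear_partE.
by split=> //; rewrite /pt /vec e -translation_partE rt.
Qed.

Lemma represents_good tau : trans_rel tau -> vec_of lam tau != 0 ->
  exists rho, [/\ represents lam tau (conj_class rho), good lam (imgs rho) &
    pt (imgs rho) = ppt (vec_of lam tau)].
Proof.
case=> t4 rel; case: tau t4 rel => [|t0 [|t1 [|t2 [|t3 [|t5 u]]]]] //= _ rel v0.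
have [l0 [l1 [l2 [l3 lE]]]] : exists l0 l1 l2 l3, tval lam = [:: l0; l1; l2; l3].
  by case: (tval lam) l4 => [|l0 [|l1 [|l2 [|l3 [|//]]]]] // _; exists l0, l1, l2, l3.
have n0 i : (i < 4)%N -> lam`_i != 0 := lam_neq0 l4 l_prod (i := i).
move: rel v0 (n0 0 isT) (n0 1 isT) (n0 2 isT) (n0 3 isT); rewrite lE /= => rel v0 n00 n1 n2 n3.
pose s : seq (aff F) := [:: mk_aff t0 n00; mk_aff t1 n1; mk_aff t2 n2; mk_aff t3 n3].
have sl : map (@lin F) s = lam by rewrite lE.
have st : map (@trans F) s = [:: t0; t1; t2; t3] by [].
have sq : quad s.
  split=> //; apply: aff_ext.
    by rewrite lin_prod -(big_map (@lin F) xpredT id) sl l_prod.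
  by rewrite !big_cons big_nil !transM trans1 -[RHS]rel /lin /trans /=; ring.
have [rho rE] := imgs_quad sq; exists rho.
have e : vec s = vec_of lam [:: t0; t1; t2; t3] by rewrite /vec sl st.
rewrite rE /pt e lE; split=> //.
  exists rho; split=> //; first by apply: val_inj; rewrite /= linear_partE rE sl.
  by rewrite translation_partE rE.
split=> // c; move: v0; rewrite -lE -e => /eqP; apply.
by apply/vec_eq0 => //; rewrite sl.
Qed.

Definition orbit_card x (N : option nat) : Prop :=
  if N is Some k then exists2 s, size s = k & orbit_list A B s x
  else ~ exists s, orbit_list A B s x.

Lemma orbit_card_has_size (rho : affrep F 4) N : good lam (imgs rho) ->
  orbit_card (pt (imgs rho)) N -> has_size (pb_orbit (conj_class rho)) N.
Proof.
move=> rg; case: N => [k [s <- sP]|nP].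
  exact: (orbit_size l4 l_prod l_neq1).
by move=> fin; apply: nP; apply: (orbit_finite_list l4 l_prod l_neq1 rg).
Qed.

(** [Os] gives each listed orbit as a list of points of the line; disjointness is only asked of the
    representative of each later entry. *)
Lemma listed_orbits (L : seq (seq F * nat)) (Os : seq (seq (option F))) N :
  (forall i, (i < size L)%N -> let e := nth ([::], 0%N) L i in
    [/\ trans_rel e.1, vec_of lam e.1 != 0, size (nth [::] Os i) = e.2 &
        orbit_list A B (nth [::] Os i) (ppt (vec_of lam e.1))]) ->
  (forall i j, (i < j < size L)%N ->
    ppt (vec_of lam (nth ([::], 0%N) L j).1) \notin nth [::] Os i) ->
  (forall x, (forall i, (i < size L)%N -> x \notin nth [::] Os i) ->
    orbit_card x N) ->
  orbits_listed lam L N.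
Proof.
move=> LP Ldis Loth; split=> [tau k tkL|e0 i j p q ij rp rq eq_orb|p pP np].
- have iL : (index (tau, k) L < size L)%N by rewrite index_mem.
  have := LP _ iL; rewrite nth_index //= => -[tr v0 sk ol].
  have [rho [rr rg rx]] := represents_good tr v0.
  exists (conj_class rho); first by split=> //; apply/(good_PH _ (erefl _)).
  by rewrite -sk; apply: (orbit_size l4 l_prod l_neq1) => //; rewrite rx.
- have /andP[i_j jL] := ij; have iL := ltn_trans i_j jL.
  rewrite (set_nth_default ([::], 0%N)) // in rp.
  rewrite (set_nth_default ([::], 0%N)) // in rq.
  have [tri vi _ oi] := LP i iL; have [trj vj _ oj] := LP j jL.
  have [r pE [rl rx]] := represents_pt rp; have [r' qE [r'l r'x]] := represents_pt rq.
  have gd (u : affrep F 4) tau : map (@lin F) (imgs u) = lam ->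
      pt (imgs u) = ppt (vec_of lam tau) -> represents lam tau (conj_class u) ->
      vec_of lam tau != 0 -> good lam (imgs u).
    move=> ul ux [u1 [u1l u1t /conj_class_eq c]] v0; split=> //; first exact: quad_imgs.
    move=> cu; case/eqP: v0.
    have <- : vec (imgs u1) = vec_of lam tau.
      by rewrite /vec -linear_partE u1l -translation_partE u1t.
    apply/vec_eq0; [exact: quad_imgs | by rewrite -linear_partE u1l|].
    by case: c => g ->; apply: centered_conj cu.
  have rg : good lam (imgs r) by apply: (gd r _ rl rx) => //; rewrite -pE.
  have r'g : good lam (imgs r') by apply: (gd r' _ r'l r'x) => //; rewrite -qE.
  have := Ldis i j ij; rewrite -r'x; case/negP; case: oi => _ oi; apply/oi.
  rewrite -rx; apply/pb_orbit_mem => //; rewrite -pE -qE eq_orb qE.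
  by apply/pb_orbit_mem => //; apply: morb_refl.
have [rho pE rP] := PH_inv pP.
have rg : good lam (imgs rho) by apply/(good_PH _ (erefl _)); rewrite -pE.
rewrite pE; apply: orbit_card_has_size => //; apply: Loth => i iL.
apply/negP => xi; apply: np; have [tri vi _ [_ oi]] := LP i iL.
have [r [rr rg' rx]] := represents_good tri vi.
exists (nth ([::], 0%N) L i), (conj_class r); split=> //; first exact: mem_nth.
by rewrite pE; apply/pb_orbit_mem => //; rewrite rx; apply/oi.
Qed.

End ListedOrbits.

Local Open Scope nat_scope.

(** * Computing orbits by breadth-first search *)

Section TableCheck.
Variable K : cyc_field.
Let cpt : Type := (seq Z * seq Z)%type.

Section Moves.
(* The entries of the matrices [matA] and [matB]. *)
Variables (a b c d : seq Z).

Definition mvA (p : cpt) : cpt := (cmul K a p.1, cadd (cmul K b p.1) p.2).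
Definition mvB (p : cpt) : cpt := (cadd p.1 (cmul K c p.2), cmul K d p.2).
Definition ccross (p q : cpt) : seq Z := csub (cmul K p.1 q.2) (cmul K p.2 q.1).
Definition peq (p q : cpt) : bool := czero (ccross p q).

(** Neither the fuel nor completeness of the search is trusted: [pclosed] checks afterwards that the
    list is stable. Inverse moves are left out, a finite stable set being stable under inverses. *)
Fixpoint bfs (fuel : nat) (todo seen : seq cpt) : seq cpt :=
  match fuel, todo with
  | f.+1, p :: todo' =>
    let p1 := mvA p in
    let n1 := if has (peq p1) seen then [::] else [:: p1] in
    let seen1 := seen ++ n1 in
    let p2 := mvB p in
    let n2 := if has (peq p2) seen1 then [::] else [:: p2] in
    bfs f (todo' ++ n1 ++ n2) (seen1 ++ n2)
  | _, _ => seen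
  end.

Definition pclosed (O : seq cpt) : bool :=
  all (fun p => has (peq (mvA p)) O && has (peq (mvB p)) O) O.

End Moves.

Definition cone : seq Z := [:: 1%coqZ].
Definition cvec (l t : seq (seq Z)) : cpt :=
  let s i := csub cone (nth [::] l i) in let u i := nth [::] t i in
  (cmul K (csub (cmul K (u 0) (s 1)) (cmul K (u 1) (s 0))) (s 2),
   cmul K (csub (cmul K (u 1) (s 2)) (cmul K (u 2) (s 1))) (s 0)).

Definition ctrans (l t : seq (seq Z)) : seq Z :=
  let s := nth [::] l in let u := nth [::] t in
  cadd (u 0) (cmul K (s 0) (cadd (u 1) (cmul K (s 1)
    (cadd (u 2) (cmul K (s 2) (u 3)))))).

Definition table_orbits (l : seq (seq Z)) (ts : seq (seq (seq Z))) : seq (seq cpt) :=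
  let s := nth [::] l in
  let a := cmul K (s 0) (s 1) in let b := csub cone (s 0) in
  let c := cmul K (s 1) (csub cone (s 2)) in let d := cmul K (s 1) (s 2) in
  [seq let p := cvec l t in bfs a b c d 100 [:: p] [:: p] | t <- ts].

(** The conditions are, in order: the relation holds, the coordinates are nonzero, the lists are
    closed, all points are distinct, the sizes are the announced ones, and they add up to N + 2 as
    [free_orbit] requires. *)
Definition table_check (l : seq (seq Z)) (ts : seq (seq (seq Z)))
    (ns : seq nat) (N : nat) : bool :=
  let s := nth [::] l in
  let a := cmul K (s 0) (s 1) in let b := csub cone (s 0) in
  let c := cmul K (s 1) (csub cone (s 2)) in let d := cmul K (s 1) (s 2) in
  let tab := ctab K in let Os := table_orbits l ts in
  [&& all (fun t => (size t == 4) && czero (ctrans l t)) ts,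
      all (fun t => let p := cvec l t in
        if cunit K tab p.1 then true else cunit K tab p.2) ts,
      all (pclosed a b c d) Os,
      pairwise (fun p q => cunit K tab (ccross p q)) (flatten Os),
      map size Os == ns & sumn ns == N.+2].

End TableCheck.
Arguments bfs : simpl never.
Arguments cmul : simpl never.
Arguments csub : simpl never.

Definition K12 := CycField 4 [:: -1; 0; 1]%coqZ 12 [:: 7; 5].
Definition K24 := CycField 8 [:: -1; 0; 0; 0; 1]%coqZ 24 [:: 13; 7; 17].
Definition K60 := CycField 16
  [:: -1; 0; -1; 0; 0; 0; 1; 0; 1; 0; 1; 0; 0; 0; -1]%coqZ 60 [:: 31; 41; 49; 37].


Local Open Scope ring_scope.
Section TableSound.
Variables (F : numClosedFieldType) (K : cyc_field) (z : F).
Hypotheses (z_red : z ^+ dg K = ev z (Rd K)) (dg_gt0 : (0 < dg K)%N).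
Local Notation ev := (ev z).
Local Notation cpt := (seq Z * seq Z)%type.

Let evM := evM z_red dg_gt0.

Definition evp (p : cpt) : F * F := (ev p.1, ev p.2).
Definition epp (p : cpt) : option F := ppt (evp p).

Lemma ev_cone : ev cone = 1.
Proof. by rewrite /= /zr mulr0 addr0. Qed.

Lemma nth_ev (l : seq (seq Z)) i : (map ev l)`_i = ev (nth [::] l i).
Proof.
have [il|il] := ltnP i (size l); first by rewrite (nth_map [::]).
by rewrite !nth_default ?size_map.
Qed.

Lemma cvecE l t : evp (cvec K l t) = vec_of (map ev l) (map ev t).
Proof. by rewrite /evp /vec_of !nth_ev /cvec; congr pair; rewrite !(evM, evB, ev_cone). Qed.

Section Orbit.
Variables (a b c d : seq Z).
Let A : mat2 F := (ev a, 0, ev b, 1).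
Let B : mat2 F := (1, ev c, 0, ev d).
Hypotheses (A0 : mdet A != 0) (B0 : mdet B != 0).

Lemma evp_mvA p : evp (mvA K a b p) = mapply A (evp p).
Proof. by rewrite /evp /=; congr pair; rewrite ?evD !evM; ring. Qed.
Lemma evp_mvB p : evp (mvB K c d p) = mapply B (evp p).
Proof. by rewrite /evp /=; congr pair; rewrite ?evD !evM; ring. Qed.

Lemma evp_cross p q : ev (ccross K p q) = cross (evp p) (evp q).
Proof. by rewrite evB !evM. Qed.

Lemma bfs_sub f todo seen : {subset seen <= bfs K a b c d f todo seen}.
Proof.
elim: f todo seen => [|f IHf] [|p todo] seen //; rewrite /bfs -/bfs => q qs; apply: IHf.
by rewrite !mem_cat qs.
Qed.

Lemma bfs_all (P : cpt -> Prop) f todo seen :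
  (forall p, P p -> P (mvA K a b p)) -> (forall p, P p -> P (mvB K c d p)) ->
  (forall p, p \in todo -> P p) -> (forall p, p \in seen -> P p) ->
  forall p, p \in bfs K a b c d f todo seen -> P p.
Proof.
move=> PA PB; elim: f todo seen => [|f IHf] [|p todo] seen Ptodo Pseen //.
rewrite /bfs -/bfs.
have Pp : P p by apply: Ptodo; rewrite mem_head.
apply: IHf => q.
  rewrite !mem_cat => /or3P[qt|qn|qn].
  - by apply: Ptodo; rewrite inE qt orbT.
  - by move: qn; case: ifP => // _; rewrite inE => /eqP->; apply: PA.
  - by move: qn; case: ifP => // _; rewrite inE => /eqP->; apply: PB.
rewrite !mem_cat => /orP[/orP[]|]; first exact: Pseen.
  by case: ifP => // _; rewrite inE => /eqP->; apply: PA.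
by case: ifP => // _; rewrite inE => /eqP->; apply: PB.
Qed.

Lemma bfs_orbit_list p0 (O : seq cpt) : evp p0 != 0 ->
  O = bfs K a b c d 100 [:: p0] [:: p0] ->
  pclosed K a b c d O -> uniq (map epp O) -> orbit_list A B (map epp O) (epp p0).
Proof.
move=> p00 OE Ocl Ou; split=> // y.
have OP p : p \in O -> evp p != 0 /\ morb A B (epp p0) (epp p).
  move: p; rewrite OE; apply: bfs_all => [p [pn m]|p [pn m]|p|p].
  - rewrite /epp evp_mvA -mob_ppt //; split; first exact: mapply_neq0.
    apply: (morb_trans A0 B0 m); by exists A; [apply: mgen_genL|].
  - rewrite /epp evp_mvB -mob_ppt //; split; first exact: mapply_neq0.
    apply: (morb_trans A0 B0 m); by exists B; [apply: mgen_genR|].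
  - by rewrite inE => /eqP->; split=> //; apply: morb_refl.
  - by rewrite inE => /eqP->; split=> //; apply: morb_refl.
split=> [/mapP[p /OP[_ m] ->]//|m].
have peqP p q : evp p != 0 -> q \in O -> peq K p q -> epp p \in map epp O.
  move=> pn qO pq; have [qn _] := OP q qO.
  have -> : epp p = epp q.
    by apply/eqP; rewrite /epp ppt_eq // -evp_cross; apply/eqP; apply: ev_zero.
  exact: map_f.
apply: (morb_stable A0 B0 _ _ _ m).
- move=> _ /mapP[p pO ->]; have [pn _] := OP p pO.
  have /andP[/hasP[q qO pq] _] := allP Ocl p pO.
  rewrite /epp mob_ppt // -evp_mvA; apply: peqP qO pq.
  by rewrite evp_mvA mapply_neq0.
- move=> _ /mapP[p pO ->]; have [pn _] := OP p pO.
  have /andP[_ /hasP[q qO pq]] := allP Ocl p pO.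
  rewrite /epp mob_ppt // -evp_mvB; apply: peqP qO pq.
  by rewrite evp_mvB mapply_neq0.
- by apply: map_f; rewrite OE; apply: bfs_sub; rewrite mem_head.
Qed.

Lemma bfs_neq0 p0 p : evp p0 != 0 -> p \in bfs K a b c d 100 [:: p0] [:: p0] ->
  evp p != 0.
Proof.
move=> p00; move: p; apply: bfs_all => [p pn|p pn|p|p].
- by rewrite evp_mvA mapply_neq0.
- by rewrite evp_mvB mapply_neq0.
- by rewrite inE => /eqP->.
- by rewrite inE => /eqP->.
Qed.

End Orbit.

Lemma pairwise_epp_uniq (O : seq cpt) : (forall p, p \in O -> evp p != 0) ->
  pairwise (fun p q => cunit K (ctab K) (ccross K p q)) O -> uniq (map epp O).
Proof.
elim: O => [//|p O IHO] On /= /andP[pO Od]; rewrite IHO // ?andbT; last first.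
  by move=> q qO; apply: On; rewrite inE qO orbT.
apply/negP => /mapP[q qO e].
have := ev_unit z_red dg_gt0 (allP pO q qO); rewrite evp_cross -ppt_eq.
- by rewrite -/(epp p) e eqxx.
- by apply: On; rewrite mem_head.
- by apply: On; rewrite inE qO orbT.
Qed.

Lemma evp_neq0 p : (if cunit K (ctab K) p.1 then true else cunit K (ctab K) p.2) ->
  evp p != 0.
Proof.
rewrite -[0]/(0, 0) xpair_eqE /= negb_and; case: ifP => [u _|_ u].
  by rewrite (ev_unit z_red dg_gt0 u).
by rewrite (ev_unit z_red dg_gt0 u) orbT.
Qed.

Variable lam : 4.-tuple F.
Hypotheses (l_prod : \prod_(z <- lam) z = 1)
  (l_neq1 : all (fun z => z != 1) lam).

(** The check makes the three lists genuine orbits, and [free_orbit] then describes every other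
    orbit. *)
Theorem table_sound (l : seq (seq Z)) (t1 t2 t3 : seq (seq Z)) n1 n2 n3 N :
  map ev l = lam -> table_check K l [:: t1; t2; t3] [:: n1; n2; n3] N ->
  (0 < N)%N -> (N %| lcmn n1 (lcmn n2 n3))%N ->
  orbits_listed lam
    [:: (map ev t1, n1); (map ev t2, n2); (map ev t3, n3)] (Some N).
Proof.
move=> lE; rewrite /table_check => /and5P[+ + + + /andP[/eqP ns /eqP sumN]].
have l4 := size_tuple lam.
have A0 := matA_det l4 l_prod; have B0 := matB_det l4 l_prod.
pose s := nth [::] l.
pose a := cmul K (s 0%N) (s 1%N); pose b := csub cone (s 0%N).
pose c := cmul K (s 1%N) (csub cone (s 2%N)); pose d := cmul K (s 1%N) (s 2%N).
have sE i : lam`_i = ev (s i) by rewrite -lE nth_ev.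
have AE : matA lam = (ev a, 0, ev b, 1) :> mat2 F.
  by rewrite /matA !sE evM evB ev_cone.
have BE : matB lam = (1, ev c, 0, ev d) :> mat2 F.
  by rewrite /matB !sE !evM evB ev_cone.
rewrite /table_orbits /= -/s -/a -/b -/c -/d in ns *.
(* The search is hidden behind an opaque function, so that simplification does not unfold it. *)
have [O OE] : exists O, forall t, bfs K a b c d 100 [:: cvec K l t] [:: cvec K l t] = O t.
  by exists (fun t => bfs K a b c d 100 [:: cvec K l t] [:: cvec K l t]).
rewrite !OE in ns *; rewrite !andbT cats0.
move=> /and3P[rel1 rel2 rel3] /and3P[u1 u2 u3] /and3P[c1 c2 c3] pw.
case: ns => ns1 ns2 ns3.
have v1 : evp (cvec K l t1) != 0 := @evp_neq0 (cvec K l t1) u1.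
have v2 : evp (cvec K l t2) != 0 := @evp_neq0 (cvec K l t2) u2.
have v3 : evp (cvec K l t3) != 0 := @evp_neq0 (cvec K l t3) u3.
rewrite AE in A0; rewrite BE in B0.
have On p : p \in O t1 ++ O t2 ++ O t3 -> evp p != 0.
  rewrite !mem_cat -!OE => /or3P[]; exact: bfs_neq0.
have := pairwise_epp_uniq On pw; rewrite !map_cat => Ou.
have [Ou1 [Ou2 Ou3]] : uniq (map epp (O t1)) /\ uniq (map epp (O t2)) /\ uniq (map epp (O t3)).
  by move: Ou; rewrite !cat_uniq => /and3P[-> _ /and3P[-> _ ->]].
have o1 := bfs_orbit_list A0 B0 v1 (esym (OE t1)) c1 Ou1.
have o2 := bfs_orbit_list A0 B0 v2 (esym (OE t2)) c2 Ou2.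
have o3 := bfs_orbit_list A0 B0 v3 (esym (OE t3)) c3 Ou3.
move=> N0 Nlcm.
have relE t : (size t == 4) && czero (ctrans K l t) -> trans_rel lam (map ev t).
  case/andP=> /eqP t4 /(ev_zero z); rewrite /ctrans !(evD, evM) => e.
  by split; rewrite ?size_map // !sE !nth_ev -[RHS]e; ring.
have epE t : epp (cvec K l t) = ppt (vec_of lam (map ev t)) by rewrite /epp cvecE lE.
apply: (listed_orbits l_prod l_neq1
  (Os := [:: map epp (O t1); map epp (O t2); map epp (O t3)])).
- move=> [|[|[|//]]] _ /=; rewrite size_map AE BE -epE; split=> //;
    by [apply: relE | rewrite -lE -cvecE].
- have notin (u v w : seq (option F)) : uniq (u ++ v) -> w = v -> forall x, x \in v -> x \notin u.
    by rewrite cat_uniq => /and3P[_ /hasPn h _] _ x /h.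
  have m t : epp (cvec K l t) \in map epp (O t) by rewrite -OE; apply: map_f; apply: bfs_sub; rewrite mem_head.
  move: Ou; rewrite cat_uniq => /and3P[_ /hasPn d1].
  rewrite cat_uniq => /and3P[_ /hasPn d2 _].
  move=> i j /andP[+ j3]; case: j j3 => [|[|[|//]]] _; case: i => [|[|[|//]]] //= _;
    rewrite -?epE.
  + by apply: d1; rewrite mem_cat m.
  + by apply: d1; rewrite mem_cat m orbT.
  + by apply: d2; rewrite m.
- move=> x xO; rewrite /orbit_card AE BE.
  apply: (free_orbit A0 B0 o1 o2 o3 Ou N0).
  + by rewrite !size_cat !size_map ns1 ns2 ns3 -sumN /= addn0.
  + move=> k; rewrite !size_map ns1 ns2 ns3 => k1 k2 k3.
    by apply: dvdn_trans Nlcm _; rewrite !dvdn_lcm k1 k2 k3.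
  + rewrite !mem_cat; apply/negP => /or3P[]; apply/negP.
    * exact: (xO 0%N isT).
    * exact: (xO 1%N isT).
    * exact: (xO 2%N isT).
Qed.

End TableSound.

(** * Reduction modulo cyclotomic polynomials *)

Section PrimitiveRoots.
Variable F : numFieldType.
Implicit Types z w : F.

Lemma zr0 : zr F Z0 = 0. Proof. by []. Qed.
Lemma zr1 : zr F 1%coqZ = 1. Proof. by []. Qed.
Lemma zrN1 : zr F (-1)%coqZ = -1. Proof. by []. Qed.

Lemma prim_neq0 n z : n.-primitive_root z -> z != 0.
Proof.
move=> zP; apply: contra_eqN (prim_expr_order zP) => /eqP->.
by rewrite expr0n eqn0Ngt (prim_order_gt0 zP) eq_sym oner_eq0.
Qed.

Lemma prim_half n z : (2 * n)%N.-primitive_root z -> (0 < n)%N -> z ^+ n = -1.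
Proof.
move=> zP n0; have : z ^+ n ^+ 2 == 1 by rewrite -exprM mulnC (prim_expr_order zP).
rewrite sqrf_eq1 => /orP[|/eqP//].
rewrite -(prim_order_dvd zP) => /dvdn_leq; lia.
Qed.

Lemma prim_sqrt n z w : (2 * n)%N.-primitive_root z -> w ^+ 2 = z ->
  (4 * n)%N.-primitive_root w.
Proof.
move=> zP wz; have n0 : (0 < 2 * n)%N := prim_order_gt0 zP.
have w1 : w ^+ (4 * n) = 1.
  by rewrite -[4%N]/(2 * 2)%N -mulnA exprM wz (prim_expr_order zP).
have [|d dP d_dvd] := prim_order_exists _ w1.
  by move: n0; rewrite !muln_gt0.
have /dvdnP[k dE] : (2 * n %| d)%N.
  by rewrite (prim_order_dvd zP) -wz -exprM mulnC exprM (prim_expr_order dP) expr1n.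
have : z ^+ (k * n) == 1.
  by rewrite -wz -exprM mulnCA -dE (prim_expr_order dP).
rewrite -(prim_order_dvd zP) => /dvdnP[m mE].
have k2 : k = (2 * m)%N.
  apply/eqP; rewrite -(@eqn_pmul2r n); last by move: n0; rewrite muln_gt0.
  by rewrite mE mulnA (mulnC m).
suff -> : (4 * n = d)%N by [].
apply/eqP; rewrite eqn_dvd d_dvd andbT dE k2.
by rewrite (mulnC 2%N m) -mulnA [(2 * _)%N]mulnA dvdn_mull.
Qed.

(** From z^6 = -1, as X^6 + 1 is X^2 + 1 times the cyclotomic polynomial and z^2 + 1 is nonzero. The
    other orders work alike. *)
Lemma red12 z : 12.-primitive_root z -> z ^+ 4 = ev z (Rd K12).
Proof.
move=> zP; have z6 : z ^+ 6 = -1 := @prim_half 6 z zP isT.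
have n2 : z ^+ 2 + 1 != 0.
  apply/eqP => z2; have : z ^+ 4 == 1.
    by apply/eqP; apply: (lincomb1 (k1 := z ^+ 2 - 1) z2); ring.
  by rewrite -(prim_order_dvd zP).
rewrite /= !(zr0, zr1, zrN1); apply: (mulfI n2).
by apply: (lincomb1 (k1 := 1) z6); ring.
Qed.

Lemma red24 z : 24.-primitive_root z -> z ^+ 8 = ev z (Rd K24).
Proof.
move=> zP; have z12 : z ^+ 12 = -1 := @prim_half 12 z zP isT.
have n4 : z ^+ 4 + 1 != 0.
  apply/eqP => z4; have : z ^+ 8 == 1.
    by apply/eqP; apply: (lincomb1 (k1 := z ^+ 4 - 1) z4); ring.
  by rewrite -(prim_order_dvd zP).
rewrite /= !(zr0, zr1, zrN1); apply: (mulfI n4).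
by apply: (lincomb1 (k1 := 1) z12); ring.
Qed.

(** The cofactors of the cyclotomic polynomial in X^30 + 1 are X^10 + 1, for the orders 4 and 20,
    and X^4 - X^2 + 1, for the order 12. *)
Lemma red60 z : 60.-primitive_root z -> z ^+ 16 = ev z (Rd K60).
Proof.
move=> zP; have z30 : z ^+ 30 = -1 := @prim_half 30 z zP isT.
have n10 : z ^+ 10 + 1 != 0.
  apply/eqP => z10; have : z ^+ 20 == 1.
    by apply/eqP; apply: (lincomb1 (k1 := z ^+ 10 - 1) z10); ring.
  by rewrite -(prim_order_dvd zP).
have n4 : z ^+ 4 - z ^+ 2 + 1 != 0.
  apply/eqP => z4; have : z ^+ 12 == 1.
    apply/eqP; apply: (lincomb1 (k1 := (z ^+ 2 + 1) * (z ^+ 6 - 1)) z4); ring.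
  by rewrite -(prim_order_dvd zP).
rewrite /= !(zr0, zr1, zrN1); apply: (mulfI (mulf_neq0 n10 n4)).
by apply: (lincomb1 (k1 := 1) z30); ring.
Qed.

End PrimitiveRoots.

(** * The tetrahedral, octahedral and icosahedral tables *)

Section Tables.
Variables (F : numClosedFieldType) (lam : 4.-tuple F).
Hypotheses (l_prod : \prod_(z <- lam) z = 1)
  (l_neq1 : all (fun z => z != 1) lam).

Definition e0 : seq Z := [::].
Definition x12 := cX K12.
Definition x24 := cX K24.
Definition x60 := cX K60.
Definition csum (s : seq (seq Z)) := foldr cadd [::] s.


Lemma ev12 (z : F) k : 12.-primitive_root z -> ev z (x12 k) = z ^+ k.
Proof. by move=> /red12 red; apply: ev_cX. Qed.
Lemma ev24 (z : F) k : 24.-primitive_root z -> ev z (x24 k) = z ^+ k.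
Proof. by move=> /red24 red; apply: ev_cX. Qed.
Lemma ev60 (z : F) k : 60.-primitive_root z -> ev z (x60 k) = z ^+ k.
Proof. by move=> /red60 red; apply: ev_cX. Qed.

Definition table12 (z : F) (zP : 12.-primitive_root z) :=
  @table_sound F K12 z (red12 zP) isT lam l_prod l_neq1.
Definition table24 (z : F) (zP : 24.-primitive_root z) :=
  @table_sound F K24 z (red24 zP) isT lam l_prod l_neq1.
Definition table60 (z : F) (zP : 60.-primitive_root z) :=
  @table_sound F K60 z (red60 zP) isT lam l_prod l_neq1.


Lemma tetra1 (eta : F) : 12.-primitive_root eta ->
  tval lam = [:: eta; eta ^+ 5; eta ^+ 3; eta ^+ 3] ->
  orbits_listed lam
    [:: ([:: eta ^+ 3; 0; 0; 1], 4%N); ([:: 0; eta ^+ 5; -1; 0], 4%N);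
        ([:: 0; 0; eta ^+ 3; -1], 6%N)] (Some 12%N).
Proof.
move=> zP lE; have E k := ev12 k zP.
have := @table12 eta zP [seq x12 k | k <- [:: 1; 5; 3; 3]%N]
  [:: x12 3; e0; e0; cone] [:: e0; x12 5; copp cone; e0]
  [:: e0; e0; x12 3; copp cone] 4 4 6 12.
cbn [map]; rewrite !(E, evN, ev_cone).
rewrite expr1; apply; [by [] | vm_cast_no_check (erefl true) | by [] | by []].
Qed.

Lemma tetra2 (zeta eta : F) : 6.-primitive_root zeta -> eta ^+ 2 = zeta ->
  tval lam = [:: -1; zeta; zeta; zeta] ->
  orbits_listed lam
    [:: ([:: 0; 0; zeta; -1], 4%N); ([:: 0; 1 - zeta ^+ 2; zeta; zeta], 4%N);
        ([:: 0; 1; zeta + eta; zeta ^+ 2 * eta + zeta - 1], 6%N)] (Some 12%N).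
Proof.
move=> zetaP zE lE; have zP : 12.-primitive_root eta := @prim_sqrt _ 3 _ _ zetaP zE.
have E k := ev12 k zP.
have := @table12 eta zP [:: copp cone; x12 2; x12 2; x12 2]
  [:: e0; e0; x12 2; copp cone] [:: e0; csub cone (x12 4); x12 2; x12 2]
  [:: e0; cone; cadd (x12 2) (x12 1); csub (cadd (x12 5) (x12 2)) cone] 4 4 6 12.
cbn [map]; rewrite !(E, evN, evD, evB, ev_cone) zE.
have -> : eta ^+ 4 = zeta ^+ 2 by rewrite -zE -exprM.
have -> : eta ^+ 5 = zeta ^+ 2 * eta by rewrite -zE; ring.
rewrite expr1; apply; [by [] | vm_cast_no_check (erefl true) | by [] | by []].
Qed.

Lemma octa1 (eta : F) : 24.-primitive_root eta ->
  tval lam = [:: eta; eta ^+ 5; eta ^+ 7; eta ^+ 11] ->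
  orbits_listed lam
    [:: ([:: 0; 0; 1; eta ^+ 5], 6%N); ([:: 0; 1; 0; 1], 8%N);
        ([:: eta; 0; 0; 1], 12%N)] (Some 24%N).
Proof.
move=> zP lE; have E k := ev24 k zP.
have := @table24 eta zP [seq x24 k | k <- [:: 1; 5; 7; 11]%N]
  [:: e0; e0; cone; x24 5] [:: e0; cone; e0; cone]
  [:: x24 1; e0; e0; cone] 6 8 12 24.
cbn [map]; rewrite !(E, ev_cone).
rewrite expr1; apply; [by [] | vm_cast_no_check (erefl true) | by [] | by []].
Qed.

Lemma octa2 (eta nu : F) : 12.-primitive_root eta -> nu ^+ 2 = eta ->
  tval lam = [:: eta; - eta; eta ^+ 2; eta ^+ 2] ->
  orbits_listed lam
    [:: ([:: eta ^+ 4; 0; 0; 1], 6%N); ([:: 0; 0; eta ^+ 2; -1], 8%N);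
        ([:: 0; nu + eta ^+ 3; nu^-1; 1], 12%N)] (Some 24%N).
Proof.
move=> etaP nuE lE; have zP : 24.-primitive_root nu := @prim_sqrt _ 6 _ _ etaP nuE.
have E k := ev24 k zP.
have := @table24 nu zP [:: x24 2; copp (x24 2); x24 4; x24 4]
  [:: x24 8; e0; e0; cone] [:: e0; e0; x24 4; copp cone]
  [:: e0; cadd (x24 1) (x24 6); x24 23; cone] 6 8 12 24.
cbn [map]; rewrite !(E, evN, evD, ev_cone) nuE.
have -> : nu ^+ 8 = eta ^+ 4 by rewrite -nuE -exprM.
have -> : nu ^+ 4 = eta ^+ 2 by rewrite -nuE -exprM.
have -> : nu ^+ 6 = eta ^+ 3 by rewrite -nuE -exprM.
have -> : nu ^+ 23 = nu^-1.
  apply: (mulfI (prim_neq0 zP)); rewrite -exprS (prim_expr_order zP).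
  by rewrite mulfV // (prim_neq0 zP).
rewrite expr1; apply; [by [] | vm_cast_no_check (erefl true) | by [] | by []].
Qed.

Lemma icosa1 (a : F) : 60.-primitive_root a ->
  tval lam = [:: a; a ^+ 29; a ^+ 11; a ^+ 19] ->
  orbits_listed lam
    [:: ([:: 0; 1; 0; a ^+ 50], 12%N); ([:: 1; 0; 0; a ^+ 49], 20%N);
        ([:: 0; 0; 1; a ^+ 19], 30%N)] (Some 60%N).
Proof.
move=> zP lE; have E k := ev60 k zP.
have := @table60 a zP [seq x60 k | k <- [:: 1; 29; 11; 19]%N]
  [:: e0; cone; e0; x60 50] [:: cone; e0; e0; x60 49]
  [:: e0; e0; cone; x60 19] 12 20 30 60.
cbn [map]; rewrite !(E, ev_cone).
rewrite expr1; apply; [by [] | vm_cast_no_check (erefl true) | by [] | by []].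
Qed.

Lemma icosa2 (b a : F) : 60.-primitive_root b -> a = b ^+ 3 ->
  tval lam = [:: a; a ^+ 9; a ^+ 7; a ^+ 3] ->
  orbits_listed lam
    [:: ([:: a ^+ 12; 0; 0; a ^+ 5], 12%N);
        ([:: 0; b + a ^+ 5 + a ^+ 2 + a; 1 + a ^+ 3;
             (b + a) * (1 - a ^+ 3 * b)], 20%N);
        ([:: 0; 0; a ^+ 17; 1], 30%N)] (Some 60%N).
Proof.
move=> zP -> lE; have E k := ev60 k zP; have M := @evM F K60 b (red60 zP) isT.
have := @table60 b zP [seq x60 k | k <- [:: 3; 27; 21; 9]%N]
  [:: x60 36; e0; e0; x60 15]
  [:: e0; cadd (cadd (cadd (x60 1) (x60 15)) (x60 6)) (x60 3); cadd cone (x60 9);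
      cmul K60 (cadd (x60 1) (x60 3)) (csub cone (x60 10))]
  [:: e0; e0; x60 51; cone] 12 20 30 60.
cbn [map]; rewrite lE -!exprM !(M, E, evD, evB, ev_cone) expr1 -exprSr.
apply; [by [] | vm_cast_no_check (erefl true) | by [] | by []].
Qed.

Lemma icosa3 (b a : F) : 60.-primitive_root b -> a = b ^+ 2 ->
  tval lam = [:: a ^+ 9; a ^+ 9; a; a ^+ 11] ->
  orbits_listed lam
    [:: ([:: 0; 0; a ^+ 16; 1], 12%N); ([:: a ^+ 10; 0; 0; a ^+ 6], 20%N);
        ([:: 0; (a + 1) * (a ^+ 11 + 1); b + a ^+ 14 - a ^+ 5 + a ^+ 4;
             (b + 1) * a ^+ 14 + a ^+ 4], 30%N)] (Some 60%N).
Proof.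
move=> zP -> lE; have E k := ev60 k zP; have M := @evM F K60 b (red60 zP) isT.
have := @table60 b zP [seq x60 k | k <- [:: 18; 18; 2; 22]%N]
  [:: e0; e0; x60 32; cone] [:: x60 20; e0; e0; x60 12]
  [:: e0; cmul K60 (cadd (x60 2) cone) (cadd (x60 22) cone);
      cadd (csub (cadd (x60 1) (x60 28)) (x60 10)) (x60 8);
      cadd (cmul K60 (cadd (x60 1) cone) (x60 28)) (x60 8)] 12 20 30 60.
cbn [map]; rewrite lE -!exprM !(M, E, evD, evB, M, E, ev_cone) expr1.
apply; [by [] | vm_cast_no_check (erefl true) | by [] | by []].
Qed.

Lemma icosa4 (b a : F) : 60.-primitive_root b -> a = b ^+ 2 ->
  tval lam = [:: a ^+ 5; a ^+ 5; a; a ^+ 19] ->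
  orbits_listed lam
    [:: ([:: a ^+ 11; 0; 0; -1], 12%N); ([:: 0; 0; 1; a ^+ 14], 20%N);
        ([:: 0; 1; a ^+ 5 * (1 + b); a ^+ 4 * (a ^+ 10 - b)], 30%N)]
    (Some 60%N).
Proof.
move=> zP -> lE; have E k := ev60 k zP; have M := @evM F K60 b (red60 zP) isT.
have := @table60 b zP [seq x60 k | k <- [:: 10; 10; 2; 38]%N]
  [:: x60 22; e0; e0; copp cone] [:: e0; e0; cone; x60 28]
  [:: e0; cone; cmul K60 (x60 10) (cadd cone (x60 1));
      cmul K60 (x60 8) (csub (x60 20) (x60 1))] 12 20 30 60.
cbn [map]; rewrite lE -!exprM !(M, E, evD, evB, evN, ev_cone) expr1.
apply; [by [] | vm_cast_no_check (erefl true) | by [] | by []].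
Qed.

Lemma icosa5 (b a : F) : 60.-primitive_root b -> a = b ^+ 4 ->
  tval lam = [:: a; a ^+ 4; a ^+ 2; a ^+ 8] ->
  orbits_listed lam
    [:: ([:: a ^+ 12; 0; 0; - a ^+ 5], 12%N); ([:: 0; 0; a ^+ 2; -1], 20%N);
        ([:: 0;
             b ^+ 56 + b ^+ 13 + b ^+ 12 + b ^+ 8 - b ^+ 6 - b ^+ 2;
             1 + b ^+ 22; b ^+ 19 + b ^+ 18 - b ^+ 8], 30%N)] (Some 60%N).
Proof.
move=> zP -> lE; have E k := ev60 k zP.
have := @table60 b zP [seq x60 k | k <- [:: 4; 16; 8; 32]%N]
  [:: x60 48; e0; e0; copp (x60 20)] [:: e0; e0; x60 8; copp cone]
  [:: e0; csub (csub (cadd (cadd (cadd (x60 56) (x60 13)) (x60 12)) (x60 8)) (x60 6)) (x60 2);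
      cadd cone (x60 22); csub (cadd (x60 19) (x60 18)) (x60 8)] 12 20 30 60.
cbn [map]; rewrite lE -!exprM !(E, evD, evB, evN, ev_cone).
apply; [by [] | vm_cast_no_check (erefl true) | by [] | by []].
Qed.

Lemma icosa6 (b a c : F) : 60.-primitive_root b -> a = b ^+ 12 -> c = b ^+ 2 ->
  tval lam = [:: - a; - a; - a; - a ^+ 2] ->
  orbits_listed lam
    [:: ([:: 0; 0; a; 1], 12%N);
        ([:: 0; c ^+ 5 + c ^+ 4 - 1; c ^+ 4 + c - a; a * c - c ^+ 5], 20%N);
        ([:: 0; b ^+ 11 + b ^+ 9 - b; b ^+ 9 - 1;
             a * (b ^+ 6 + b ^+ 3)], 30%N)] (Some 60%N).
Proof.
move=> zP -> -> lE; have E k := ev60 k zP; have M := @evM F K60 b (red60 zP) isT.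
have := @table60 b zP [:: copp (x60 12); copp (x60 12); copp (x60 12); copp (x60 24)]
  [:: e0; e0; x60 12; cone]
  [:: e0; csub (cadd (x60 10) (x60 8)) cone; csub (cadd (x60 8) (x60 2)) (x60 12);
      csub (cmul K60 (x60 12) (x60 2)) (x60 10)]
  [:: e0; csub (cadd (x60 11) (x60 9)) (x60 1); csub (x60 9) cone;
      cmul K60 (x60 12) (cadd (x60 6) (x60 3))] 12 20 30 60.
cbn [map]; rewrite lE -!exprM !(M, E, evD, evB, evN, ev_cone) expr1.
apply; [by [] | vm_cast_no_check (erefl true) | by [] | by []].
Qed.

End Tables.

(** * Change of coordinate and the imprimitive case *)

Section Intertwining.
Variables (F : numClosedFieldType) (A B A' B' C : mat2 F).
Hypotheses (A0 : mdet A != 0) (B0 : mdet B != 0) (C0 : mdet C != 0)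
  (A'0 : mdet A' != 0) (B'0 : mdet B' != 0)
  (CA : mmul C A = mmul A' C) (CB : mmul C B = mmul B' C).

Lemma mob_intertwine (M M' : mat2 F) x : mdet M != 0 -> mdet M' != 0 ->
  mmul C M = mmul M' C -> mob C (mob M x) = mob M' (mob C x).
Proof. by move=> M0 M'0 e; rewrite -!mobM // e. Qed.

Lemma mob_intertwineV (M M' : mat2 F) x : mdet M != 0 -> mdet M' != 0 ->
  mmul C M = mmul M' C -> mob C (mob (madj M) x) = mob (madj M') (mob C x).
Proof.
move=> M0 M'0 e; apply: (mob_inj M'0).
by rewrite -(mob_intertwine _ M0 M'0 e) !mob_adjVK.
Qed.

Lemma morb_intertwine x y : morb A B x y <-> morb A' B' (mob C x) (mob C y).
Proof.
split=> -[M gM].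
  move=> <-; elim: gM => [|N gN IH|N gN IH|N gN IH|N gN IH].
  - by rewrite mob1; apply: morb_refl.
  - apply: (morb_trans A'0 B'0 IH); exists A'; first exact: mgen_genL.
    by rewrite mobM ?(mgen_det A0 B0 gN) // (mob_intertwine _ A0 A'0 CA).
  - apply: (morb_trans A'0 B'0 IH); exists B'; first exact: mgen_genR.
    by rewrite mobM ?(mgen_det A0 B0 gN) // (mob_intertwine _ B0 B'0 CB).
  - apply: (morb_trans A'0 B'0 IH); exists (madj A'); first exact/mgen_adj/mgen_genL.
    by rewrite mobM ?mdet_adj ?(mgen_det A0 B0 gN) // (mob_intertwineV _ A0 A'0 CA).
  - apply: (morb_trans A'0 B'0 IH); exists (madj B'); first exact/mgen_adj/mgen_genR.
    by rewrite mobM ?mdet_adj ?(mgen_det A0 B0 gN) // (mob_intertwineV _ B0 B'0 CB).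
move=> e; suff [z xz zE] : exists2 z, morb A B x z & mob C z = mob M (mob C x).
  by have <- : z = y by apply: (mob_inj C0); rewrite zE e.
elim: gM {e} => [|N gN [z xz zE]|N gN [z xz zE]|N gN [z xz zE]|N gN [z xz zE]].
- by exists x; [apply: morb_refl | rewrite mob1].
- exists (mob A z).
    by apply: (morb_trans A0 B0 xz); exists A; first exact: mgen_genL.
  by rewrite (mob_intertwine _ A0 A'0 CA) zE mobM ?(mgen_det A'0 B'0 gN).
- exists (mob B z).
    by apply: (morb_trans A0 B0 xz); exists B; first exact: mgen_genR.
  by rewrite (mob_intertwine _ B0 B'0 CB) zE mobM ?(mgen_det A'0 B'0 gN).
- exists (mob (madj A) z).
    by apply: (morb_trans A0 B0 xz); exists (madj A); first exact/mgen_adj/mgen_genL.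
  by rewrite (mob_intertwineV _ A0 A'0 CA) zE mobM ?mdet_adj ?(mgen_det A'0 B'0 gN).
- exists (mob (madj B) z).
    by apply: (morb_trans A0 B0 xz); exists (madj B); first exact/mgen_adj/mgen_genR.
  by rewrite (mob_intertwineV _ B0 B'0 CB) zE mobM ?mdet_adj ?(mgen_det A'0 B'0 gN).
Qed.

Lemma orbit_list_intertwine s x : orbit_list A' B' s (mob C x) ->
  orbit_list A B (map (mob (madj C)) s) x.
Proof.
case=> s_uniq sP; split.
  by rewrite map_inj_uniq //; apply: mob_inj; rewrite mdet_adj.
move=> y; rewrite morb_intertwine -sP; split=> [/mapP[z zs ->]|ys].
  by rewrite mob_adjVK.
by apply/mapP; exists (mob C y) => //; rewrite mob_adjK.
Qed.

Lemma mem_intertwine s x : (x \in map (mob (madj C)) s) = (mob C x \in s).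
Proof.
apply/mapP/idP => [[z zs ->]|xs]; first by rewrite mob_adjVK.
by exists (mob C x); rewrite ?mob_adjK.
Qed.

End Intertwining.

Section Dihedral.
Variables (F : numClosedFieldType) (t : F).
Hypothesis t0 : t != 0.
Implicit Types (w : F) (x y : option F).

(** On the affine coordinate these are w -> 1 / w and w -> w / t, which generate a dihedral group
    exchanging or fixing 0 and infinity. *)
Definition dswap : mat2 F := (0, 1, 1, 0).
Definition ddiag : mat2 F := (1, 0, 0, t^-1).

Lemma dswap_det : mdet dswap != 0.
Proof. by rewrite /= mul0r mulr1 sub0r oppr_eq0 oner_eq0. Qed.
Lemma ddiag_det : mdet ddiag != 0.
Proof. by rewrite /= mul1r mulr0 subr0 invr_eq0. Qed.

Lemma dswap_mob w : w != 0 -> mob dswap (Some w) = Some w^-1.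
Proof.
move=> w0; rewrite /mob /ppt /= ?(mul0r, mul1r, mulr1, add0r, addr0).
by rewrite (negPf w0) ?div1r.
Qed.
Lemma dswap_mob0 : mob dswap (Some 0) = None.
Proof. by rewrite /mob /ppt /= ?(mul0r, mul1r, mulr1, mulr0, add0r, addr0) eqxx. Qed.
Lemma dswap_mobN : mob dswap None = Some 0.
Proof.
by rewrite /mob /ppt /= ?(mul0r, mul1r, mulr1, mulr0, add0r, addr0) oner_eq0 ?mul0r.
Qed.
Lemma ddiag_mob w : mob ddiag (Some w) = Some (t^-1 * w).
Proof.
by rewrite /mob /ppt /= ?(mul0r, mul1r, mulr1, mulr0, add0r, addr0) oner_eq0 divr1.
Qed.
Lemma ddiag_mobN : mob ddiag None = None.
Proof. by rewrite /mob /ppt /= ?(mul0r, mul1r, mulr1, mulr0, add0r, addr0) eqxx. Qed.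

Lemma dihedral_poles x : x = None \/ x = Some 0 ->
  orbit_list dswap ddiag [:: None; Some 0] x.
Proof.
move=> xE; split=> // y; split.
  have S0 : morb dswap ddiag None (Some 0).
    by exists dswap; [apply: mgen_genL | apply: dswap_mobN].
  have S1 := morb_sym dswap_det ddiag_det S0.
  have Sr x' : morb dswap ddiag x' x' by apply: morb_refl.
  by case: xE => ->; rewrite in_cons inE => /orP[]/eqP->.
move=> xy; apply: (morb_stable dswap_det ddiag_det _ _ _ xy).
- by move=> z; rewrite !inE => /orP[]/eqP->; rewrite ?dswap_mobN ?dswap_mob0 ?eqxx ?orbT.
- by move=> z; rewrite !inE => /orP[]/eqP->;
    rewrite ?ddiag_mobN ?ddiag_mob ?mulr0 ?eqxx ?orbT.
- by case: xE => ->; rewrite !inE ?eqxx ?orbT.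
Qed.

Lemma dihedral_power x w k : morb dswap ddiag x (Some w) ->
  morb dswap ddiag x (Some (t ^+ k * w)).
Proof.
elim: k => [|k IHk] xw; first by rewrite expr0 mul1r.
apply: (morb_trans dswap_det ddiag_det (IHk xw)).
apply: (morb_sym dswap_det ddiag_det); exists ddiag; first exact: mgen_genR.
by rewrite ddiag_mob exprS -mulrA mulKf.
Qed.

Lemma dihedral_infinite w : w != 0 -> (forall k, (0 < k)%N -> t ^+ k != 1) ->
  ~ exists s, orbit_list dswap ddiag s (Some w).
Proof.
move=> w0 tk [s [s_uniq sP]].
pose f k := Some (t ^+ k * w).
have f_inj : injective f.
  have aux i j : (i <= j)%N -> f i = f j -> i = j.
    move=> ij [/(mulIf w0)]; rewrite -(subnK ij) exprD => e.
    have : t ^+ (j - i) = 1.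
      by apply: (mulIf (expf_neq0 i t0)); rewrite -e mul1r.
    case E: (j - i)%N => [|k]; first lia.
    by move/eqP; rewrite (negPf (tk _ _)).
  move=> i j; have [ij|ji] := leqP i j; first exact: aux.
  by move=> e; apply/esym/(aux j i (ltnW ji))/esym.
have : (size (map f (iota 0 (size s).+1)) <= size s)%N.
  apply: uniq_leq_size; first by rewrite map_inj_uniq ?iota_uniq.
  by move=> _ /mapP[k _ ->]; apply/sP/dihedral_power/morb_refl.
by rewrite size_map size_iota ltnn.
Qed.

Variable m : nat.
Hypothesis tP : m.-primitive_root t.

Lemma prim_exprV k : (t ^+ k)^-1 = t ^+ (k * m.-1).
Proof.
apply: (mulfI (expf_neq0 k t0)); rewrite mulfV ?expf_neq0 // -exprD.
rewrite -mulnS prednK ?(prim_order_gt0 tP) // mulnC exprM.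
by rewrite (prim_expr_order tP) expr1n.
Qed.

Definition dcycle w : seq (option F) := [seq Some (t ^+ k * w) | k <- iota 0 m].

Lemma size_dcycle w : size (dcycle w) = m.
Proof. by rewrite size_map size_iota. Qed.

Lemma mem_dcycle w y : y \in dcycle w <-> exists k, y = Some (t ^+ k * w).
Proof.
split=> [/mapP[k _ ->]|[k ->]]; first by exists k.
apply/mapP; exists (k %% m)%N; last by rewrite (prim_expr_mod tP).
by rewrite mem_iota add0n ltn_mod (prim_order_gt0 tP).
Qed.

Lemma dcycle_uniq w : w != 0 -> uniq (dcycle w).
Proof.
move=> w0; rewrite map_inj_in_uniq ?iota_uniq // => i j.
rewrite !mem_iota !add0n => im jm [/(mulIf w0)] /eqP.
by rewrite (eq_prim_root_expr tP) !modn_small // => /eqP.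
Qed.

Lemma dcycle_diag w y : y \in dcycle w -> mob ddiag y \in dcycle w.
Proof.
move=> /mem_dcycle[k ->]; apply/mem_dcycle; exists (k + m.-1)%N.
rewrite ddiag_mob exprD; congr Some; rewrite !mulrA; congr (_ * _).
apply: (mulfI t0); rewrite mulrA mulfV // mul1r mulrCA -exprS.
by rewrite prednK ?(prim_order_gt0 tP) // (prim_expr_order tP) mulr1.
Qed.

Lemma dcycle_swap w y : w != 0 -> y \in dcycle w -> mob dswap y \in dcycle w^-1.
Proof.
move=> w0 /mem_dcycle[k ->]; apply/mem_dcycle; exists (k * m.-1)%N.
by rewrite dswap_mob ?mulf_neq0 ?expf_neq0 // invfM prim_exprV.
Qed.

Lemma dcycle_orbit w y : y \in dcycle w -> morb dswap ddiag (Some w) y.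
Proof. by move=> /mem_dcycle[k ->]; apply/dihedral_power/morb_refl. Qed.

(** Here 1 / w is w times a power of t, so the inversion preserves the cycle of w. *)
Lemma dihedral_short w j : w != 0 -> w ^+ 2 = t ^+ j ->
  orbit_list dswap ddiag (dcycle w) (Some w).
Proof.
move=> w0 w2; split=> [|y]; first exact: dcycle_uniq.
split=> [|wy]; first exact: dcycle_orbit.
apply: (morb_stable dswap_det ddiag_det _ _ _ wy); last first.
- by apply/mem_dcycle; exists 0%N; rewrite expr0 mul1r.
- exact: dcycle_diag.
- move=> z /(dcycle_swap w0) /mem_dcycle[k ->]; apply/mem_dcycle.
  exists (k + j * m.-1)%N; congr Some; rewrite exprD -mulrA; congr (_ * _).
  by rewrite -prim_exprV -w2; field.
Qed.

(** The cycles of w and 1 / w are disjoint unless w^2 is a power of t. *)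
Lemma dihedral_long w : w != 0 -> (forall j, w ^+ 2 != t ^+ j) ->
  orbit_list dswap ddiag (dcycle w ++ dcycle w^-1) (Some w).
Proof.
move=> w0 w2; have wV0 : w^-1 != 0 by rewrite invr_eq0.
split=> [|y].
  rewrite cat_uniq !dcycle_uniq // andbT; apply/hasPn => y /mem_dcycle[k yk].
  apply/negP => /mem_dcycle[i yi]; move: yi; rewrite yk => -[e].
  have /eqP : w ^+ 2 = t ^+ (k + i * m.-1).
    rewrite exprD -prim_exprV; apply: (mulfI (expf_neq0 i t0)).
    by rewrite expr2 mulrA -e divfK // mulrC divfK // expf_neq0.
  exact/negP.
rewrite mem_cat; split=> [/orP[|yw]|wy].
- exact: dcycle_orbit.
- apply: (morb_trans dswap_det ddiag_det _ (dcycle_orbit yw)).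
  by exists dswap; [apply: mgen_genL | apply: dswap_mob].
rewrite -mem_cat; apply: (morb_stable dswap_det ddiag_det _ _ _ wy); last first.
- by rewrite mem_cat; apply/orP; left; apply/mem_dcycle; exists 0%N; rewrite expr0 mul1r.
- by move=> z; rewrite !mem_cat => /orP[/dcycle_diag->//|/dcycle_diag->]; rewrite orbT.
- move=> z; rewrite !mem_cat => /orP[/(dcycle_swap w0)->|]; first by rewrite orbT.
  by move=> /(dcycle_swap wV0); rewrite invrK => ->.
Qed.

Lemma size_long w : size (dcycle w ++ dcycle w^-1) = (2 * m)%N.
Proof. by rewrite size_cat !size_dcycle addnn mul2n. Qed.

End Dihedral.

Lemma odd_power_sqr (R : comNzRingType) (t a : R) i : t = a ^+ 2 ->
  t ^+ (2 * i).+1 = (t ^+ i * a) ^+ 2.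
Proof. by move=> tE; rewrite exprMn -tE exprS mulrC mulnC exprM. Qed.

Section Imprimitive.
Variables (F : numClosedFieldType) (lam : 4.-tuple F) (a : F).
Hypotheses (l_prod : \prod_(z <- lam) z = 1)
  (l_neq1 : all (fun z => z != 1) lam)
  (lE : tval lam = [:: a; - a^-1; - a^-1; a]) (a2 : a ^+ 2 != 1).

Let l4 := size_tuple lam.
Let t := a ^+ 2.
Let A := matA lam.
Let B := matB lam.
(* In the coordinate [s / (s - (a - 1))], where [s = v / u], the generators
   become [w -> 1 / w] and [w -> w / a ^ 2]. *)
Let C : mat2 F := (1 - a, 1, 0, 1).
Let A0 : mdet A != 0 := matA_det l4 l_prod.
Let B0 : mdet B != 0 := matB_det l4 l_prod.

Lemma imprim_a0 : a != 0.
Proof. by have := lam_neq0 l4 l_prod (isT : (0 < 4)%N); rewrite lE. Qed.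
Let a0 := imprim_a0.

Lemma imprim_a1 : 1 - a != 0.
Proof. by rewrite subr_eq0; apply: contraNneq a2 => <-; rewrite expr1n. Qed.

Lemma imprim_aN1 : 1 + a != 0.
Proof.
rewrite addr_eq0; apply: contraNneq a2 => e.
by rewrite -[a]opprK -e sqrrN expr1n.
Qed.

Let t0 : t != 0. Proof. exact: expf_neq0. Qed.
Let C0 : mdet C != 0.
Proof. by rewrite /= mulr1 mulr0 subr0 imprim_a1. Qed.

Let CA : mmul C A = mmul (dswap F) C.
Proof.
by rewrite /A /matA lE /=; congr (_, _, _, _); field.
Qed.
Let CB : mmul C B = mmul (ddiag t) C.
Proof.
by rewrite /B /matB lE /t /=; congr (_, _, _, _); field.
Qed.

Let S0 := dswap_det F.
Let D0 := ddiag_det t0.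
Let pull := map (mob (madj C)).

Lemma pull_orbit s x : orbit_list (dswap F) (ddiag t) s (mob C x) ->
  orbit_list A B (pull s) x.
Proof. exact: (orbit_list_intertwine A0 B0 C0 S0 D0 CA CB). Qed.

Lemma mem_pull s x : (x \in pull s) = (mob C x \in s).
Proof. exact: mem_intertwine. Qed.

Let v1 := vec_of lam [:: 0; 1; a; 0].
Let v2 := vec_of lam [:: 0; 0; 1; a].
Let v3 := vec_of lam [:: 0; 1; 0; - a ^+ 2].
Let v4 := vec_of lam [:: 0; 2; 1 + a; a - a ^+ 2].

Let k0 : 1 + a^-1 != 0.
Proof.
have -> : 1 + a^-1 = (1 + a) / a by field.
by rewrite mulf_neq0 ?imprim_aN1 ?invr_eq0.
Qed.

Lemma imprim_ppt v (p q : F) : mapply C v = (p, q) -> (p, q) != 0 ->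
  v != 0 /\ mob C (ppt v) = ppt (p, q).
Proof.
move=> e pq0; have v0 : v != 0.
  apply: contraNneq pq0 => v0; rewrite -e v0 /mapply /=.
  by rewrite !mulr0 !addr0.
by rewrite mob_ppt // e.
Qed.

Lemma imprim_v1 : v1 != 0 /\ mob C (ppt v1) = None.
Proof.
have -> : None = ppt (0, (1 - a) ^+ 2 * (1 + a^-1)) by rewrite /ppt eqxx.
apply: imprim_ppt; last by rewrite xpair_eqE /= mulf_eq0 expf_eq0 /= negb_and negb_or imprim_a1 k0 orbT.
by rewrite /v1 /vec_of lE /=; congr pair; field.
Qed.

Lemma imprim_v2 : v2 != 0 /\ mob C (ppt v2) = Some 1.
Proof.
have n0 : (a - 1) * (1 + a^-1) != 0.
  by rewrite mulf_neq0 // -oppr_eq0 opprB imprim_a1.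
have -> : Some 1 = ppt ((a - 1) * (1 + a^-1), (a - 1) * (1 + a^-1)).
  by rewrite /ppt /= (negPf n0) divff.
apply: imprim_ppt; last by rewrite xpair_eqE /= negb_and n0.
by rewrite /v2 /vec_of lE /=; congr pair; field.
Qed.

Lemma imprim_v3 : v3 != 0 /\ mob C (ppt v3) = Some a^-1.
Proof.
have n0 : (1 - a) * (1 + a^-1) != 0 by rewrite mulf_neq0 // imprim_a1.
have -> : Some a^-1 = ppt ((1 - a) * (1 + a^-1) * a, (1 - a) * (1 + a^-1)).
  by rewrite /ppt /= mulf_eq0 (negPf n0) (negPf a0) /= invfM mulrA divff // mul1r.
apply: imprim_ppt; last by rewrite xpair_eqE /= negb_and n0 orbT.
by rewrite /v3 /vec_of lE /=; congr pair; field.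
Qed.

Lemma imprim_v4 : v4 != 0 /\ mob C (ppt v4) = Some (-1).
Proof.
have n0 : (1 - a) ^+ 2 * (1 + a^-1) != 0 by rewrite mulf_neq0 ?expf_neq0 // imprim_a1.
have -> : Some (-1) = ppt (- ((1 - a) ^+ 2 * (1 + a^-1)), (1 - a) ^+ 2 * (1 + a^-1)).
  by rewrite /ppt /= oppr_eq0 (negPf n0) invrN mulrN divff.
apply: imprim_ppt; last by rewrite xpair_eqE /= negb_and n0 orbT.
by rewrite /v4 /vec_of lE /=; congr pair; field.
Qed.

Lemma imprim_rel : [/\ trans_rel lam [:: 0; 1; a; 0], trans_rel lam [:: 0; 0; 1; a],
  trans_rel lam [:: 0; 1; 0; - a ^+ 2] & trans_rel lam [:: 0; 2; 1 + a; a - a ^+ 2]].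
Proof. by split; split=> //; rewrite lE /=; field. Qed.

Lemma imprim_infinite : (forall k, (0 < k)%N -> t ^+ k != 1) ->
  orbits_listed lam [:: ([:: 0; 1; a; 0], 2%N)] None.
Proof.
move=> tk; have [r1 _ _ _] := imprim_rel; have [v1n v1E] := imprim_v1.
apply: (listed_orbits l_prod l_neq1 (Os := [:: pull [:: None; Some 0]])).
- move=> [|//] _; split; [exact: r1 | exact: v1n | by [] |].
  by apply: pull_orbit; rewrite v1E; apply: (dihedral_poles t0); left.
- by move=> i [|j]; rewrite ?andbF // andbC.
- move=> x xO [s sP]; have xE : x \notin pull [:: None; Some 0] := xO 0%N isT.
  move: xE; rewrite mem_pull !inE; case E: (mob C x) => [w|//]; rewrite (inj_eq Some_inj) => w0.
  apply: (dihedral_infinite t0 w0 tk); exists (map (mob C) s); split.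
    by rewrite map_inj_uniq; [case: sP | apply: mob_inj].
  move=> y; rewrite -E -(mob_adjVK C0 y) -(morb_intertwine A0 B0 C0 S0 D0 CA CB).
  case: sP => _ <-; rewrite mem_map //; exact: mob_inj.
Qed.

Section FiniteOrder.
Variable m : nat.
Hypothesis tP : m.-primitive_root t.

Lemma imprim_orbits x : mob C x != None -> mob C x != Some 0 ->
  (forall w, mob C x = Some w -> forall j, w ^+ 2 != t ^+ j) ->
  orbit_card lam x (Some (2 * m)%N).
Proof.
case E: (mob C x) => [w|//] _; rewrite (inj_eq Some_inj) => w0 /(_ w erefl) wj.
exists (pull (dcycle t m w ++ dcycle t m w^-1)).
  by rewrite size_map size_long.
by apply: pull_orbit; rewrite E; apply: (dihedral_long t0 tP).
Qed.

(** By [dihedral_short], the short orbits away from the poles consist of the square roots of powers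
    of t. They form two cosets of the powers of t, represented by 1 and by w; the parity of m
    decides which w is available. *)
Lemma imprim_listed (tau : seq F) (w : F) : trans_rel lam tau ->
  vec_of lam tau != 0 -> mob C (ppt (vec_of lam tau)) = Some w ->
  w != 0 -> (exists j, w ^+ 2 = t ^+ j) ->
  w \notin [seq t ^+ k | k <- iota 0 m] ->
  (forall z, z != 0 -> (exists j, z ^+ 2 = t ^+ j) ->
     (exists k, z = t ^+ k) \/ (exists k, z = t ^+ k * w)) ->
  orbits_listed lam [:: ([:: 0; 1; a; 0], 2%N); ([:: 0; 0; 1; a], m); (tau, m)]
    (Some (2 * m)%N).
Proof.
move=> tau_rel v_neq0 vE w0 [j wj] w_notin squares.
have [r1 r2 _ _] := imprim_rel; have [v1n v1E] := imprim_v1; have [v2n v2E] := imprim_v2.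
apply: (listed_orbits l_prod l_neq1
  (Os := [:: pull [:: None; Some 0]; pull (dcycle t m 1); pull (dcycle t m w)])).
- move=> [|[|[|//]]] _; split;
    try by [exact: r1 | exact: r2 | exact: tau_rel | rewrite !size_map ?size_iota].
  + exact: v1n.
  + by apply: pull_orbit; rewrite v1E; apply: (dihedral_poles t0); left.
  + exact: v2n.
  + apply: pull_orbit; rewrite v2E; apply: (dihedral_short t0 tP (j := 0)).
      exact: oner_neq0.
    by rewrite expr1n expr0.
  + exact: v_neq0.
  + by apply: pull_orbit; rewrite vE; exact: (dihedral_short t0 tP w0 wj).
- move=> i k /andP[+ k3]; case: k k3 => [|[|[|//]]] _; case: i => [|[|[|//]]] // _.
  + change (ppt v2 \notin pull [:: None; Some 0]).
    by rewrite mem_pull v2E !inE (inj_eq Some_inj) oner_eq0.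
  + change (ppt (vec_of lam tau) \notin pull [:: None; Some 0]).
    by rewrite mem_pull vE !inE (inj_eq Some_inj) (negPf w0).
  + change (ppt (vec_of lam tau) \notin pull (dcycle t m 1)).
    rewrite mem_pull vE; apply: contra w_notin => /mapP[k k_in [->]].
    by rewrite mulr1; apply: map_f.
- move=> x xO; apply: imprim_orbits.
  + by have : x \notin pull [:: None; Some 0] := xO 0%N isT; rewrite mem_pull !inE negb_or => /andP[].
  + by have : x \notin pull [:: None; Some 0] := xO 0%N isT; rewrite mem_pull !inE negb_or => /andP[].
  move=> z xz i; apply/eqP => zi.
  have z0 : z != 0.
    by have : x \notin pull [:: None; Some 0] := xO 0%N isT; rewrite mem_pull !inE negb_or xz => /andP[_].
  have [|[k zE]|[k zE]] := squares z z0; first by exists i.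
    have : x \notin pull (dcycle t m 1) := xO 1%N isT; rewrite mem_pull xz zE => /negP; apply.
    by apply/(mem_dcycle tP); exists k; rewrite mulr1.
  have : x \notin pull (dcycle t m w) := xO 2%N isT; rewrite mem_pull xz zE => /negP; apply.
  by apply/(mem_dcycle tP); exists k.
Qed.

(** Here -1 is a power of t, so the square roots of powers of t are the t^i and the t^i a; the
    second coset is that of 1 / a, since 1 / a = t^k would give a odd order. *)
Lemma imprim_even : ~~ odd m -> orbits_listed lam
  [:: ([:: 0; 1; a; 0], 2%N); ([:: 0; 0; 1; a], m); ([:: 0; 1; 0; - a ^+ 2], m)]
  (Some (2 * m)%N).
Proof.
move=> m_even; have [_ _ r3 _] := imprim_rel; have [v3n v3E] := imprim_v3.
have m0 := prim_order_gt0 tP.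
have [h mE] : exists h, m = (2 * h)%N by exists m./2; rewrite mul2n even_halfK.
have tN : t ^+ h = -1.
  by apply: prim_half; [rewrite -mE | move: m0; rewrite mE muln_gt0].
have aV : a^-1 = t ^+ m.-1 * a.
  apply: (mulfI a0); rewrite mulfV // mulrCA -expr2 -/t -exprSr prednK //.
  by rewrite (prim_expr_order tP).
apply: (imprim_listed r3 v3n v3E); first by rewrite invr_eq0.
- by exists m.-1; rewrite expr2 {1}aV mulfK.
- apply/mapP => -[k _ ak]; have : a ^+ (2 * k).+1 = 1.
    by rewrite exprS exprM -/t -ak mulfV.
  move=> /(congr1 (fun z => z ^+ 2)); rewrite expr1n -exprM mulnC exprM -/t => /eqP.
  rewrite -(prim_order_dvd tP) mE => /(dvdn_trans (dvdn_mulr _ (dvdnn 2))).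
  by rewrite dvdn2 /= oddM.
- move=> z z0 [j zj].
  have sg y : z ^+ 2 = y ^+ 2 -> z = y \/ z = - y.
    by move=> /eqP; rewrite eqf_sqr => /orP[]/eqP->; [left|right].
  have [i [jE|jE]] : exists i, j = (2 * i)%N \/ j = (2 * i).+1.
    by move: (odd_double_half j); case: (odd j) => e; exists j./2; [right|left];
      rewrite -[LHS]e -mul2n.
    have [->|->] : z = t ^+ i \/ z = - (t ^+ i) by apply: sg; rewrite zj jE -[RHS]exprM [in RHS]mulnC.
      by left; exists i.
    by left; exists (h + i)%N; rewrite exprD tN mulN1r.
  have e : z ^+ 2 = (t ^+ i * a) ^+ 2.
    by rewrite zj jE; apply: odd_power_sqr.
  have aE : a = t * a^-1 by rewrite /t expr2 mulfK.
  right; have [->|->] := sg _ e.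
    by exists i.+1; rewrite {1}aE exprSr mulrA.
  by exists (h + i.+1)%N; rewrite {1}aE exprD tN exprSr mulN1r mulNr mulrA.
Qed.

(** Here every power of t is the square of a power of t, so the square roots are, up to sign, powers
    of t, and -1 is not one of these. *)
Lemma imprim_odd : odd m -> orbits_listed lam
  [:: ([:: 0; 1; a; 0], 2%N); ([:: 0; 0; 1; a], m);
      ([:: 0; 2; 1 + a; a - a ^+ 2], m)] (Some (2 * m)%N).
Proof.
move=> m_odd; have [_ _ _ r4] := imprim_rel; have [v4n v4E] := imprim_v4.
have m0 := prim_order_gt0 tP.
apply: (imprim_listed r4 v4n v4E); first by rewrite oppr_eq0 oner_eq0.
- by exists 0%N; rewrite sqrrN expr1n expr0.
- apply/mapP => -[k _ tk].
  have /eqP : t ^+ (2 * k) = 1 by rewrite mulnC exprM -tk sqrrN expr1n.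
  rewrite -(prim_order_dvd tP) Gauss_dvdr ?coprimen2 // (prim_order_dvd tP) -tk.
  by rewrite -subr_eq0 -opprD oppr_eq0 (_ : 1 + 1 = 2) // pnatr_eq0.
- move=> z z0 [j zj].
  have [i iE] : exists i, z ^+ 2 = (t ^+ i) ^+ 2.
    have [oj|ej] := boolP (odd j).
      exists (j + m)./2; rewrite zj -exprM muln2 even_halfK ?oddD ?oj ?m_odd //.
      by rewrite exprD (prim_expr_order tP) mulr1.
    by exists j./2; rewrite zj -exprM muln2 even_halfK.
  move/eqP: iE; rewrite eqf_sqr => /orP[]/eqP->; first by left; exists i.
  by right; exists i; rewrite mulrN1.
Qed.

End FiniteOrder.
End Imprimitive.

Theorem table_listed (F : numClosedFieldType) (lam : 4.-tuple F)
    (L : seq (seq F * nat)) (N : option nat) :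
  \prod_(z <- lam) z = 1 -> all (fun z => z != 1) lam ->
  finite_table lam L N -> orbits_listed lam L N.
Proof.
move=> l_prod l_neq1; move lE : (tval lam) => mu ft.
case: {mu L N} ft lE => [a m a2 _ mP ev|a m a2 _ mP od|a a2 nr|eta eP|zeta eta zP eE|
  eta eP|eta nu eP nE|a aP|b a bP aE|b a bP aE|b a bP aE|b a bP aE|b a c bP aE cE] lE.
- exact: imprim_even.
- exact: imprim_odd.
- apply: (imprim_infinite l_prod l_neq1 lE a2) => k k0; apply/eqP => ak; apply: nr.
  by exists (2 * k)%N; rewrite ?muln_gt0 // exprM.
- exact: tetra1.
- exact: tetra2.
- exact: octa1.
- exact: octa2.
- exact: icosa1.
- exact: (icosa2 _ _ bP).
- exact: (icosa3 _ _ bP).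
- exact: (icosa4 _ _ bP).
- exact: (icosa5 _ _ bP).
- exact: (icosa6 _ _ bP).
Qed.

Delimit Scope N_scope with coqN.

(** * Trace conditions for elements of small order *)

Section TraceConditions.
Variable F : numClosedFieldType.
Implicit Types (M : mat2 F) (x y t d : F).

(* The product of the factors is zero when [M ^ k] is scalar for some [k] in
   [2, 5], with [t] the trace and [d] the determinant of [M]. *)
Definition rot_poly t d : F :=
  t * (t ^+ 2 - d) * (t ^+ 2 - 2 * d) * (t ^+ 4 - 3 * t ^+ 2 * d + d ^+ 2).

(** By Cayley-Hamilton, M^k = U M + V with scalars U and V, where U is a polynomial in trace and
    determinant. If M is not scalar but M^k is, then U = 0, and U divides [rot_poly]. *)
Lemma mscal_rot_poly M k : k \in [:: 2; 3; 4; 5]%N -> mscal (mexp M k) ->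
  ~~ mscal M -> rot_poly (mtr M) (mdet M) = 0.
Proof.
case: M => [[[a b] c] d] kP.
have [U [eb [ec ed]] Uz] : exists2 U : F, (exists e1 e2 e3 e4, [/\ mexp (a, b, c, d) k =
    (e1, e2, e3, e4), e2 = b * U, e3 = c * U & e1 - e4 = (a - d) * U]) &
    (U = 0 -> rot_poly (mtr (a, b, c, d)) (mdet (a, b, c, d)) = 0).
  rewrite /rot_poly /=; set t := a + d; set dd := a * d - b * c.
  move: kP; rewrite !inE => /or4P[]/eqP->.
  - exists t; last by move=> ->; rewrite !mul0r.
    by do 4!eexists; split; [reflexivity | rewrite /= /t; ring..].
  - exists (t ^+ 2 - dd); last by move=> ->; rewrite mulr0 !mul0r.
    by do 4!eexists; split; [reflexivity | rewrite /= /t /dd; ring..].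
  - exists (t * (t ^+ 2 - 2 * dd)).
      by do 4!eexists; split; [reflexivity | rewrite /= /t /dd; ring..].
    by move=> /eqP; rewrite mulf_eq0 => /orP[]/eqP->; rewrite ?mulr0 !mul0r.
  - exists (t ^+ 4 - 3 * t ^+ 2 * dd + dd ^+ 2); last by move=> ->; rewrite mulr0.
    by do 4!eexists; split; [reflexivity | rewrite /= /t /dd; ring..].
case: ed => e3 [e4 [-> e2E e3E e14]]; rewrite /mscal => /and3P[/eqP b0 /eqP c0 /eqP ad0].
move=> nM; apply: Uz; apply: contraNeq nM => U0; rewrite /mscal.
move: e2E e3E e14; rewrite b0 c0 ad0 subrr => /esym/eqP + /esym/eqP + /esym/eqP.
by rewrite !mulf_eq0 (negPf U0) !orbF subr_eq0 => -> -> ->.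
Qed.

Lemma rot_poly_scale (k t d : F) :
  rot_poly (k * t) (k ^+ 2 * d) = k ^+ 9 * rot_poly t d.
Proof. by rewrite /rot_poly; ring. Qed.

(** For eigenvalues 1 and x, the factors are the cyclotomic polynomials of orders 2, 3, 4 and 5. *)
Lemma rot_poly_root x : rot_poly (1 + x) x = 0 ->
  exists2 k, k \in [:: 2; 3; 4; 5]%N & x ^+ k = 1 /\ x != 1.
Proof.
have -> : rot_poly (1 + x) x =
    (1 + x) * (1 + x + x ^+ 2) * (1 + x ^+ 2) * (1 + x + x ^+ 2 + x ^+ 3 + x ^+ 4).
  by rewrite /rot_poly; ring.
have one_n (p : F) n : p = n.+1%:R -> p = 0 -> False.
  by move=> -> /eqP; rewrite pnatr_eq0.
move/eqP; rewrite !mulf_eq0 -!orbA => /or4P[] /eqP e.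
- exists 2%N => //; split; first by apply: (lincomb1 (k1 := x - 1) e); ring.
  apply/eqP => x1; apply: (one_n _ 1%N _ e); rewrite x1; ring.
- exists 3%N => //; split; first by apply: (lincomb1 (k1 := x - 1) e); ring.
  apply/eqP => x1; apply: (one_n _ 2%N _ e); rewrite x1; ring.
- exists 4%N => //; split; first by apply: (lincomb1 (k1 := x ^+ 2 - 1) e); ring.
  apply/eqP => x1; apply: (one_n _ 1%N _ e); rewrite x1; ring.
- exists 5%N => //; split; first by apply: (lincomb1 (k1 := x - 1) e); ring.
  apply/eqP => x1; apply: (one_n _ 4%N _ e); rewrite x1; ring.
Qed.

End TraceConditions.

Section Exponents.
Variables (F : numClosedFieldType) (z : F).
Hypothesis zP : 120.-primitive_root z.

(** The exponents e for which z^e has order 2, 3, 4 or 5. *)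
Definition rot_exps : seq nat := [:: 60; 40; 80; 30; 90; 24; 48; 72; 96].

Lemma rot_poly_exp (x : F) : rot_poly (1 + x) x = 0 ->
  exists2 e, e \in rot_exps & x = z ^+ e.
Proof.
case/rot_poly_root => k kP [xk x1].
have kd : (k %| 120)%N by move: kP; rewrite !inE => /or4P[]/eqP->.
have k0 : (0 < k)%N by move: kP; rewrite !inE => /or4P[]/eqP->.
have wP : k.-primitive_root (z ^+ (120 %/ k)) := dvdn_prim_root zP kd.
have [i xi] := prim_rootP wP xk.
exists (120 %/ k * i)%N; last by rewrite exprM.
have i0 : (i : nat) != 0%N by apply: contraNneq x1 => i0; rewrite xi i0 expr0.
move: i i0 {xi wP}; move: kP; rewrite !inE => /or4P[]/eqP->;
  by case=> -[|[|[|[|[|//]]]]].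
Qed.

End Exponents.

Section StablePoints.
Variable F : numClosedFieldType.
Implicit Types (M N : mat2 F) (x y : option F).

(** By Cayley-Hamilton, M^2 is the trace times M up to a scalar matrix: if M^2 fixes the line of x
    and M does not, the trace vanishes. *)
Lemma swap_trace0 M x : mdet M != 0 -> mob M (mob M x) = x -> mob M x != x ->
  mtr M = 0.
Proof.
move=> M0 MMx; rewrite mob_fixE // => cr.
have : mob (mmul M M) x == x by rewrite mobM // MMx.
rewrite mob_fixE ?mdetM ?mulf_neq0 // mapplyM.
have -> : cross (prep x) (mapply M (mapply M (prep x))) =
    mtr M * cross (prep x) (mapply M (prep x)).
  by case: (M) (prep x) => [[[a b] c] d] [u v]; rewrite /cross /=; ring.
by rewrite mulf_eq0 (negPf cr) orbF => /eqP.
Qed.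

Lemma pair_fix_or_swap M x y : mdet M != 0 -> x != y ->
  {subset [:: mob M x; mob M y] <= [:: x; y]} ->
  (mob M x = x /\ mob M y = y) \/ (mob M x = y /\ mob M y = x).
Proof.
move=> M0 xy sub.
have := sub (mob M x) (mem_head _ _); rewrite !inE => /orP[]/eqP e.
  left; split=> //; have := sub (mob M y); rewrite !inE eqxx orbT => /(_ isT).
  move=> /orP[]/eqP // e'; case/eqP: xy; apply: (mob_inj M0); by rewrite e e'.
right; split=> //; have := sub (mob M y); rewrite !inE eqxx orbT => /(_ isT).
move=> /orP[]/eqP // e'; case/eqP: xy; apply: (mob_inj M0); by rewrite e e'.
Qed.

End StablePoints.

(** * Necessary conditions for four punctures *)

Section QuadClassification.
Variables (F : numClosedFieldType) (l : seq F).
Hypotheses (l4 : size l = 4) (l_prod : \prod_(z <- l) z = 1)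
  (l_neq1 : all (fun z => z != 1) l).

Let A := matA l.
Let B := matB l.
Let A0 : mdet A != 0 := matA_det l4 l_prod.
Let B0 : mdet B != 0 := matB_det l4 l_prod.
Let l0 := l`_0.
Let l1 := l`_1.
Let l2 := l`_2.

Let n0 : l0 != 0 := lam_neq0 l4 l_prod (isT : (0 < 4)%N).
Let n1 : l1 != 0 := lam_neq0 l4 l_prod (isT : (1 < 4)%N).
Let n2 : l2 != 0 := lam_neq0 l4 l_prod (isT : (2 < 4)%N).

Lemma quad_neq1 i : (i < 4)%N -> 1 - l`_i != 0.
Proof.
move=> i4; rewrite subr_eq0 eq_sym.
by apply: (allP l_neq1); rewrite mem_nth // l4.
Qed.
Let d0 : 1 - l0 != 0 := quad_neq1 (isT : (0 < 4)%N).
Let d1 : 1 - l1 != 0 := quad_neq1 (isT : (1 < 4)%N).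
Let d2 : 1 - l2 != 0 := quad_neq1 (isT : (2 < 4)%N).

Lemma quad_l3 : l0 * l1 * l2 * l`_3 = 1.
Proof.
rewrite -l_prod /l0 /l1 /l2; case: (l) l4 => [|a [|b [|c [|d [|//]]]]] // _.
by rewrite !big_cons big_nil /= mulr1 !mulrA.
Qed.

Let d3 : 1 - l0 * l1 * l2 != 0.
Proof.
have := quad_neq1 (isT : (3 < 4)%N); rewrite !subr_eq0; apply: contraNneq => e.
by rewrite -quad_l3 -e mul1r.
Qed.

(** Eliminating the coordinate of a common fixed point gives a product of factors 1 - l_i, up to
    units; that of l_3 appears as 1 - l_0 l_1 l_2. *)
Lemma no_fixed_point : ~ exists x, mob A x = x /\ mob B x = x.
Proof.
case=> -[s|] [/eqP + /eqP]; rewrite !mob_fixE // /cross /= -/l0 -/l1 -/l2.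
  move=> /eqP eA /eqP eB.
  have eA' : s * (1 - l0 * l1) = - (1 - l0) by apply: (lincomb1 (k1 := 1) eA); ring.
  have : s * (l1 * l2 - 1 - l1 * (1 - l2) * s) = 0.
    by apply: (lincomb1 (k1 := 1) eB); ring.
  move=> /eqP; rewrite mulf_eq0 => /orP[/eqP s0|/eqP e].
    by move: eA' d0 => /eqP; rewrite s0 mul0r eq_sym oppr_eq0 => ->.
  have : (1 - l1) * (1 - l0 * l1 * l2) = 0.
    by apply: (lincomb2 (k1 := - (l1 * (1 - l2))) (k2 := - (1 - l0 * l1)) eA' e); ring.
  by move=> /eqP; rewrite mulf_eq0 (negPf d1) (negPf d3).
move=> _ /eqP e; have : l1 * (1 - l2) = 0 by apply: (lincomb1 (k1 := -1) e); ring.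
by move=> /eqP; rewrite mulf_eq0 (negPf n1) (negPf d2).
Qed.

(** Together with the product relation, this is the imprimitive family (a, -1/a, -1/a, a) up to
    order. *)
Definition imprim : Prop :=
  [\/ l0 * l1 = -1 /\ l1 * l2 = -1, l0 * l1 = -1 /\ l0 * l2 = -1
    | l1 * l2 = -1 /\ l0 * l2 = -1].

Lemma trA : mtr A = 1 + l0 * l1. Proof. by rewrite /= addrC. Qed.
Lemma trB : mtr B = 1 + l1 * l2. Proof. by []. Qed.
Lemma trAB : mtr (mmul A B) = l1 * (1 + l0 * l2).
Proof. by rewrite /= -/l0 -/l1 -/l2; ring. Qed.

(** Without a common fixed point, exactly two of A, B and AB exchange the pair, and these have trace
    0. *)
Lemma stable_pair_imprim x y : x != y ->
  {subset [:: mob A x; mob A y] <= [:: x; y]} ->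
  {subset [:: mob B x; mob B y] <= [:: x; y]} -> imprim.
Proof.
move=> xy /(pair_fix_or_swap A0 xy) fA /(pair_fix_or_swap B0 xy) fB.
have AB0 : mdet (mmul A B) != 0 by rewrite mdetM mulf_neq0.
have yx : y != x by rewrite eq_sym.
have cA : mob A x = y -> mob A y = x -> l0 * l1 = -1.
  move=> e e'; have : mtr A = 0 by apply: (swap_trace0 (x := x)); rewrite ?e ?e'.
  by rewrite trA => /eqP; rewrite addrC addr_eq0 => /eqP.
have cB : mob B x = y -> mob B y = x -> l1 * l2 = -1.
  move=> e e'; have : mtr B = 0 by apply: (swap_trace0 (x := x)); rewrite ?e ?e'.
  by rewrite trB => /eqP; rewrite addrC addr_eq0 => /eqP.
have cAB : mob A (mob B x) = y -> mob A (mob B y) = x -> l0 * l2 = -1.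
  move=> e e'; have : mtr (mmul A B) = 0.
    by apply: (swap_trace0 (x := x)); rewrite ?mobM // ?e ?mobM ?e'.
  by rewrite trAB => /eqP; rewrite mulf_eq0 (negPf n1) /= addrC addr_eq0 => /eqP.
case: fA => -[Ax Ay]; case: fB => -[Bx By].
- by case: no_fixed_point; exists x.
- by constructor 3; split; [apply: cB | apply: cAB; rewrite ?Bx ?By].
- by constructor 2; split; [apply: cA | apply: cAB; rewrite ?Bx ?By].
- by constructor 1; split; [apply: cA | apply: cB].
Qed.

(* The traces and determinants of [A], [B], [AB], [AAB], [ABB] and [AAAB]. *)
Lemma finite_rot_polys x sl : orbit_list A B sl x ->
  imprim \/ let d := l1 - l0 * l1 - l1 * l2 + l0 * l1 * l2 in
    let p := l0 * l1 in let q := l1 * l2 in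
  [/\ rot_poly (1 + p) p = 0, rot_poly (1 + q) q = 0,
      rot_poly (1 + l0 * l2) (l0 * l2) = 0,
      rot_poly (p ^+ 2 + q + (1 + p) * d) (p ^+ 2 * q) = 0 &
      rot_poly (p + q ^+ 2 + (1 + q) * d) (p * q ^+ 2) = 0 /\
      rot_poly (p ^+ 3 + q + (1 + p + p ^+ 2) * d) (p ^+ 3 * q) = 0].
Proof.
move=> slP; have [sl_uniq slE] := slP.
have gA := mgen_genL A B; have gB := mgen_genR A B.
have slA : {in sl, forall y, mob A y \in sl} := orbit_list_closed A0 B0 slP gA.
have slB : {in sl, forall y, mob B y \in sl} := orbit_list_closed A0 B0 slP gB.
have fin : [\/ exists x, mob A x = x /\ mob B x = x,
    exists x y, [/\ x != y, {subset [:: mob A x; mob A y] <= [:: x; y]}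
        & {subset [:: mob B x; mob B y] <= [:: x; y]}]
    | forall M, mgen A B M ->
        exists2 k, k \in [:: 2; 3; 4; 5]%N & mscal (mexp M k)].
  have xsl : x \in sl by apply/slE/morb_refl.
  case E : sl => [|a [|b [|c r]]].
  - by move: xsl; rewrite E.
  - constructor 1; exists a; have a_sl : a \in sl by rewrite E mem_head.
    by have := slA a a_sl; have := slB a a_sl; rewrite E !inE => /eqP-> /eqP->.
  - constructor 2; exists a, b; split.
    + by move: sl_uniq; rewrite E /= inE andbT.
    + by rewrite -E => y; rewrite !inE => /orP[]/eqP->; apply: slA; rewrite E !inE eqxx ?orbT.
    + by rewrite -E => y; rewrite !inE => /orP[]/eqP->; apply: slB; rewrite E !inE eqxx ?orbT.
  - by apply: (finite_mobius A0 B0 sl_uniq _ slA slB); rewrite E.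
case: fin => [/no_fixed_point//|[y [w [yw sA sB]]]|ok]; first by left; apply: stable_pair_imprim sA sB.
right; move=> d p q.
have rp M : mgen A B M -> ~~ mscal M -> rot_poly (mtr M) (mdet M) = 0.
  by move=> gM nM; have [k kP kM] := ok M gM; apply: mscal_rot_poly kP kM nM.
have p0 : p != 0 by apply: mulf_neq0.
have q0 : q != 0 by apply: mulf_neq0.
split; last split.
- rewrite -trA [X in rot_poly _ X](_ : _ = mdet A); last by rewrite /= -/l0 -/l1 /p; ring.
  by apply: rp => //; rewrite /= -/l0 (negPf d0) andbF.
- rewrite -trB [X in rot_poly _ X](_ : _ = mdet B); last by rewrite /= -/l1 -/l2 /q; ring.
  by apply: rp => //; rewrite /= -/l1 -/l2 mulf_eq0 (negPf n1) (negPf d2).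
(* AB has trace l_1 (1 + l_0 l_2) and determinant l_1^2 l_0 l_2; [rot_poly] is homogeneous of degree
   9, so the factor l_1 drops out. *)
- apply: (mulfI (expf_neq0 9 n1)); rewrite mulr0 -rot_poly_scale -trAB.
  rewrite [X in rot_poly _ X](_ : _ = mdet (mmul A B)); last first.
    by rewrite /= -/l0 -/l1 -/l2; ring.
  apply: rp; first exact: mgenM.
  by rewrite /= -/l0 -/l1 -/l2 mulr1 mul1r mulr0 addr0 (negPf d0) andbF.
- rewrite [X in rot_poly X _](_ : _ = mtr (mmul A (mmul A B))); last first.
    by rewrite /= -/l0 -/l1 -/l2 /d /p /q; ring.
  rewrite [X in rot_poly _ X](_ : _ = mdet (mmul A (mmul A B))); last first.
    by rewrite /= -/l0 -/l1 -/l2 /d /p /q; ring.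
  apply: rp; first by do 2!apply: mgenM => //.
  rewrite /= -/l0 -/l1 -/l2 !mul0r !addr0 !mulf_eq0 (negPf n0) (negPf n1) (negPf d2) //.
- rewrite [X in rot_poly X _](_ : _ = mtr (mmul A (mmul B B))); last first.
    by rewrite /= -/l0 -/l1 -/l2 /d /p /q; ring.
  rewrite [X in rot_poly _ X](_ : _ = mdet (mmul A (mmul B B))); last first.
    by rewrite /= -/l0 -/l1 -/l2 /d /p /q; ring.
  apply: rp; first by do 2!apply: mgenM => //.
  by rewrite /= -/l0 -/l1 -/l2 !(mul1r, mulr1, mul0r, mulr0, addr0) (negPf d0) andbF.
- rewrite [X in rot_poly X _](_ : _ = mtr (mmul A (mmul A (mmul A B)))); last first.
    by rewrite /= -/l0 -/l1 -/l2 /d /p /q; ring.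
  rewrite [X in rot_poly _ X](_ : _ = mdet (mmul A (mmul A (mmul A B)))); last first.
    by rewrite /= -/l0 -/l1 -/l2 /d /p /q; ring.
  apply: rp; first by do 3!apply: mgenM => //.
  by rewrite /= -/l0 -/l1 -/l2 !mul0r !addr0 !mulf_eq0 (negPf n0) (negPf n1) (negPf d2).
Qed.

End QuadClassification.


(** * Search among 120th roots of unity *)

Definition K120 := CycField 32
  [:: -1; 0; 0; 0; -1; 0; 0; 0; 0; 0; 0; 0; 1; 0; 0; 0; 1; 0; 0; 0; 1; 0; 0; 0; 0;
      0; 0; 0; -1]%coqZ 120 [:: 61; 31; 41; 49; 97].

Definition units120 : seq N :=
  [:: 1; 7; 11; 13; 17; 19; 23; 29; 31; 37; 41; 43; 47; 49; 53; 59; 61; 67; 71; 73;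
      77; 79; 83; 89; 91; 97; 101; 103; 107; 109; 113; 119]%coqN.

(* The conditionals replace boolean disjunctions, whose arguments are all
   evaluated by the virtual machine. *)
(* For [lambda_i = zeta ^ e_i], this says that the hermitian form preserved by the
   pure braid group and all its Galois conjugates are definite. *)
Definition definite (e : seq nat) : bool :=
  let en := map N.of_nat e in
  all (fun k => let s := foldr (fun x r => N.add (N.modulo (N.mul k x) 120) r) N0 en in
    N.eqb s 120 || N.eqb s 360) units120.

Definition crot (t d : seq Z) : seq Z :=
  let m := cmul K120 in
  let t2 := m t t in let d2 := cadd d d in let td := m t2 d in
  m (m t (csub t2 d)) (m (csub t2 d2)
    (cadd (csub (m t2 t2) (cadd td (cadd td td))) (m d d))).

(** Excludes a tuple by a nonzero [rot_poly] for one of the words AAB, ABB and AAAB. *)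
Definition bad_exps (tab : seq (seq Z)) (e0 e1 e2 : nat) : bool :=
  let x j := nth [::] tab (j %% 120)%N in let m := cmul K120 in
  let p := x (e0 + e1)%N in let q := x (e1 + e2)%N in
  let d := cadd (csub (csub (x e1) p) q) (x (e0 + e1 + e2)%N) in
  let p2 := m p p in let q2 := m q q in
  if cunit K120 tab (crot (cadd (cadd p2 q) (m (cadd cone p) d)) (m p2 q))
  then true
  else if cunit K120 tab (crot (cadd (cadd p q2) (m (cadd cone q) d)) (m p q2))
  then true
  else cunit K120 tab (crot (cadd (cadd (m p p2) q) (m (cadd (cadd cone p) p2) d))
    (m (m p p2) q)).

(** Recovers the four exponents from e0 and the exponents X of l_0 l_1 and Z of l_0 l_2; the
    multiples of 120 keep the subtractions nonnegative. *)
Definition exps4 (e0 X Z : nat) : nat * nat * nat :=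
  let e1 := ((X + 120 - e0) %% 120)%N in let e2 := ((Z + 120 - e0) %% 120)%N in
  (e1, e2, ((480 - (e0 + e1 + e2)) %% 120)%N).

Definition classify_check : bool :=
  let tab := ctab K120 in
  all (fun e0 => all (fun X => all (fun Z =>
    let: (e1, e2, e3) := exps4 e0 X Z in
    if ((e1 + e2) %% 120)%N \notin rot_exps then true
    else if 0%N \in [:: e0; e1; e2; e3] then true
    else if definite [:: e0; e1; e2; e3] then true else bad_exps tab e0 e1 e2)
    rot_exps) rot_exps) (iota 0 120).

Lemma classify_checkP : classify_check = true.
Proof. by vm_cast_no_check (erefl true). Qed.

Section ClassifyExponents.
Variables (F : numClosedFieldType) (z : F).
Hypothesis zP : 120.-primitive_root z.

Lemma red120 : z ^+ 32 = ev z (Rd K120).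
Proof.
have z2P : 60.-primitive_root (z ^+ 2) := dvdn_prim_root zP (isT : 60 %| 120)%N.
have := red60 z2P; rewrite -exprM /= !(zr0, zr1, zrN1) => ->; ring.
Qed.

Let M := @evM F K120 z red120 isT.

Lemma ev_crot t d : ev z (crot t d) = rot_poly (ev z t) (ev z d).
Proof. by rewrite /crot /rot_poly !(M, evB, evD); ring. Qed.

Lemma ev_tab120 j : ev z (nth [::] (ctab K120) (j %% 120)%N) = z ^+ j.
Proof.
have jm : (j %% 120 < nn K120)%N by rewrite ltn_mod.
rewrite /ctab (set_nth_default [:: 1%coqZ]) ?size_traject // nth_traject //.
rewrite -[iter _ _ _]/(cX K120 (j %% 120)) (@ev_cX F K120 z red120 isT) //.
exact: (prim_expr_mod zP).
Qed.

Lemma bad_exps_sound e0 e1 e2 : bad_exps (ctab K120) e0 e1 e2 ->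
  let l0 := z ^+ e0 in let l1 := z ^+ e1 in let l2 := z ^+ e2 in
  let d := l1 - l0 * l1 - l1 * l2 + l0 * l1 * l2 in
  let p := l0 * l1 in let q := l1 * l2 in
  [\/ rot_poly (p ^+ 2 + q + (1 + p) * d) (p ^+ 2 * q) != 0,
      rot_poly (p + q ^+ 2 + (1 + q) * d) (p * q ^+ 2) != 0 |
      rot_poly (p ^+ 3 + q + (1 + p + p ^+ 2) * d) (p ^+ 3 * q) != 0].
Proof.
move=> bad l0 l1 l2 d p q; move: bad; rewrite /bad_exps.
have X := (ev_tab120, ev_cone, exprD).
case: ifP => [u _|_]; last case: ifP => [u _|_ u].
- constructor 1; have := @ev_unit F K120 z red120 isT _ u; rewrite ev_crot !(evD, evB, M) !X.
  by rewrite -!expr2.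
- constructor 2; have := @ev_unit F K120 z red120 isT _ u; rewrite ev_crot !(evD, evB, M) !X.
  by rewrite -!expr2.
- constructor 3; have := @ev_unit F K120 z red120 isT _ u; rewrite ev_crot !(evD, evB, M) !X.
  by rewrite -!expr2 -!exprS.
Qed.

(** The products l_0 l_1, l_1 l_2 and l_0 l_2 have orders 2 to 5, hence are powers of z with even
    exponents. So l_0^2 is a 60th root of unity, l_0 is a power of z, and [classify_check] covers
    the remaining exponents. *)
Theorem classify_exps (l : seq F) x sl : size l = 4 -> \prod_(y <- l) y = 1 ->
  all (fun y => y != 1) l -> orbit_list (matA l) (matB l) sl x ->
  imprim l \/ exists e0 X Z, [/\ (e0 < 120)%N, X \in rot_exps, Z \in rot_exps &
    let: (e1, e2, e3) := exps4 e0 X Z in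
    [/\ l = [:: z ^+ e0; z ^+ e1; z ^+ e2; z ^+ e3], definite [:: e0; e1; e2; e3] &
        0%N \notin [:: e0; e1; e2; e3]]].
Proof.
move=> l4 l_prod l_neq1 slP.
have [|[/(rot_poly_exp zP)[X XP p1] /(rot_poly_exp zP)[Y YP p2]
  /(rot_poly_exp zP)[Z ZP p3] w1 [w2 w3]]] := finite_rot_polys l4 l_prod l_neq1 slP; first by left.
have n0 := lam_neq0 l4 l_prod (isT : (0 < 4)%N).
have n1 := lam_neq0 l4 l_prod (isT : (1 < 4)%N).
have n2 := lam_neq0 l4 l_prod (isT : (2 < 4)%N).
have z0 := prim_neq0 zP.
have sq W : W \in rot_exps -> (z ^+ W) ^+ 60 = 1.
  move=> WP; have ev2 : all (dvdn 2) rot_exps by [].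
  have /dvdnP[h ->] := allP ev2 W WP.
  by rewrite -exprM -mulnA mulnC exprM (prim_expr_order zP) expr1n.
have l0_120 : l`_0 ^+ 120 = 1.
  have e : l`_0 ^+ 2 * z ^+ Y = z ^+ X * z ^+ Z by rewrite -p1 -p2 -p3; ring.
  have : (l`_0 ^+ 2 * z ^+ Y) ^+ 60 = 1 by rewrite e exprMn !sq // mulr1.
  by rewrite exprMn sq // mulr1 -exprM.
have [e0 l0E] := prim_rootP zP l0_120.
have subE j W : (j < 120)%N -> (W < 120)%N -> z ^+ j * z ^+ ((W + 120 - j) %% 120) = z ^+ W.
  move=> j120 W120; rewrite (prim_expr_mod zP) -exprD subnKC; last first.
    by apply: leq_trans (leq_addl _ _); apply: ltnW.
  by rewrite exprD (prim_expr_order zP) mulr1.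
have lt W : W \in rot_exps -> (W < 120)%N.
  by move=> WP; have lt120 : all (fun i => i < 120)%N rot_exps by []; apply: (allP lt120).
set e1 := ((X + 120 - e0) %% 120)%N; set e2 := ((Z + 120 - e0) %% 120)%N.
set e3 := ((480 - (e0 + e1 + e2)) %% 120)%N.
have l1E : l`_1 = z ^+ e1.
  by apply: (mulfI n0); rewrite p1 {1}l0E subE // lt.
have l2E : l`_2 = z ^+ e2.
  by apply: (mulfI n0); rewrite p3 {1}l0E subE // lt.
have l3E : l`_3 = z ^+ e3.
  apply: (mulfI (mulf_neq0 (mulf_neq0 n0 n1) n2)); rewrite quad_l3 //.
  rewrite /e3 (prim_expr_mod zP) l0E l1E l2E -!exprD subnKC.
    by rewrite -[480%N]/(120 * 4)%N exprM (prim_expr_order zP) expr1n.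
  by apply: (@leq_trans (120 + 120 + 120)%N) => //; rewrite !leq_add // ltnW // ltn_mod.
have lE : l = [:: z ^+ e0; z ^+ e1; z ^+ e2; z ^+ e3].
  move: l0E l1E l2E l3E; case: (l) l4 => [|a [|b [|c [|d [|//]]]]] // _ /=.
  by move=> -> -> -> ->.
have YE : ((e1 + e2) %% 120)%N = Y.
  apply/eqP; rewrite -(modn_small (lt _ YP)) -(eq_prim_root_expr zP).
  by rewrite exprD -l1E -l2E p2.
have nz : 0%N \notin [:: nat_of_ord e0; e1; e2; e3].
  apply/negP => h; have : z ^+ 0 \in map (fun j => z ^+ j) [:: nat_of_ord e0; e1; e2; e3] by apply: map_f.
  by rewrite expr0 /= -lE => /(allP l_neq1); rewrite eqxx.
right; exists e0, X, Z; split=> //; rewrite /exps4 -/e1 -/e2 -/e3; split=> //.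
have := classify_checkP; rewrite /classify_check => /allP/(_ (e0 : nat)).
rewrite mem_iota add0n ltn_ord => /(_ isT) /allP/(_ X XP) /allP/(_ Z ZP).
rewrite /exps4 -/e1 -/e2 -/e3 YE YP (negPf nz) /=; case: ifP => // _ bad.
have [h|h|h] := bad_exps_sound bad.
- by case/eqP: h; rewrite -l0E -l1E -l2E.
- by case/eqP: h; rewrite -l0E -l1E -l2E.
- by case/eqP: h; rewrite -l0E -l1E -l2E.
Qed.

End ClassifyExponents.


(* The exponents of the linear parts of the tetrahedral, octahedral and
   icosahedral cases, as powers of a primitive 120th root of unity. *)
Definition table_exps : seq (seq nat) :=
  [:: [:: 10; 50; 30; 30]; [:: 60; 20; 20; 20]; [:: 5; 25; 35; 55]; [:: 10; 70; 20; 20];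
      [:: 2; 58; 22; 38]; [:: 6; 54; 42; 18]; [:: 36; 36; 4; 44]; [:: 20; 20; 4; 76];
      [:: 8; 32; 16; 64]; [:: 84; 84; 84; 108]]%N.

(** Computed in binary: unary products would slow the search down. *)
Definition mulmod120 (k b : nat) : nat :=
  N.to_nat (N.modulo (N.mul (N.of_nat k) (N.of_nat b)) 120).

Definition units120n : seq nat := map N.to_nat units120.

Definition imprim_exps (e0 e1 e2 : nat) : bool :=
  let s := [:: (e0 + e1) %% 120; (e1 + e2) %% 120; (e0 + e2) %% 120]%N in
  (1 < count (pred1 60%N) s)%N.

(** The multiplier k replaces z by another primitive root z^k, which is harmless as the tables allow
    any primitive root. *)
Definition table_exps_check : bool :=
  all (fun e0 => all (fun X => all (fun Z =>
    let: (e1, e2, e3) := exps4 e0 X Z in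
    if 0%N \in [:: e0; e1; e2; e3] then true
    else if ~~ definite [:: e0; e1; e2; e3] then true
    else if imprim_exps e0 e1 e2 then true
    else has (fun k => has (fun b => perm_eq [:: e0; e1; e2; e3] (map (mulmod120 k) b))
      table_exps) units120n)
    rot_exps) rot_exps) (iota 0 120).

Lemma table_exps_checkP : table_exps_check = true.
Proof. by vm_cast_no_check (erefl true). Qed.

Lemma mulmod120E k b : mulmod120 k b = (k * b %% 120)%N.
Proof.
have E n : N.to_nat (N.modulo n 120) = (N.to_nat n %% 120)%N.
  have n0 : 120%coqN <> 0%coqN by [].
  have lt120 : (N.to_nat (N.modulo n 120) < 120)%N.
    by have := N.mod_lt n _ n0; lia.
  have := N.div_mod n _ n0.
  move: (N.div _ _) (N.modulo _ _) lt120 => q r r120 ->.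
  by rewrite Nnat.N2Nat.inj_add Nnat.N2Nat.inj_mul -modnDml -mulnE modnMr add0n modn_small.
by rewrite /mulmod120 E Nnat.N2Nat.inj_mul !Nnat.Nat2N.id.
Qed.

Section TableExps.
Variables (F : numClosedFieldType) (z : F).
Hypothesis zP : 120.-primitive_root z.

Lemma table_exps_finite b : b \in table_exps ->
  exists (mu : seq F) L N, finite_table mu L N /\ mu = [seq z ^+ j | j <- b].
Proof.
have prim n : (n %| 120)%N -> n.-primitive_root (z ^+ (120 %/ n)) := @dvdn_prim_root _ _ _ zP n.
have zN : z ^+ 60 = -1 := @prim_half _ 60 _ zP isT.
have zm y : - y = z ^+ 60 * y by rewrite zN mulN1r.
have z5 := prim 24 isT; have z10 := prim 12 isT; have z20 := prim 6 isT.
have z2 := prim 60 isT.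
rewrite !inE; do 9?[case/orP=> [/eqP->|]]; last move=> /eqP->.
all: do 3!eexists; split.
- exact: Tetra1 z10.
- by rewrite -!exprM.
- by apply: (Tetra2 z20 (eta := z ^+ 10)); rewrite -exprM.
- by rewrite -zN.
- exact: Octa1 z5.
- by rewrite -!exprM.
- by apply: (Octa2 z10 (nu := z ^+ 5)); rewrite -exprM.
- by rewrite -!exprM -mulN1r -zN -exprD.
- exact: Icosa1 z2.
- by rewrite -!exprM.
- exact: (Icosa2 z2 erefl).
- by rewrite -!exprM.
- exact: (Icosa3 z2 erefl).
- by rewrite -!exprM.
- exact: (Icosa4 z2 erefl).
- by rewrite -!exprM.
- exact: (Icosa5 z2 erefl).
- by rewrite -!exprM.
- exact: (Icosa6 z2 erefl erefl).
- by rewrite /= !zm -!exprM -!exprD.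
Qed.

End TableExps.

Lemma imprim_finite_table (F : numClosedFieldType) (l : seq F) : size l = 4 ->
  \prod_(y <- l) y = 1 -> all (fun y => y != 1) l -> imprim l ->
  exists mu L N, finite_table mu L N /\ perm_eq l mu.
Proof.
move=> l4 l_prod l_neq1 im.
have n0 := lam_neq0 l4 l_prod (isT : (0 < 4)%N).
have n1 := lam_neq0 l4 l_prod (isT : (1 < 4)%N).
have n2 := lam_neq0 l4 l_prod (isT : (2 < 4)%N).
have l3E := quad_l3 l4 l_prod.
have d (i : nat) : (i < 4)%N -> l`_i != 1.
  by move=> i4; apply: (allP l_neq1); rewrite mem_nth // l4.
have lE : l = [:: l`_0; l`_1; l`_2; l`_3].
  by case: (l) l4 => [|? [|? [|? [|? [|//]]]]].
pose a := l`_0.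
have [la a1] : perm_eq l [:: a; - a^-1; - a^-1; a] /\ a != -1.
  have inv (x y : F) : x != 0 -> x * y = -1 -> y = - x^-1.
    by move=> x0 e; apply: (mulfI x0); rewrite e mulrN mulfV.
  have aN1 : - a^-1 \in l -> a != -1.
    move=> al; apply: contraTneq al => ->; rewrite invrN invr1 opprK.
    by apply/negP => /(allP l_neq1); rewrite eqxx.
  rewrite {1}lE; case: im => -[e1 e2].
  - have l1 : l`_1 = - a^-1 := inv _ _ n0 e1; have l2 : l`_2 = a.
      by rewrite (inv _ _ n1 e2) l1 invrN invrK opprK.
    have l3 : l`_3 = - a^-1.
      by apply: inv => //; apply: (lincomb1 (k1 := -1) l3E); rewrite e1 l2; ring.
    split; last by apply: aN1; rewrite -l1 mem_nth ?l4.
    by rewrite l1 l2 l3 -/a; apply/seq.permP => P /=; ring.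
  - have l1 : l`_1 = - a^-1 := inv _ _ n0 e1.
    have l2 : l`_2 = - a^-1 := inv _ _ n0 e2.
    have l3 : l`_3 = a.
      apply: (mulfI n2); rewrite [RHS]mulrC e2.
      by apply: (lincomb1 (k1 := -1) l3E); rewrite e1; ring.
    split; last by apply: aN1; rewrite -l1 mem_nth ?l4.
    by rewrite l1 l2 l3.
  - have l1 : l`_1 = a by apply: (mulIf n2); rewrite e1 e2.
    have l2 : l`_2 = - a^-1 := inv _ _ n0 e2.
    have l3 : l`_3 = - a^-1.
      apply: inv => //; apply: (lincomb2 (k1 := -1) (k2 := a * l`_3) l3E e1).
      by rewrite /a; ring.
    split; last by apply: aN1; rewrite -l2 mem_nth ?l4.
    by rewrite l1 l2 l3; apply/seq.permP => P /=; ring.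
have a2 : a ^+ 2 != 1 by rewrite sqrf_eq1 negb_or a1 andbT d.
have [ru|nr] := pselect (Defs.root_of_unity a); last first.
  by do 3!eexists; split; [exact: ImprimInf a2 nr | ].
have [k k0 ak] := ru.
have a2k : (a ^+ 2) ^+ k = 1 by rewrite exprAC ak expr1n.
have [m mP _] := prim_order_exists k0 a2k.
have [om|om] := boolP (odd m).
  by do 3!eexists; split; [exact: ImprimOdd a2 ru mP om | ].
by do 3!eexists; split; [exact: ImprimEven a2 ru mP om | ].
Qed.

Lemma prim_root_exists (F : numClosedFieldType) n : (0 < n)%N ->
  exists z : F, n.-primitive_root z.
Proof.
move=> n0; have [r rE] := closed_field_poly_normal ('X^n - 1 : {poly F}).
move: rE; rewrite (monicP (monicXnsubC 1 n0)) scale1r => rE.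
have r_root : all n.-unity_root r by apply/allP => x; rewrite -root_prod_XsubC -rE.
have r_size : (n < (size r).+1)%N.
  by rewrite -(size_prod_XsubC r id) -rE size_XnsubC.
have [|z _ zP] := hasP (has_prim_root n0 r_root _ r_size); last by exists z.
by rewrite -separable_prod_XsubC -rE separable_Xn_sub_1 // pnatr_eq0 -lt0n.
Qed.

Lemma imprim_expsP (F : numClosedFieldType) (z : F) (e0 e1 e2 e3 : nat) :
  120.-primitive_root z -> imprim_exps e0 e1 e2 ->
  imprim [:: z ^+ e0; z ^+ e1; z ^+ e2; z ^+ e3].
Proof.
move=> zP; have zN : z ^+ 60 = -1 := @prim_half _ 60 _ zP isT.
have E i j : ((i + j) %% 120 == 60)%N -> z ^+ i * z ^+ j = -1.
  by move=> /eqP e; rewrite -exprD -(prim_expr_mod zP) e.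
rewrite /imprim_exps /imprim /= addn0.
case: eqP => [/eqP/E e01|_]; case: eqP => [/eqP/E e12|_];
  case: eqP => [/eqP/E e02|_] // _.
- by constructor 1.
- by constructor 1.
- by constructor 2.
- by constructor 3.
Qed.

Lemma quad_table (F : numClosedFieldType) (l : seq F) x sl : size l = 4 ->
  \prod_(y <- l) y = 1 -> all (fun y => y != 1) l ->
  orbit_list (matA l) (matB l) sl x ->
  exists mu L N, finite_table mu L N /\ perm_eq l mu.
Proof.
move=> l4 l_prod l_neq1 slP.
have [z zP] := prim_root_exists F (isT : (0 < 120)%N).
have [im|] := classify_exps zP l4 l_prod l_neq1 slP.
  exact: imprim_finite_table.
move=> [e0 [X [Z [e0lt XP ZP]]]].
have e0P : e0 \in iota 0 120 by rewrite mem_iota.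
have := allP (allP (allP table_exps_checkP e0 e0P) X XP) Z ZP.
rewrite /exps4 => chk + ; move: chk.
set e1 := ((X + _ - _) %% _)%N; set e2 := ((Z + _ - _) %% _)%N.
set e3 := ((480%N - _) %% _)%N => chk [lE df n0]; move: chk.
rewrite (negPf n0) df [~~ true]/=.
case: ifP => [im _|_ /(@hasP _ _ _)[k kP /(@hasP _ _ _)[b bP pb]]].
  by apply: imprim_finite_table => //; rewrite lE; apply: imprim_expsP.
have k_co : coprime k 120.
  have co : all (coprime^~ 120) units120n by vm_cast_no_check (erefl true).
  exact: (allP co).
have xP : 120.-primitive_root (z ^+ k) by rewrite (prim_root_exp_coprime _ zP).
have [mu [L [N [tab muE]]]] := table_exps_finite xP bP.
exists mu, L, N; split=> //.
have -> : l = [seq z ^+ j | j <- [:: e0; e1; e2; e3]] by rewrite lE.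
apply: perm_trans (perm_map _ pb) _; rewrite muE -map_comp.
rewrite (@eq_map _ _ _ (fun j => (z ^+ k) ^+ j)) // => j /=.
by rewrite mulmod120E (prim_expr_mod zP) exprM.
Qed.

(** * Merging neighbouring entries *)

Section HurwitzMerge.
Variable G : groupType.
Implicit Types (s t u v : seq G) (x y g : G).

Lemma prod_hmoveV i s : (\prod_(x <- hmoveV i s) x = \prod_(x <- s) x)%g.
Proof. by rewrite -[in RHS](hmoveVK i s) prod_hmove. Qed.

Lemma hreach_prod s t : hreach s t -> (\prod_(x <- t) x = \prod_(x <- s) x)%g.
Proof. by elim=> // u i _ <-; rewrite ?prod_hmove ?prod_hmoveV. Qed.

Lemma hreach_size s t : hreach s t -> size t = size s.
Proof. by elim=> // u i _ <-; rewrite ?size_hmove ?size_hmoveV. Qed.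

Lemma hreach_sym s t : hreach s t -> hreach t s.
Proof.
elim=> [|u i _ IH|u i _ IH]; first exact: HreachRefl.
- apply: hreach_trans IH; rewrite -[X in hreach _ X](hmoveK i u).
  by apply: HreachMoveV; apply: HreachRefl.
- apply: hreach_trans IH; rewrite -[X in hreach _ X](hmoveVK i u).
  by apply: HreachMove; apply: HreachRefl.
Qed.

Lemma hreach_cons x s t : hreach s t -> hreach (x :: s) (x :: t).
Proof.
elim=> [|u i _ IH|u i _ IH]; first exact: HreachRefl.
- exact: (HreachMove i.+1 IH).
- exact: (HreachMoveV i.+1 IH).
Qed.

Lemma hreach_front u x v : exists w, hreach (u ++ x :: v) (x :: w).
Proof.
elim/last_ind: u v => [|u y IHu] v; first by exists v; apply: HreachRefl.
have [w ww] := IHu (x^-1 * y * x :: v)%g; exists w.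
apply: hreach_trans ww; rewrite cat_rcons -(@hmoveV_cat _ u y x v (size u)) //.
exact: HreachMoveV (HreachRefl _).
Qed.

Lemma fin_orb_near s : fin_orb s -> exists X : seq (seq G), s \in X /\
  forall t t', t \in X -> hreach t t' -> exists2 t2, t2 \in X & conjugate t2 t'.
Proof.
case=> X [sX XP]; exists X; split=> // t t' tX.
elim=> [|t0 i _ [u uX uc]|t0 i _ [u uX uc]].
- by exists t => //; apply: conjugate_refl.
- have [[w wX w_c] _] := XP _ i uX; exists w => //.
  exact: conjugate_trans w_c (conjugate_hmove _ uc).
- have [_ [w wX w_c]] := XP _ i uX; exists w => //.
  exact: conjugate_trans w_c (conjugate_hmoveV _ uc).
Qed.

(** Infinitely many reachable tuples fall into finitely many conjugacy classes. *)
Lemma fin_orb_pigeon s (f : nat -> seq G) : fin_orb s ->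
  (forall k, hreach s (f k)) -> exists k m, (k < m)%N /\ conjugate (f k) (f m).
Proof.
move=> /fin_orb_near[X [sX XP]] sf.
have /choice[c cP] k : exists i : 'I_(size X), conjugate (nth s X i) (f k).
  have [t tX tc] := XP _ _ sX (sf k); have ti : (index t X < size X)%N by rewrite index_mem.
  by exists (Ordinal ti); rewrite /= nth_index.
have /injectivePn[k [m km e]] : ~~ injectiveb (fun k : 'I_(size X).+1 => c k).
  apply: contraTN isT => /injectiveP/leq_card; by rewrite !card_ord ltnn.
have ckm := conjugate_trans (conjugate_sym (cP k)) (_ : conjugate _ (f m)).
have {ckm} ckm : conjugate (f k) (f m) by apply: ckm; rewrite e.
have [lt|gt|/val_inj eq] := ltngtP k m.
- by exists k, m.
- by exists m, k; split=> //; apply: conjugate_sym.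
- by rewrite eq eqxx in km.
Qed.

Definition merge (j : nat) s : seq G :=
  take j s ++ (if drop j s is [:: x, y & v] then (x * y)%g :: v else drop j s).

Lemma merge_cat u x y v j : size u = j ->
  merge j (u ++ [:: x, y & v]) = u ++ (x * y)%g :: v.
Proof. by move=> <-; rewrite /merge take_size_cat // drop_size_cat. Qed.

Lemma merge_big j s : (size s <= j.+1)%N -> merge j s = s.
Proof.
rewrite /merge => sj.
have := size_drop j s; case E: (drop j s) => [|x [|y v]] /=; try lia.
  by rewrite -E cat_take_drop.
by rewrite -E cat_take_drop.
Qed.

Lemma merge_conjs j g s : merge j (conjs g s) = conjs g (merge j s).
Proof.
rewrite /merge /conjs map_cat -map_take -map_drop; congr (_ ++ _).
by case: (drop j s) => [|x [|y v]] //=; rewrite !mulgA mulgVK.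
Qed.

Lemma hreach_move i s t : hreach (hmove i s) t -> hreach s t.
Proof. exact/hreach_trans/HreachMove/HreachRefl. Qed.
Lemma hreach_moveV i s t : hreach (hmoveV i s) t -> hreach s t.
Proof. exact/hreach_trans/HreachMoveV/HreachRefl. Qed.

(* A move next to the merged element comes from two moves before merging. *)
Lemma hmove_merge i j s : exists j' t, hreach s t /\ hmove i (merge j s) = merge j' t.
Proof.
have [js|js] := ltnP j.+1 (size s); last first.
  exists j, (hmove i s); rewrite !merge_big ?size_hmove //; split=> //.
  exact: HreachMove (HreachRefl _).
have [u [x [y [v [-> uj]]]]] := split_at js; rewrite merge_cat //.
have [ij|ij|ij] := ltngtP i j.
- have [ij1|ij1] := ltnP i.+1 j.
    rewrite -uj in ij1; have [u1 [a [b [u2 [uE ui]]]]] := split_at ij1.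
    exists j, (hmove i (u ++ [:: x, y & v])); split; first exact: HreachMove (HreachRefl _).
    rewrite uE -!catA !(hmove_cat _ _ _ ui).
    have E (c d : G) w : u1 ++ [:: c, d & u2] ++ w = (u1 ++ [:: c, d & u2]) ++ w.
      by rewrite catA.
    rewrite [in RHS]E merge_cat; last by rewrite -uj uE !size_cat.
    by rewrite -catA.
  case/lastP: u uj => [|u z] uj; first by move: ij; rewrite -uj.
  rewrite size_rcons in uj; have ui : size u = i by lia.
  exists i, (hmove i.+1 (hmove i (rcons u z ++ [:: x, y & v]))); split.
    exact/hreach_move/hreach_move/HreachRefl.
  rewrite !cat_rcons !(hmove_cat _ _ _ ui) -[u ++ [:: _, _, _ & v]]cat_rcons.
  rewrite hmove_cat ?size_rcons ?ui // cat_rcons.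
  by rewrite merge_cat // !mulgA mulgVK.
- exists j, (hmove i.+1 (u ++ [:: x, y & v])); split; first exact: HreachMove (HreachRefl _).
  have [iv|iv] := ltnP (i - j) (size v); last first.
    rewrite !(hmove_big _).1 ?merge_cat // !size_cat uj /=; lia.
  have iv' : ((i - j.+1).+1 < size v)%N by lia.
  have [u1 [a [b [u2 [-> ui]]]]] := split_at iv'.
  have E1 w : u ++ (x * y)%g :: u1 ++ w = (u ++ (x * y)%g :: u1) ++ w by rewrite -catA.
  have E2 w : u ++ [:: x, y & u1 ++ w] = (u ++ [:: x, y & u1]) ++ w by rewrite -catA.
  rewrite E1 E2 !hmove_cat ?size_cat ?uj /= ?ui; try lia.
  by rewrite -!catA /= merge_cat.
- rewrite ij; case: v js => [|z v] _.
    exists j, (u ++ [:: x; y]); rewrite merge_cat //; split; first exact: HreachRefl.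
    by rewrite (hmove_big _).1 // size_cat uj addn1.
  exists j.+1, (hmove j (hmove j.+1 (u ++ [:: x, y, z & v]))); split.
    exact/hreach_move/hreach_move/HreachRefl.
  rewrite (hmove_cat _ _ _ uj) -[u ++ [:: x, y, z & v]]cat_rcons.
  rewrite hmove_cat ?size_rcons ?uj // cat_rcons (hmove_cat _ _ _ uj) -[in RHS]cat_rcons merge_cat ?size_rcons ?uj //.
  by rewrite cat_rcons !invgM !mulgA.
Qed.

Lemma hmoveV_merge i j s : exists j' t, hreach s t /\ hmoveV i (merge j s) = merge j' t.
Proof.
have [js|js] := ltnP j.+1 (size s); last first.
  exists j, (hmoveV i s); rewrite !merge_big ?size_hmoveV //; split=> //.
  exact: HreachMoveV (HreachRefl _).
have [u [x [y [v [-> uj]]]]] := split_at js; rewrite merge_cat //.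
have [ij|ij|ij] := ltngtP i j.
- have [ij1|ij1] := ltnP i.+1 j.
    rewrite -uj in ij1; have [u1 [a [b [u2 [uE ui]]]]] := split_at ij1.
    exists j, (hmoveV i (u ++ [:: x, y & v])); split; first exact: HreachMoveV (HreachRefl _).
    rewrite uE -!catA !(hmoveV_cat _ _ _ ui).
    have E (c d : G) w : u1 ++ [:: c, d & u2] ++ w = (u1 ++ [:: c, d & u2]) ++ w.
      by rewrite catA.
    rewrite [in RHS]E merge_cat; last by rewrite -uj uE !size_cat.
    by rewrite -catA.
  case/lastP: u uj => [|u z] uj; first by move: ij; rewrite -uj.
  rewrite size_rcons in uj; have ui : size u = i by lia.
  exists i, (hmoveV i.+1 (hmoveV i (rcons u z ++ [:: x, y & v]))); split.
    exact/hreach_moveV/hreach_moveV/HreachRefl.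
  rewrite !cat_rcons !(hmoveV_cat _ _ _ ui) -[u ++ [:: _, _, _ & v]]cat_rcons.
  rewrite hmoveV_cat ?size_rcons ?ui // cat_rcons.
  by rewrite merge_cat // !invgM !mulgA.
- exists j, (hmoveV i.+1 (u ++ [:: x, y & v])); split; first exact: HreachMoveV (HreachRefl _).
  have [iv|iv] := ltnP (i - j) (size v); last first.
    rewrite !(hmove_big _).2 ?merge_cat // !size_cat uj /=; lia.
  have iv' : ((i - j.+1).+1 < size v)%N by lia.
  have [u1 [a [b [u2 [-> ui]]]]] := split_at iv'.
  have E1 w : u ++ (x * y)%g :: u1 ++ w = (u ++ (x * y)%g :: u1) ++ w by rewrite -catA.
  have E2 w : u ++ [:: x, y & u1 ++ w] = (u ++ [:: x, y & u1]) ++ w by rewrite -catA.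
  rewrite E1 E2 !hmoveV_cat ?size_cat ?uj /= ?ui; try lia.
  by rewrite -!catA /= merge_cat.
- rewrite ij; case: v js => [|z v] _.
    exists j, (u ++ [:: x; y]); rewrite merge_cat //; split; first exact: HreachRefl.
    by rewrite (hmove_big _).2 // size_cat uj addn1.
  exists j.+1, (hmoveV j (hmoveV j.+1 (u ++ [:: x, y, z & v]))); split.
    exact/hreach_moveV/hreach_moveV/HreachRefl.
  rewrite (hmoveV_cat _ _ _ uj) -[u ++ [:: x, y, z & v]]cat_rcons.
  rewrite hmoveV_cat ?size_rcons ?uj // cat_rcons (hmoveV_cat _ _ _ uj) -[in RHS]cat_rcons merge_cat ?size_rcons ?uj //.
  by rewrite cat_rcons !mulgA mulgK.
Qed.

(** Doubling the merged strand lifts each move to the longer tuple, so the merged forms of a finite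
    set of representatives are again enough. *)
Lemma fin_orb_merge u x y v : fin_orb (u ++ [:: x, y & v]) -> fin_orb (u ++ (x * y)%g :: v).
Proof.
move=> /fin_orb_near[X [sX XP]].
pose X' := [seq merge j t | t <- X, j <- iota 0 (size t).+1].
have X'P t j : t \in X -> merge j t \in X'.
  move=> tX; have [jt|jt] := leqP j (size t).
    by apply: allpairs_f_dep => //; rewrite mem_iota.
  rewrite merge_big; last by lia.
  rewrite -[X in X \in _](@merge_big (size t) t) //.
  by apply: allpairs_f_dep => //; rewrite mem_iota add0n /=.
exists X'; split; first by rewrite -(@merge_cat u x y v (size u)) // X'P.
have X'c t t1 j : t \in X -> hreach t t1 ->
    exists2 t2, t2 \in X' & conjugate t2 (merge j t1).
  move=> tX tt1; have [t2 t2X [g ->]] := XP _ _ tX tt1.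
  exists (merge j t2); first exact: X'P.
  by exists g; rewrite merge_conjs.
move=> _ i /allpairsPdep[t [j [tX _ ->]]]; split.
  by have [j' [t1 [tt1 ->]]] := hmove_merge i j t; apply: X'c tt1.
by have [j' [t1 [tt1 ->]]] := hmoveV_merge i j t; apply: X'c tt1.
Qed.

End HurwitzMerge.

(** * Fixed points and products of neighbours *)

Section AffineTuples.
Variable F : numClosedFieldType.
Implicit Types (s t u v : seq (aff F)) (x y g : aff F) (l : seq F) (c : F).

Lemma fixes_exists x : lin x != 1 -> exists c, fixes x c.
Proof.
move=> x1; exists (trans x / (1 - lin x)); apply/fixes_trans.
by rewrite mulrC divfK // subr_eq0 eq_sym.
Qed.

Lemma fixes_uniq x c c' : lin x != 1 -> fixes x c -> fixes x c' -> c = c'.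
Proof.
move=> x1 /fixes_trans e /fixes_trans; rewrite e; apply: mulfI.
by rewrite subr_eq0 eq_sym.
Qed.

Lemma fixes2_one x c c' : fixes x c -> fixes x c' -> c != c' -> x = 1%g.
Proof.
move=> e e' cc'; have x1 : lin x = 1.
  by apply/eqP; apply: contraNT cc' => x1; apply/eqP; apply: fixes_uniq e e'.
apply: aff_ext => //; move/fixes_trans: e; by rewrite x1 subrr mul0r.
Qed.

Lemma fixes_conjE x g c c' : lin x != 1 -> fixes x c ->
  fixes (g * x * g^-1)%g c' <-> c' = aff_fun g c.
Proof.
move=> x1 xc; split=> [h|->]; last exact: fixes_conj.
by apply: (fixes_uniq _ h (fixes_conj g xc)); rewrite lin_conj.
Qed.

Lemma aff_fun_inj g c c' : aff_fun g c = aff_fun g c' -> c = c'.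
Proof. by move=> /addIr /mulfI; apply; apply: lin_neq0. Qed.

Lemma linear_hmove i s : perm_eq (map (@lin F) (hmove i s)) (map (@lin F) s).
Proof.
have [si|si] := ltnP i.+1 (size s); last by rewrite (hmove_big si).1.
have [u [x [y [v [-> ui]]]]] := split_at si.
rewrite hmove_cat // !map_cat perm_cat2l /= lin_conj.
by apply/seq.permP => P /=; rewrite addnCA.
Qed.

Lemma linear_hreach s t : hreach s t -> perm_eq (map (@lin F) t) (map (@lin F) s).
Proof.
elim=> // u i _; first exact/perm_trans/linear_hmove.
by apply: perm_trans; rewrite perm_sym -{1}[u](hmoveVK i) linear_hmove.
Qed.

(** The full braid group realizes every order of the linear parts, so they may be permuted freely
    below. *)
Lemma hreach_linear s l : perm_eq (map (@lin F) s) l ->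
  exists2 t, hreach s t & map (@lin F) t = l.
Proof.
elim: l s => [|a l IHl] s sl.
  by exists s; [apply: HreachRefl | apply/nilP; rewrite /nilp (perm_size sl)].
have /mapP[x xs aE] : a \in map (@lin F) s by rewrite (perm_mem sl) mem_head.
have [u [v sE]] : exists u v, s = u ++ x :: v.
  by case/splitPr: xs => u v; exists u, v.
have [w sw] := hreach_front u x v; rewrite -sE in sw.
have wl : perm_eq (map (@lin F) w) l.
  rewrite -(perm_cons a); apply: perm_trans sl.
  by have := linear_hreach sw; rewrite /= aE.
have [t wt <-] := IHl w wl; exists (x :: t); last by rewrite aE.
exact: hreach_trans sw (hreach_cons x wt).
Qed.

Lemma centered_hmove i s : centered s -> centered (hmove i s).
Proof.
have [si|si] := ltnP i.+1 (size s); last by rewrite (hmove_big si).1.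
have [u [x [y [v [-> ui]]]]] := split_at si; rewrite hmove_cat // => -[c cP].
have xc : fixes x c by apply: cP; rewrite mem_cat mem_head orbT.
have yc : fixes y c by apply: cP; rewrite mem_cat !inE eqxx !orbT.
exists c => z; rewrite mem_cat !inE => /or4P[zu|/eqP->|/eqP->|zv] //.
- by apply: cP; rewrite mem_cat zu.
- exact/fixes_mul/fixes_inv/xc/fixes_mul.
- by apply: cP; rewrite mem_cat !inE zv !orbT.
Qed.

Lemma centered_hmoveV i s : centered s -> centered (hmoveV i s).
Proof.
have [si|si] := ltnP i.+1 (size s); last by rewrite (hmove_big si).2.
have [u [x [y [v [-> ui]]]]] := split_at si; rewrite hmoveV_cat // => -[c cP].
have xc : fixes x c by apply: cP; rewrite mem_cat mem_head orbT.
have yc : fixes y c by apply: cP; rewrite mem_cat !inE eqxx !orbT.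
exists c => z; rewrite mem_cat !inE => /or4P[zu|/eqP->|/eqP->|zv] //.
- by apply: cP; rewrite mem_cat zu.
- exact: fixes_mul (fixes_mul (fixes_inv yc) xc) yc.
- by apply: cP; rewrite mem_cat !inE zv !orbT.
Qed.

Lemma hreach_centered s t : hreach s t -> centered s -> centered t.
Proof. by elim=> // u i _ IH /IH; [apply: centered_hmove | apply: centered_hmoveV]. Qed.

Lemma fixes_expg x c k : fixes x c -> fixes (x ^+ k)%g c.
Proof.
move=> xc; elim: k => [|k IHk]; last by rewrite expgS; apply: fixes_mul.
by rewrite expg0 /fixes lin1 trans1 mul1r addr0.
Qed.

Lemma hmove0_sq x y s :
  hmove 0 (hmove 0 [:: x, y & s]) =
  [:: x * y * x * (x * y)^-1, x * y * y * (x * y)^-1 & s]%g.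
Proof. by rewrite /hmove /= !invgM invgK !mulgA mulgVK mulgK. Qed.

(* The square of the first move conjugates [x] and [y] by the translation
   [x * y]; no two of the resulting tuples are conjugate, as the remaining maps
   have two fixed points. *)
Lemma fin_orb_mul_neq1 x y s : fin_orb [:: x, y & s] ->
  (\prod_(g <- [:: x, y & s]) g = 1)%g -> all (fun g => lin g != 1) [:: x, y & s] ->
  ~ (exists c, fixes x c /\ fixes y c) -> lin x * lin y != 1.
Proof.
move=> fin prod1 /= /and3P[x1 y1 s1] nxy; apply/eqP => xy1.
have [c xc] := fixes_exists x1.
pose T := (x * y)%g; have linT : lin T = 1 := xy1.
have TN1 : trans T != 0.
  apply/eqP => T0; apply: nxy; exists c; split=> //.
  have T1 : T = 1%g by apply: aff_ext.
  have -> : y = (x^-1)%g by apply: (mulgI x); rewrite mulgV.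
  exact: fixes_inv.
have sN : ~ centered s.
  move=> [d dP]; have : fixes T d.
    have -> : T = (\prod_(g <- s) g)^-1%g.
      by move: prod1; rewrite !big_cons mulgA => /eqP; rewrite mulg_eq1 => /eqP.
    apply: fixes_inv; elim: (s) dP => [_|z r IHr rP].
      by rewrite big_nil /fixes lin1 trans1 mul1r addr0.
    rewrite big_cons; apply: fixes_mul; first exact/rP/mem_head.
    by apply: IHr => w wr; apply: rP; rewrite inE wr orbT.
  by move=> /fixes_trans; rewrite linT subrr mul0r; apply/eqP.
have [z [w [zs ws [d [zd wd]]]]] : exists z w, [/\ z \in s, w \in s &
    exists d, fixes z d /\ ~ fixes w d].
  apply: contrapT => no; apply: sN.
  case: s s1 no {fin prod1} => [|z s] /= s1 no; first by exists 0.
  have /andP[z1 _] := s1; have [d zd] := fixes_exists z1.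
  exists d => w ws; apply: contrapT => wd; apply: no; exists z, w.
  by split=> //; [apply: mem_head | exists d].
have s1P h : h \in s -> lin h != 1 by move/(allP s1).
pose f k := [:: T ^+ k * x * T ^- k, T ^+ k * y * T ^- k & s]%g.
have fP k : hreach [:: x, y & s] (f k).
  elim: k => [|k IHk].
    by rewrite /f expg0 !mul1g !invg1 !mulg1; apply: HreachRefl.
  apply: hreach_trans IHk _.
  have -> : f k.+1 = hmove 0 (hmove 0 (f k)).
    rewrite hmove0_sq /f; set t := (T ^+ k)%g.
    have -> : (t * x * t^-1 * (t * y * t^-1))%g = T.
      rewrite !mulgA mulgVK -(mulgA t x y) -/T /t.
      by rewrite -expgSr expgS mulgK.
    by rewrite expgS -/t invgM !mulgA.
  exact/hreach_move/hreach_move/HreachRefl.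
have [k [m [km [g fkm]]]] := fin_orb_pigeon fin fP.
have e : (T ^+ m * x * T ^- m = g * (T ^+ k * x * T ^- k) * g^-1)%g := congr1 (head x) fkm.
have sE : s = conjs g s := congr1 (behead \o behead) fkm.
(* The conjugator commutes with the untouched entries, hence fixes their fixed points. There are two
   different ones, so it is trivial. *)
have gfix h e0 : h \in s -> fixes h e0 -> fixes g e0.
  move=> hs he; have cE : (g * h * g^-1)%g = h.
    have /eq_in_map E : map (fun h => g * h * g^-1)%g s = map id s.
      exact: etrans (esym sE) (esym (map_id s)).
    exact: E.
  by have /(fixes_conjE g _ (s1P h hs) he)/esym : fixes (g * h * g^-1)%g e0 by rewrite cE.
have [d' wd'] := fixes_exists (s1P _ ws).
have g1 : g = 1%g.
  apply: (fixes2_one (gfix _ _ zs zd) (gfix _ _ ws wd')).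
  by apply/eqP => dd'; apply: wd; rewrite dd'.
move: e; rewrite g1 mul1g invg1 mulg1 => e.
have Tk j : lin (T ^+ j)%g = 1 /\ trans (T ^+ j)%g = trans T *+ j.
  elim: j => [|j [IH1 IH2]]; first by rewrite expg0.
  by rewrite expgS linM transM IH1 IH2 linT !mul1r mulrS addrC.
have : trans T *+ m = trans T *+ k.
  have := congr1 (@trans F) e; rewrite !trans_conj !(Tk _).1 !(Tk _).2 !mul1r => /addrI /mulfI.
  by apply; rewrite subr_eq0 eq_sym.
by move/eqP; rewrite -subr_eq0 -mulrnBr 1?ltnW // mulrn_eq0 (negPf TN1) orbF subn_eq0 leqNgt km.
Qed.

End AffineTuples.

Section FiniteLinearParts.
Variable F : numClosedFieldType.
Implicit Types (s t : seq (aff F)) (x y z : aff F) (l r : seq F) (a b c : F).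

Lemma not_centered s c : ~ centered s -> exists2 z, z \in s & ~ fixes z c.
Proof.
move=> nc; apply: contrapT => no; apply: nc; exists c => z zs.
by apply: contrapT => zc; apply: no; exists z.
Qed.

Lemma hreach_twist x y z s : hreach [:: x, y, z & s]
  [:: x, (y * z) * y * (y * z)^-1, (y * z) * z * (y * z)^-1 & s]%g.
Proof.
apply: hreach_cons; rewrite -hmove0_sq.
exact/hreach_move/hreach_move/HreachRefl.
Qed.

(** If x and y share the fixed point c, some later z moves c. Once z is brought next to y, twisting
    them sends the fixed point of y to y z c, which differs from c. *)
Lemma hreach_no_common_fixes x y s : lin x != 1 -> lin y != 1 -> ~ centered [:: x, y & s] ->
  exists y' s', [/\ hreach [:: x, y & s] [:: x, y' & s'], lin y' = lin y &
    ~ exists c, fixes x c /\ fixes y' c].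
Proof.
move=> x1 y1 nc.
have [[c [xc yc]]|no] := pselect (exists c, fixes x c /\ fixes y c); last first.
  by exists y, s; split=> //; apply: HreachRefl.
have [z + zc] := not_centered c nc; rewrite !inE => /or3P[/eqP zx|/eqP zy|zs].
- by case: zc; rewrite zx.
- by case: zc; rewrite zy.
have [u [v sE]] : exists u v, s = u ++ z :: v.
  by case/splitPr: zs => u v; exists u, v.
have [w sw] := hreach_front u z v; rewrite -sE in sw.
exists ((y * z) * y * (y * z)^-1)%g, ((y * z) * z * (y * z)^-1 :: w)%g; split.
- exact: hreach_trans (hreach_cons x (hreach_cons y sw)) (hreach_twist x y z w).
- by rewrite lin_conj.
- move=> [c' [xc' /(fixes_conjE _ _ y1 yc)]].
  rewrite -(fixes_uniq x1 xc xc') aff_funM /= -{1}yc -/(aff_fun y c) => /aff_fun_inj e.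
  by apply: zc; rewrite /fixes {2}e.
Qed.

(** If x y, z and w all fix c, then y moves c. Twisting y with z moves the fixed point of z to y c
    and leaves w alone, so these two no longer agree. *)
Lemma hreach_merge_not_centered x y s : (1 < size s)%N ->
  all (fun g => lin g != 1) [:: x, y & s] -> ~ (exists c, fixes x c /\ fixes y c) ->
  exists y' s', [/\ hreach [:: x, y & s] [:: x, y' & s'], lin y' = lin y &
    ~ centered (x * y' :: s')%g].
Proof.
case: s => [|z [|w s]] // _ /and5P[x1 y1 z1 w1 _] no.
have [[c cP]|nc] := pselect (centered (x * y :: z :: w :: s)%g); last first.
  by exists y, [:: z, w & s]; split=> //; apply: HreachRefl.
have xyc : fixes (x * y)%g c by apply: cP; rewrite mem_head.
have zc : fixes z c by apply: cP; rewrite !inE eqxx !orbT.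
have wc : fixes w c by apply: cP; rewrite !inE eqxx !orbT.
have yc : ~ fixes y c.
  move=> yc; apply: no; exists c; split=> //.
  by rewrite -(mulgK y x); apply: fixes_mul xyc (fixes_inv yc).
exists ((y * z) * y * (y * z)^-1)%g, [:: (y * z) * z * (y * z)^-1, w & s]%g; split.
- exact: hreach_twist.
- by rewrite lin_conj.
- move=> [c' c'P]; have wc' : fixes w c' by apply: c'P; rewrite !inE eqxx !orbT.
  have : fixes (y * z * z * (y * z)^-1)%g c' by apply: c'P; rewrite !inE eqxx !orbT.
  rewrite -(fixes_uniq w1 wc wc') => /(fixes_conjE _ _ z1 zc).
  by rewrite aff_funM /= {2}/aff_fun zc => e; apply: yc.
Qed.

Definition fin_lin l : Prop := exists s,
  [/\ fin_orb s, (\prod_(g <- s) g = 1)%g, ~ centered s & map (@lin F) s = l].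

Lemma fin_lin_perm l l' : perm_eq l l' -> fin_lin l -> fin_lin l'.
Proof.
move=> ll' [s [fin s1 nc sl]]; have [|t st tl] := @hreach_linear F s l'; first by rewrite sl.
exists t; split=> //.
- exact: fin_orb_reach st.
- by rewrite (hreach_prod st).
- by move/(hreach_centered (hreach_sym st)).
Qed.

Lemma fin_lin_prod l : fin_lin l -> \prod_(a <- l) a = 1.
Proof. by case=> s [_ s1 _ <-]; rewrite big_map -lin_prod s1. Qed.

(** The descent from n + 1 to n punctures: separate the fixed points of the first two entries,
    exclude a translation as product, keep the rest off-centre, then merge. *)
Lemma fin_lin_merge a b r : (2 < size r)%N -> all (fun c => c != 1) [:: a, b & r] ->
  fin_lin [:: a, b & r] -> a * b != 1 /\ fin_lin (a * b :: r).
Proof.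
move=> r3 abr1 [s [fin s1 nc sE]].
case: s sE fin s1 nc => [|x [|y s]] // [xa yb sr] fin s1 nc.
have lin1 t : hreach [:: x, y & s] t -> all (fun g => lin g != 1) t.
  move=> /linear_hreach/(perm_all (fun c => c != 1)); rewrite all_map /= => ->.
  by rewrite xa yb sr.
have /= /and3P[x1 y1 _] := lin1 _ (HreachRefl _).
have [y' [s' [st y'E no]]] := hreach_no_common_fixes x1 y1 nc.
have s'r : perm_eq (map (@lin F) s') r.
  by have := linear_hreach st; rewrite /= y'E !perm_cons sr.
split.
  rewrite -xa -yb -y'E; apply: fin_orb_mul_neq1 no.
  - exact: fin_orb_reach st.
  - by rewrite (hreach_prod st).
  - exact: lin1.
have [|y2 [s2 [st2 y2E nc2]]] := hreach_merge_not_centered _ (lin1 _ st) no.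
  by rewrite -(size_map (@lin F)) (perm_size s'r); apply: ltnW.
apply: (@fin_lin_perm (map (@lin F) (x * y2 :: s2)%g)).
  have := linear_hreach st2; rewrite /= linM y2E y'E xa yb !perm_cons => e.
  exact: perm_trans e s'r.
exists (x * y2 :: s2)%g; split=> //.
- apply: (@fin_orb_merge _ [::]); apply: fin_orb_reach st2.
  exact: fin_orb_reach st.
- by rewrite -[RHS]s1 -(hreach_prod st) -(hreach_prod st2) !big_cons !mulgA.
Qed.

End FiniteLinearParts.

Section FiniteLinearParts.
Variable F : numClosedFieldType.
Implicit Types (l r : seq F).

Lemma fin_lin_PH n (lam : n.-tuple F) :
  (exists2 p, PH lam p & finite_set (pb_orbit p)) <-> fin_lin lam.
Proof.
split=> [[p /PH_inv[rho -> [rl nc]] fin]|[s [fin s1 nc sl]]].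
  by exists (imgs rho); split=> //; [apply: finite_fin_orb | apply: prod_imgs].
have [|rho rE] := @imgs_surj F n s _ s1.
  by rewrite -(size_map (@lin F)) sl size_tuple.
rewrite -rE in fin nc sl; exists (conj_class rho); last exact: fin_orb_finite.
exact/PH_class.
Qed.

Lemma fin_lin_quad l : size l = 4 -> all (fun y => y != 1) l -> fin_lin l ->
  exists x sl, orbit_list (matA l) (matB l) sl x.
Proof.
move=> l4 l_neq1 fl; have l_prod := fin_lin_prod fl.
have l4b : size l == 4 by apply/eqP.
pose lam : 4.-tuple F := Tuple l4b.
have [p pP fin] := (fin_lin_PH lam).2 fl.
have [rho pE _] := PH_inv pP; rewrite pE in pP fin.
have rg := (good_PH rho (erefl : tval lam = l)).1 pP.
have [sl slP] := orbit_finite_list l4 l_prod l_neq1 rg fin.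
by exists (pt (imgs rho)), sl.
Qed.

Lemma finite_table_fin_lin (mu : seq F) L N : finite_table mu L N -> \prod_(y <- mu) y = 1 ->
  all (fun y => y != 1) mu -> fin_lin mu.
Proof.
move=> tab mu_prod mu_neq1; have mu4 : size mu == 4 by case: tab.
pose lam : 4.-tuple F := Tuple mu4.
have [listed _ _] := @table_listed F lam L N mu_prod mu_neq1 tab.
have [tau [k tk]] : exists (tau : seq F) k, (tau, k) \in L.
  by case: (tab) => *; do 2!eexists; apply: mem_head.
have [p [pP _] pk] := listed _ _ tk.
by apply/(fin_lin_PH lam); exists p => //; exists k.
Qed.

Lemma fin_lin4 l : size l = 4 -> \prod_(y <- l) y = 1 -> all (fun y => y != 1) l ->
  fin_lin l <-> exists (mu : seq F) L N, finite_table mu L N /\ perm_eq l mu.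
Proof.
move=> l4 l_prod l_neq1; split=> [/(fin_lin_quad l4 l_neq1)[x [sl]]|].
  exact: quad_table.
move=> [mu [L [N [tab lmu]]]]; apply: (@fin_lin_perm _ mu); first by rewrite perm_sym.
apply: finite_table_fin_lin tab _ _.
  by rewrite -(perm_big _ lmu).
by rewrite -(perm_all _ lmu).
Qed.

End FiniteLinearParts.

(* Five exponents are first restricted by the orders of the products of two
   linear parts. *)
Definition pair_exps (e : nat) : seq nat :=
  undup (e :: ((180 - e) %% 120)%N :: [seq ((X + 120 - e) %% 120)%N | X <- rot_exps]).

(** The condition on three of the exponents once the other two entries are merged into one. *)
Definition triple_exps (a b c : nat) : bool :=
  if imprim_exps a b c then true else definite [:: a; b; c; ((480 - (a + b + c)) %% 120)%N].

Definition five_exps_check : bool :=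
  all (fun a => all (fun b => all (fun c =>
    if ~~ triple_exps a b c then true else all (fun d =>
      let e := ((480 - (a + b + c + d)) %% 120)%N in
      if 0%N \in [:: a; b; c; d; e] then true
      else if ~~ triple_exps a b d then true
      else if ~~ triple_exps a c d then true
      else if ~~ triple_exps b c d then true
      else if ~~ triple_exps a b e then true
      else if ~~ triple_exps a c e then true
      else if ~~ triple_exps a d e then true
      else if ~~ triple_exps b c e then true
      else if ~~ triple_exps b d e then true
      else if ~~ triple_exps c d e then true
      else if perm_eq [:: a; b; c; d; e] [:: 20; 20; 20; 20; 40]%N then true
      else perm_eq [:: a; b; c; d; e] [:: 100; 100; 100; 100; 80]%N)
    (pair_exps a)) (pair_exps a)) (pair_exps a)) (iota 0 120).

Lemma five_exps_checkP : five_exps_check = true.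
Proof. by vm_cast_no_check (erefl true). Qed.

(** * Five punctures *)

Section FivePunctures.
Variables (F : numClosedFieldType) (z : F).
Hypothesis zP : 120.-primitive_root z.

Lemma exp_inj i j : (i < 120)%N -> (j < 120)%N -> z ^+ i = z ^+ j -> i = j.
Proof.
move=> i120 j120 /eqP; rewrite (eq_prim_root_expr zP).
by rewrite (modn_small i120) (modn_small j120) => /eqP.
Qed.

Lemma exp_mul_eqN1 i j : z ^+ i * z ^+ j = -1 -> ((i + j) %% 120 = 60)%N.
Proof.
rewrite -(@prim_half _ 60 _ zP isT) -exprD => /eqP.
by rewrite (eq_prim_root_expr zP) => /eqP ->.
Qed.

Definition imprim3 (a b c : F) : Prop :=
  [\/ a * b = -1 /\ b * c = -1, a * b = -1 /\ a * c = -1 | b * c = -1 /\ a * c = -1].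

Variable l : seq F.
Hypotheses (l5 : size l = 5) (l_neq1 : all (fun y => y != 1) l) (fl : fin_lin l).

Lemma fin_lin5_triple a b c d e : perm_eq l [:: a; b; c; d; e] ->
  imprim3 a b c \/ exists i X Z, [/\ (i < 120)%N, X \in rot_exps, Z \in rot_exps &
    let: (j, k, h) := exps4 i X Z in
    [/\ a = z ^+ i, b = z ^+ j, c = z ^+ k & definite [:: i; j; k; h]]].
Proof.
move=> lP; have lP' : perm_eq l [:: d; e; a; b; c].
  by apply: perm_trans lP _; apply/seq.permP => P /=; ring.
have [|||de1 fm] := @fin_lin_merge F d e [:: a; b; c].
- by [].
- by rewrite -(perm_all _ lP').
- exact: fin_lin_perm fl.
have fq : fin_lin [:: a; b; c; d * e].
  by apply: fin_lin_perm fm; apply/seq.permP => P /=; ring.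
have q1 : all (fun y => y != 1) [:: a; b; c; d * e].
  by move: l_neq1; rewrite (perm_all _ lP) /= de1 => /and5P[-> -> -> _ _].
have q4 : size [:: a; b; c; d * e] = 4 by [].
have [x [sl slP]] := fin_lin_quad q4 q1 fq.
have [im|[i [X [Z [i120 XP ZP]]]]] := classify_exps zP q4 (fin_lin_prod fq) q1 slP.
  by left.
rewrite /exps4 => -[[-> -> -> _] df _]; by right; exists i, X, Z.
Qed.

(** Otherwise every triple containing x is imprimitive, so at most one of the other four entries
    differs from p = -1/x. The triple (p, p, p) then makes p a 120th root of unity, and so x. *)
Lemma fin_lin5_unity x : x \in l -> x ^+ 120 = 1.
Proof.
move=> xl; apply: contrapT => x120.
have zz i : (z ^+ i) ^+ 120 = 1 by rewrite exprAC (prim_expr_order zP) expr1n.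
have T a b c d e : perm_eq l [:: a; b; c; d; e] ->
    imprim3 a b c \/ [/\ a ^+ 120 = 1, b ^+ 120 = 1 & c ^+ 120 = 1].
  move=> /fin_lin5_triple[|[i [X [Z [_ _ _ [-> -> -> _]]]]]]; first by left.
  by right.
have inv y : x * y = -1 -> y ^+ 120 = 1 -> x ^+ 120 = 1.
  move=> xy y1; rewrite -[LHS]mulr1 -y1 -exprMn xy.
  by rewrite -signr_odd.
have TX b c d e : perm_eq l [:: x; b; c; d; e] -> x * b = -1 \/ x * c = -1.
  by move=> /T[[][]|[/x120]] //; [left | left | right].
have lE : exists b c d e, perm_eq l [:: x; b; c; d; e].
  have := perm_size (perm_to_rem xl); rewrite l5 /=.
  case E: (rem x l) => [|b [|c [|d [|e [|//]]]]] // _; exists b, c, d, e.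
  by rewrite -E perm_to_rem.
have [b [c [d [e lP]]]] := lE.
(* Three entries equal to -1/x are contradictory. *)
have V p q r s t y : perm_eq l [:: p; q; r; s; t] -> x * p = -1 -> x * q = -1 ->
    x * r = -1 -> y = p -> False.
  move=> /T tr xp xq xr _; have x0 : x != 0.
    by apply/eqP => x0; move: xp => /eqP; rewrite x0 mul0r eq_sym oppr_eq0 oner_eq0.
  have pq : p = q by apply: (mulfI x0); rewrite xp.
  have pr : p = r by apply: (mulfI x0); rewrite xp.
  case: tr => [im|[p1 _ _]]; last by apply: x120; apply: inv xp p1.
  have pp : p * p = -1 by move: im; rewrite -pq -pr => -[][].
  apply: x120; apply: inv xp _; rewrite -[120%N]/(2 * 60)%N exprM expr2 pp.
  by rewrite -signr_odd.
have P1 : perm_eq l [:: x; b; d; c; e] by apply: perm_trans lP _; apply/seq.permP => P /=; ring.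
have P2 : perm_eq l [:: x; b; e; c; d] by apply: perm_trans lP _; apply/seq.permP => P /=; ring.
have P3 : perm_eq l [:: x; c; d; b; e] by apply: perm_trans lP _; apply/seq.permP => P /=; ring.
have P4 : perm_eq l [:: x; c; e; b; d] by apply: perm_trans lP _; apply/seq.permP => P /=; ring.
have P5 : perm_eq l [:: x; d; e; b; c] by apply: perm_trans lP _; apply/seq.permP => P /=; ring.
have Q1 : perm_eq l [:: c; d; e; x; b] by apply: perm_trans lP _; apply/seq.permP => P /=; ring.
have Q2 : perm_eq l [:: b; d; e; x; c] by apply: perm_trans lP _; apply/seq.permP => P /=; ring.
have Q3 : perm_eq l [:: b; c; e; x; d] by apply: perm_trans lP _; apply/seq.permP => P /=; ring.
have Q4 : perm_eq l [:: b; c; d; x; e] by apply: perm_trans lP _; apply/seq.permP => P /=; ring.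
have [xb|xb] := pselect (x * b = -1).
  have [xc|xc] := pselect (x * c = -1).
    have [xd|xd] := TX _ _ _ _ P5; first exact: V Q4 xb xc xd erefl.
    exact: V Q3 xb xc xd erefl.
  have [//|xd] := TX _ _ _ _ P3; have [//|xe] := TX _ _ _ _ P4.
  exact: V Q2 xb xd xe erefl.
have [//|xc] := TX _ _ _ _ lP; have [//|xd] := TX _ _ _ _ P1.
have [//|xe] := TX _ _ _ _ P2.
exact: V Q1 xc xd xe erefl.
Qed.

(** The search leaves two patterns, for zeta = z^20 and zeta = z^100, the two primitive 6th roots of
    unity. *)
Theorem fin_lin5 : exists2 zeta : F, 6.-primitive_root zeta &
  perm_eq l [:: zeta; zeta; zeta; zeta; zeta ^+ 2].
Proof.
have [es es120 lE] : exists2 es, all (fun i => i < 120)%N es & l = [seq z ^+ i | i <- es].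
  elim: (l) fin_lin5_unity => [|x r IHr] r1; first by exists [::].
  have [i xE] := prim_rootP zP (r1 x (mem_head _ _)).
  have [|es es120 ->] := IHr; first by move=> y yr; apply: r1; rewrite inE yr orbT.
  by exists (val i :: es); rewrite /= ?ltn_ord // xE.
have K a b c d e : perm_eq es [:: a; b; c; d; e] ->
    triple_exps a b c /\ b \in pair_exps a.
  move=> esP; have := es120; rewrite (perm_all _ esP) /= => /and5P[a120 b120 c120 _ _].
  have lP : perm_eq l [:: z ^+ a; z ^+ b; z ^+ c; z ^+ d; z ^+ e].
    by rewrite lE; apply: perm_map esP.
  have sub i : (i < 120)%N -> forall j, (j < 120)%N -> z ^+ i * z ^+ j = -1 ->
      ((180 - i) %% 120 = j)%N.
    by move=> i120 j j120 /exp_mul_eqN1; lia.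
  have [im|[i [X [Z [i120 XP ZP]]]]] := fin_lin5_triple lP.
    split.
      suff im' : imprim_exps a b c by rewrite /triple_exps im'.
      rewrite /imprim_exps.
      by case: im => -[/exp_mul_eqN1 e1 /exp_mul_eqN1 e2]; rewrite e1 e2 /= ?addn0 ?addnA ?addn1.
    rewrite mem_undup !inE; case: im => -[e1 e2].
    - by rewrite -(sub a a120 b b120 e1) eqxx !orbT.
    - by rewrite -(sub a a120 b b120 e1) eqxx !orbT.
    - rewrite (@exp_inj b a) ?eqxx //; apply: (mulIf _ (etrans e1 (esym e2))).
      exact/expf_neq0/prim_neq0/zP.
  rewrite /exps4 => -[/(exp_inj a120 i120) ai].
  have m120 j : (j %% 120 < 120)%N by rewrite ltn_mod.
  move=> /(exp_inj b120 (m120 _)) bE /(exp_inj c120 (m120 _)) cE df.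
  split; last first.
    rewrite mem_undup in_cons in_cons bE ai; apply/orP; right; apply/orP; right.
    exact: (map_f (fun X => (X + 120 - i) %% 120)%N XP).
  by rewrite /triple_exps; case: ifP => // _; rewrite ai bE cE.
have : size es = 5 by rewrite -(size_map (fun i => z ^+ i)) -lE.
move: K es120 lE; case: es => [|a [|b [|c [|d [|e [|//]]]]]] // K /=.
move=> /and5P[a120 b120 c120 d120 /andP[e120 _]] lE _.
have eE : e = ((480 - (a + b + c + d)) %% 120)%N.
  have := fin_lin_prod fl; rewrite lE !big_cons big_nil mulr1 -!exprD -[1](expr0 z).
  by move=> /eqP; rewrite (eq_prim_root_expr zP) => /eqP; lia.
have n0 : 0%N \notin [:: a; b; c; d; e].
  apply/negP => h; have : z ^+ 0 \in l.
    by rewrite lE -[X in _ \in X]/(map (fun i => z ^+ i) [:: a; b; c; d; e]) map_f.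
  by move=> /(allP l_neq1); rewrite expr0 eqxx.
have perm120 (p : seq nat) : perm_eq [:: a; b; c; d; e] p -> perm_eq [seq z ^+ i | i <- p] l.
  by move=> ep; rewrite lE perm_sym; apply: (perm_map (fun i => z ^+ i)) ep.
have aP : a \in iota 0 120 by rewrite mem_iota.
have KP p q r s t : perm_eq [:: a; b; c; d; e] [:: p; q; r; s; t] -> triple_exps p q r.
  by move=> /K[].
have [abc bP] := K a b c d e (perm_refl _).
have [|_ cP] := K a c b d e; first by apply/seq.permP => P /=; ring.
have [|_ dP] := K a d b c e; first by apply/seq.permP => P /=; ring.
have := allP (allP (allP five_exps_checkP a aP) b bP) c cP.
rewrite abc => /allP/(_ d dP); rewrite -eE; cbv zeta; rewrite (negPf n0).
rewrite (KP a b d c e) ?(KP a c d b e) ?(KP b c d a e) ?(KP a b e c d) ?(KP a c e b d)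
  ?(KP a d e b c) ?(KP b c e a d) ?(KP b d e a c) ?(KP c d e a b);
  try by apply/seq.permP => P /=; ring.
have zeta6 : 6.-primitive_root (z ^+ 20) := @dvdn_prim_root _ _ _ zP 6 isT.
case: ifP => [/perm120 pl _|_ /perm120 pl].
  by exists (z ^+ 20) => //; rewrite perm_sym -exprM.
have zeta6' : 6.-primitive_root ((z ^+ 20) ^+ 5) by rewrite prim_root_exp_coprime.
exists (z ^+ 100); first by rewrite -[100%N]/(20 * 5)%N exprM.
rewrite perm_sym (_ : (z ^+ 100) ^+ 2 = z ^+ 80) // -exprM.
by rewrite -[(100 * 2)%N]/(120 + 80)%N exprD (prim_expr_order zP) mul1r.
Qed.

End FivePunctures.

(** * Six and more punctures *)

Section ManyPunctures.
Variable F : numClosedFieldType.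
Implicit Types (l r : seq F) (a b zeta xi : F).

Lemma prim6_neq zeta : 6.-primitive_root zeta ->
  [/\ zeta != 0, zeta != 1, zeta ^+ 2 != 1 & zeta ^+ 2 != zeta].
Proof.
move=> zP; have n0 := prim_neq0 zP.
have ne (i : nat) : (0 < i < 6)%N -> zeta ^+ i != 1.
  move=> /andP[i0 i6]; rewrite -[1](expr0 zeta) (eq_prim_root_expr zP).
  by rewrite mod0n modn_small // -lt0n.
split=> //; [exact: (ne 1%N) | exact: (ne 2%N) |].
by rewrite expr2 -{3}[zeta]mulr1 (inj_eq (mulfI n0)) (ne 1%N).
Qed.

Lemma prim6_sq zeta xi : 6.-primitive_root zeta -> 6.-primitive_root xi ->
  zeta \in [:: xi; xi; xi; xi; xi ^+ 2] -> zeta = xi.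
Proof.
move=> zP xP; rewrite !inE => /or4P[/eqP//|/eqP//|/eqP//|/orP[/eqP//|/eqP e]].
have : zeta ^+ 3 == 1 by rewrite e -exprM (prim_expr_order xP).
by rewrite -(prim_order_dvd zP).
Qed.

Lemma fin_lin6_merge l a b r : size l = 6 -> all (fun y => y != 1) l -> fin_lin l ->
  perm_eq l [:: a, b & r] -> exists2 zeta : F, 6.-primitive_root zeta &
  perm_eq (a * b :: r) [:: zeta; zeta; zeta; zeta; zeta ^+ 2].
Proof.
move=> l6 l_neq1 fl lP; have [z zP] := prim_root_exists F (isT : (0 < 120)%N).
have r4 : size r = 4 by move/perm_size: lP; rewrite l6 => -[].
have abr1 : all (fun y => y != 1) [:: a, b & r] by rewrite -(perm_all _ lP).
have [|ab1 fm] := fin_lin_merge _ abr1 (fin_lin_perm lP fl); first by rewrite r4.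
apply: fin_lin5 zP _ _ _ fm; first by rewrite /= r4.
by move: abr1; rewrite /= ab1 => /and3P[].
Qed.

(** Merging x and y shows that at least three other entries are zeta. Merging x with one of them
    must give the same pattern, with x zeta as its entry zeta^2, so x = zeta. *)
Theorem fin_lin6 l : size l = 6 -> all (fun y => y != 1) l -> fin_lin l ->
  exists2 zeta : F, 6.-primitive_root zeta &
  perm_eq l [:: zeta; zeta; zeta; zeta; zeta; zeta].
Proof.
move=> l6 l_neq1 fl; have M := fin_lin6_merge l6 l_neq1 fl.
case E: l l6 => [|x [|y r]] // _; rewrite -E.
have x1 : x != 1 by apply: (allP l_neq1); rewrite E mem_head.
have [|zeta zP lP] := M x y r; first by rewrite E.
have [z0 _ z2 z2z] := prim6_neq zP; exists zeta => //.
have cr : (3 <= count_mem zeta r)%N.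
  have /seq.permP/(_ (pred1 zeta)) := lP.
  by rewrite /= eqxx (negPf z2z) /=; case: (_ == _); lia.
have zr : zeta \in r by rewrite -has_pred1 has_count; lia.
have rP := perm_to_rem zr; set r1 := rem zeta r in rP.
have zr1 : zeta \in r1.
  have /seq.permP/(_ (pred1 zeta)) := rP.
  by rewrite -has_pred1 has_count /= eqxx add1n => h; rewrite h ltnS in cr; exact: ltnW.
have lP1 : perm_eq l [:: x, zeta, y & r1].
  rewrite E perm_cons; apply: (@perm_trans _ (y :: zeta :: r1)).
    by rewrite perm_cons.
  by apply/seq.permP => P /=; ring.
have [xi xP mP] := M _ _ _ lP1.
have xiE : zeta = xi.
  by apply: prim6_sq => //; rewrite -(perm_mem mP) !inE zr1 !orbT.
rewrite -xiE in mP.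
have : x * zeta \in [:: zeta; zeta; zeta; zeta; zeta ^+ 2].
  by rewrite -(perm_mem mP) mem_head.
(* As x is not 1, the merged entry can only be zeta^2. *)
have nz : x * zeta != zeta by rewrite -{2}[zeta]mul1r (inj_eq (mulIf z0)).
rewrite !inE (negPf nz) /= expr2 (inj_eq (mulIf z0)) => /eqP xz.
apply: perm_trans lP1 _; rewrite xz; rewrite !perm_cons.
rewrite -(perm_cons (zeta ^+ 2)) [X in perm_eq (X :: _)]expr2 -{1}xz.
by apply: perm_trans mP _; apply/seq.permP => P /=; ring.
Qed.

(** One merging forces five entries to be zeta; merging two of these leaves zeta^2 next to zeta, yet
    all six entries should be equal. *)
Lemma fin_lin7 l : size l = 7 -> all (fun y => y != 1) l -> ~ fin_lin l.
Proof.
move=> l7 l_neq1 fl.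
have M a b r : perm_eq l [:: a, b & r] -> exists2 zeta : F, 6.-primitive_root zeta &
    perm_eq (a * b :: r) [:: zeta; zeta; zeta; zeta; zeta; zeta].
  move=> lP; have r5 : size r = 5 by move/perm_size: lP; rewrite l7 => -[].
  have abr1 : all (fun y => y != 1) [:: a, b & r] by rewrite -(perm_all _ lP).
  have [|ab1 fm] := fin_lin_merge _ abr1 (fin_lin_perm lP fl); first by rewrite r5.
  apply: fin_lin6 fm; first by rewrite /= r5.
  by move: abr1; rewrite /= ab1 => /and3P[].
case E: l l7 => [|a [|b r]] // r5.
have [|zeta zP lP] := M a b r; first by rewrite E.
have [_ _ _ z2z] := prim6_neq zP.
have rz : {in r, forall y, y = zeta}.
  by move=> y yr; have := perm_mem lP y; rewrite !inE yr orbT orbb !orbb => /esym/eqP.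
case: r r5 E lP rz => [|c [|d [|e r]]] // _ E lP rz.
have [cE dE eE] : [/\ c = zeta, d = zeta & e = zeta].
  by split; apply: rz; rewrite !inE eqxx ?orbT.
have [|xi xP mP] := M zeta zeta (zeta :: a :: b :: r).
  by rewrite E cE dE eE; apply/seq.permP => P /=; ring.
have inx y : y \in [:: zeta * zeta, zeta, a, b & r] -> y = xi.
  by rewrite (perm_mem mP) !inE !orbb => /eqP.
by case/eqP: z2z; rewrite expr2 (inx _ (mem_head _ _)) [RHS]inx // !inE eqxx orbT.
Qed.

Theorem fin_lin_size l : all (fun y => y != 1) l -> fin_lin l -> (size l <= 6)%N.
Proof.
have [k] := ubnP (size l); elim: k l => // k IHk l lk l_neq1 fl.
rewrite leqNgt; apply/negP => l7; have [l7'|l8] := eqVneq (size l) 7.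
  exact: fin_lin7 fl.
case: l lk l_neq1 fl l7 l8 => [|a [|b r]] //= rk abr1 fl r5 r7.
have [|ab1 fm] := fin_lin_merge _ abr1 fl; first by lia.
have abr1' : all (fun y => y != 1) (a * b :: r).
  by move: abr1; rewrite /= ab1 => /and3P[].
by have := IHk _ _ abr1' fm; rewrite /=; lia.
Qed.

End ManyPunctures.

(* Eisenstein integers: [(a, b)] stands for [a + b zeta], [zeta ^+ 2 = zeta - 1]. *)
Definition eis := (int * int)%type.
Definition eadd (x y : eis) : eis := (x.1 + y.1, x.2 + y.2).
Definition emul (x y : eis) : eis :=
  (x.1 * y.1 - x.2 * y.2, x.1 * y.2 + x.2 * y.1 + x.2 * y.2).

Definition form := (eis * eis * eis * eis)%type.

(* The actions of the five standard generators and of their inverses on linear forms in the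
   differences of successive translation parts. *)
Definition pulls (w : form) : seq form :=
  let: (a, b, c, d) := w in
  let z := emul (0, 1) in let z' := emul (0, -1) in
  let t := emul (1, -1) in let t' := emul (-1, 1) in
  [:: (eadd (z' a) b, b, c, d); (a, eadd (eadd (z a) (z' b)) c, c, d);
      (a, b, eadd (eadd (z b) (z' c)) d, d); (a, b, c, eadd (z c) (z' d));
      (eadd a (emul (-1, 1) d), eadd b (emul (-2, 1) d), eadd c (emul (-2, 0) d),
       eadd d (emul (-1, -1) d));
      (eadd (t' a) (t b), b, c, d); (a, eadd (eadd a (t' b)) (t c), c, d);
      (a, b, eadd (eadd b (t' c)) (t d), d); (a, b, c, eadd c (t' d));
      (eadd a (emul (0, 1) d), eadd b (emul (-1, 2) d), eadd c (emul (-2, 2) d),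
       eadd d (emul (-2, 1) d))].

(** The four coordinates and the last difference, which the relation expresses through them
    ([gap4]). *)
Definition coord_forms : seq form :=
  let o := (0, 0) : eis in let e := (1, 0) : eis in
  [:: (e, o, o, o); (o, e, o, o); (o, o, e, o); (o, o, o, e);
      ((0, 1), (-1, 2), (-2, 2), (-2, 1))].

Definition grow (W : seq form) : seq form :=
  foldl (fun W w => if w \in W then W else w :: W) W (flatten (map pulls W)).

(** Four rounds saturate the set, as [root_forms_closed] verifies. *)
Definition root_forms : seq form := iter 4 grow coord_forms.

Lemma root_forms_closed :
  all (fun w => all (fun v => v \in root_forms) (pulls w)) root_forms.
Proof. by vm_cast_no_check (erefl true). Qed.

Lemma root_forms_coord : all (fun w => w \in root_forms) coord_forms.
Proof. by vm_cast_no_check (erefl true). Qed.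

(** The existential hides the computed list, so that later proofs never unfold it. *)
Lemma closed_forms : exists W : seq form,
  {in W, forall w, {subset pulls w <= W}} /\ {subset coord_forms <= W}.
Proof.
exists root_forms; split=> [w wW|].
  exact: (allP (allP root_forms_closed w wW)).
exact: (allP root_forms_coord).
Qed.

Lemma fin_orb_bounded (G : groupType) (s : seq G) (X : seq (seq G)) :
  (forall t, hreach s t -> exists2 u, u \in X & conjugate u t) -> fin_orb s.
Proof.
move=> XP; pose near u := `[< exists2 t, hreach s t & conjugate u t >].
exists (s :: [seq u <- X | near u]); split; first exact: mem_head.
have XN t : hreach s t -> exists2 u, u \in s :: [seq u <- X | near u] & conjugate u t.
  move=> st; have [u uX ut] := XP t st; exists u => //.
  by rewrite inE mem_filter uX andbT; apply/orP; right; apply/asboolP; exists t.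
move=> u i uX; have [t st ut] : exists2 t, hreach s t & conjugate u t.
  move: uX; rewrite inE => /orP[/eqP->|].
    by exists s; [apply: HreachRefl | apply: conjugate_refl].
  by rewrite mem_filter => /andP[/asboolP].
split.
  have [v vX vt] := XN _ (HreachMove i st); exists v => //.
  exact: conjugate_trans vt (conjugate_sym (conjugate_hmove _ ut)).
have [v vX vt] := XN _ (HreachMoveV i st); exists v => //.
exact: conjugate_trans vt (conjugate_sym (conjugate_hmoveV _ ut)).
Qed.

(** * Finiteness for the sixth root of unity *)

Section SixPunctures.
Variables (F : numClosedFieldType) (zeta : F).
Hypothesis zetaP : 6.-primitive_root zeta.
Implicit Types (s t : seq (aff F)) (x y : aff F) (w : form).

Lemma zeta_sq : zeta ^+ 2 = zeta - 1.
Proof.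
have [_ _ z2 _] := prim6_neq zetaP.
have z3 : zeta ^+ 3 = -1 := @prim_half _ 3 _ zetaP isT.
have zN1 : zeta + 1 != 0.
  by apply: contraNneq z2 => /eqP; rewrite addr_eq0 => /eqP->; rewrite sqrrN expr1n.
apply: (mulfI zN1).
have -> : (zeta + 1) * zeta ^+ 2 = zeta ^+ 3 + zeta ^+ 2 by ring.
by rewrite z3; ring.
Qed.

Definition eis_val (x : eis) : F := x.1%:~R + x.2%:~R * zeta.

Lemma eis_valD (x y : eis) : eis_val (eadd x y) = eis_val x + eis_val y.
Proof. by rewrite /eis_val /= !intrD; ring. Qed.

Lemma eis_valM (x y : eis) : eis_val (emul x y) = eis_val x * eis_val y.
Proof.
rewrite /eis_val /= !(intrD, intrM, mulrNz, rmorphB) /=.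
by apply: (lincomb1 (k1 := - (x.2%:~R * y.2%:~R)) zeta_sq); ring.
Qed.

(** With equal linear parts, these are the differences of successive fixed points up to the factor 1
    - zeta, and determine the tuple up to conjugation by a translation. *)
Definition gap s k : F := trans (nth 1%g s k) - trans (nth 1%g s k.+1).

Definition form_val w s : F := let: (a, b, c, d) := w in
  eis_val a * gap s 0 + eis_val b * gap s 1 + eis_val c * gap s 2 + eis_val d * gap s 3.

Definition six s : Prop := [/\ size s = 6, all (fun x => lin x == zeta) s
  & (\prod_(x <- s) x = 1)%g].

Lemma six_hreach s t : six s -> hreach s t -> six t.
Proof.
move=> [s6 sz s1] st; split; [by rewrite (hreach_size st) | | by rewrite (hreach_prod st)].
have e u : all (fun x => lin x == zeta) u = all (pred1 zeta) (map (@lin F) u).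
  by rewrite all_map.
by rewrite e (perm_all _ (linear_hreach st)) -e.
Qed.

Lemma transV_six x y : lin x = zeta -> lin y = zeta ->
  trans (y^-1 * x * y)%g = (1 - zeta) * trans x + zeta * trans y.
Proof.
move=> xz yz; have [z0 _ _ _] := prim6_neq zetaP.
have zV : zeta^-1 = 1 - zeta.
  apply: (mulfI z0); rewrite mulfV //.
  by apply: (lincomb1 (k1 := 1) zeta_sq); ring.
rewrite -{2}[y]invgK trans_conj linV transV xz yz zV.
by apply: (lincomb1 (k1 := - trans y) zeta_sq); ring.
Qed.

Lemma gap4 t : six t ->
  gap t 4 = zeta * gap t 0 + (2 * zeta - 1) * gap t 1 + (2 * zeta - 2) * gap t 2 +
    (zeta - 2) * gap t 3.
Proof.
case: t => [|x0 [|x1 [|x2 [|x3 [|x4 [|x5 [|x t]]]]]]] [] //= _.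
move=> /and5P[/eqP l0 /eqP l1 /eqP l2 /eqP l3 /andP[/eqP l4 _]].
rewrite !big_cons big_nil mulg1 => /(congr1 (@trans F)).
rewrite !transM trans1 /gap /= l0 l1 l2 l3 l4.
move: (trans x0) (trans x1) (trans x2) (trans x3) (trans x4) (trans x5).
move=> t0 t1 t2 t3 t4 t5 e.
apply: (lincomb2 (k1 := - zeta) (k2 := t1 + (zeta + 1) * t2 + (zeta ^+ 2 + zeta) * t3 +
  (zeta ^+ 3 + zeta ^+ 2 - 1) * t4 + (zeta ^+ 3 - 1) * (zeta + 1) * t5) e zeta_sq).
by ring.
Qed.

Lemma eis_val_pair (m n : int) : eis_val (m, n) = m%:~R + n%:~R * zeta.
Proof. by []. Qed.

(** Moves act linearly on the gaps, and [pulls] lists the transposed action: first the five moves,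
    then their inverses, whence the offset 5. *)
Lemma form_val_hmove t w i : six t -> (i < 5)%N ->
  form_val w (hmove i t) = form_val (nth w (pulls w) i) t /\
  form_val w (hmoveV i t) = form_val (nth w (pulls w) (5 + i)) t.
Proof.
move=> t6 i5; have := gap4 t6; case: w => [[[a b] c] d].
case: t t6 => [|x0 [|x1 [|x2 [|x3 [|x4 [|x5 [|x t]]]]]]] [] //= _.
move=> /and5P[/eqP l0 /eqP l1 /eqP l2 /eqP l3 /and3P[/eqP l4 /eqP l5 _]] _.
have E := (eis_valD, eis_valM, eis_val_pair); have N := (mulrNz, mulr0z, mulr1z).
case: i i5 => [|[|[|[|[|//]]]]] _; rewrite /hmove /hmoveV /gap /= => e.
- by rewrite (trans_conj x0 x1) (transV_six l0 l1) l0 l1 !E /gap /= !N; split; ring.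
- by rewrite (trans_conj x1 x2) (transV_six l1 l2) l1 l2 !E /gap /= !N; split; ring.
- by rewrite (trans_conj x2 x3) (transV_six l2 l3) l2 l3 !E /gap /= !N; split; ring.
- by rewrite (trans_conj x3 x4) (transV_six l3 l4) l3 l4 !E /gap /= !N; split; ring.
- rewrite (trans_conj x4 x5) l4 l5 !E /gap /= !N; split.
    apply: (lincomb2 (k1 := zeta * eis_val d) (k2 := eis_val d * (trans x0 - trans x1 +
      2 * (trans x1 - trans x2) + 2 * (trans x2 - trans x3) + trans x3 - trans x4)) e zeta_sq).
    by ring.
  by apply: (lincomb1 (k1 := eis_val d) e); ring.
Qed.

Lemma gap_coord t k : six t -> (k < 5)%N ->
  exists2 w, w \in coord_forms & gap t k = form_val w t.
Proof.
move=> t6 k5; exists (nth (0, 0, (0, 0), (0, 0), (0, 0)) coord_forms k).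
  exact: mem_nth.
have E := eis_val_pair; have N := (mulrNz, mulr0z, mulr1z).
case: k k5 => [|[|[|[|[|//]]]]] _; rewrite ?(gap4 t6) /form_val /= !E !N; ring.
Qed.

Variable W : seq form.
Hypotheses (W_pulls : {in W, forall w, {subset pulls w <= W}})
  (W_coord : {subset coord_forms <= W}).

(** Pulling a form back along the moves keeps it in [W], so its value at t is a value at s of some
    form of [W]. *)
Lemma hreach_form s t w : six s -> hreach s t -> w \in W ->
  form_val w t \in [seq form_val w s | w <- W].
Proof.
move=> s6 st; have pW v i : v \in W -> (i < 10)%N -> nth v (pulls v) i \in W.
  by move=> vW i10; apply: (W_pulls vW); apply: mem_nth; case: (v) => [[[a b] c] d].
elim: st w => [|u i su IH|u i su IH] w wW; first exact: map_f.
  have u6 := six_hreach s6 su; have [i5|i5] := ltnP i 5.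
    rewrite (form_val_hmove _ u6 i5).1; apply: IH.
    by apply: pW => //; apply: leq_trans i5 _.
  by rewrite (hmove_big _).1 ?IH //; case: u6 => -> _ _.
have u6 := six_hreach s6 su; have [i5|i5] := ltnP i 5.
  rewrite (form_val_hmove _ u6 i5).2; apply: IH.
  by apply: pW => //; rewrite (ltn_add2l 5 i 5).
by rewrite (hmove_big _).2 ?IH //; case: u6 => -> _ _.
Qed.

Lemma hreach_gap s t k : six s -> hreach s t -> (k < 5)%N ->
  gap t k \in [seq form_val w s | w <- W].
Proof.
move=> s6 st k5; have [w wP ->] := gap_coord (six_hreach s6 st) k5.
exact/hreach_form/W_coord.
Qed.

Fixpoint lists (T : Type) (V : seq T) n : seq (seq T) :=
  if n is n'.+1 then [seq a :: r | a <- V, r <- lists V n'] else [:: [::]].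

Lemma mem_lists (T : eqType) (V : seq T) (r : seq T) :
  {subset r <= V} -> r \in lists V (size r).
Proof.
elim: r => [|a r IHr] // sub; apply: allpairs_f.
  exact/sub/mem_head.
by apply: IHr => b br; apply: sub; rewrite inE br orbT.
Qed.

(** The tuple with these gaps whose first translation part is 0; the extra leading 0 is there
    because [scanl] does not output its initial value. *)
Definition of_gaps (d : seq F) : seq (aff F) :=
  [seq mk_aff b (prim_neq0 zetaP) | b <- scanl (fun b e => b - e) 0 (0 :: d)].

(** Every gap of a reachable tuple takes one of finitely many values, and the gaps determine the
    conjugacy class. *)
Lemma six_fin_orb s : six s -> fin_orb s.
Proof.
move=> s6; set V := [seq form_val w s | w <- W].
apply: (@fin_orb_bounded _ s [seq of_gaps d | d <- lists V 5]) => t st.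
have t6 := six_hreach s6 st.
exists (of_gaps [seq gap t k | k <- iota 0 5]).
  apply: map_f; apply: (@mem_lists _ V [seq gap t k | k <- iota 0 5]) => _ /mapP[k + ->].
  by rewrite mem_iota => k5; apply: hreach_gap.
have [_ z1 _ _] := prim6_neq zetaP.
have z1' : 1 - zeta != 0 by rewrite subr_eq0 eq_sym.
apply: conjugate_sym.
(* The translation that moves the fixed point of the first map to 0. *)
exists (mk_aff (- trans (nth 1%g t 0) / (1 - zeta)) (oner_neq0 F)).
case: t {st} t6 => [|x0 [|x1 [|x2 [|x3 [|x4 [|x5 [|x t]]]]]]] [] //= _.
move=> /and5P[/eqP l0 /eqP l1 /eqP l2 /eqP l3 /and3P[/eqP l4 /eqP l5 _]] _.
rewrite /of_gaps /=.
have mkE (a b : F) (a0 : a != 0) : trans (mk_aff b a0) = b by [].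
congr [:: _; _; _; _; _; _]; apply: aff_ext; rewrite ?lin_conj // trans_conj !mkE.
all: rewrite -[lin (mk_aff _ _)]/1 ?(l0, l1, l2, l3, l4, l5) /gap /=; by field.
Qed.

End SixPunctures.

Theorem fin_orb_six (F : numClosedFieldType) (zeta : F) s : 6.-primitive_root zeta ->
  six zeta s -> fin_orb s.
Proof.
by move=> zP s6; have [W [W1 W2]] := closed_forms; apply: (six_fin_orb zP W1 W2).
Qed.

(** The map with linear part zeta^2 is the square of the map with linear part zeta and the same
    fixed point; splitting it gives six entries, which merge back. *)
Lemma fin_orb_five (F : numClosedFieldType) (zeta : F) (s : seq (aff F)) :
  6.-primitive_root zeta -> (\prod_(x <- s) x = 1)%g ->
  perm_eq (map (@lin F) s) [:: zeta; zeta; zeta; zeta; zeta ^+ 2] -> fin_orb s.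
Proof.
move=> zP s1 sl; have [z0 _ z2 _] := prim6_neq zP.
have [|t st tl] := @hreach_linear F s [:: zeta ^+ 2; zeta; zeta; zeta; zeta].
  by apply: perm_trans sl _; apply/seq.permP => P /=; ring.
suff fin : fin_orb t by apply: fin_orb_reach fin (hreach_sym st).
have t1 : (\prod_(x <- t) x = 1)%g by rewrite (hreach_prod st).
case: t {st} tl t1 => [|x [|y1 [|y2 [|y3 [|y4 [|//]]]]]] // [xz l1 l2 l3 l4] t1.
have x1 : lin x != 1 by rewrite xz.
have [c /fixes_trans xc] := fixes_exists x1.
pose h : aff F := mk_aff ((1 - zeta) * c) z0.
have xE : x = (h * h)%g.
  have [hl ht] : lin h = zeta /\ trans h = (1 - zeta) * c by [].
  by apply: aff_ext; rewrite ?linM ?transM ?xc hl ?ht xz; ring.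
rewrite xE; apply: (@fin_orb_merge _ [::]); apply: (fin_orb_six zP); split=> //.
  by rewrite /= l1 l2 l3 l4 -[lin h]/zeta eqxx.
by rewrite -[RHS]t1 xE !big_cons !mulgA.
Qed.

Theorem theorem2p3p4 (R : realType) (n : nat) (lam : n.-tuple R[i])
    (n_ge4 : (4 <= n)%N)
    (lam_prod : \prod_(x <- lam) x = 1)
    (lam_index : nontriv_index lam = n) :
  [/\ (exists2 p, PH lam p & finite_set (pb_orbit p)) -> (n <= 6)%N,
      n = 5%N -> forall rho : affrep R[i] n, PH lam (conj_class rho) ->
        (finite_set (pb_orbit (conj_class rho)) <->
         exists2 zeta : R[i], 6.-primitive_root zeta &
           perm_eq (linear_part rho) [:: zeta; zeta; zeta; zeta; zeta ^+ 2]),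
      n = 6%N -> forall rho : affrep R[i] n, PH lam (conj_class rho) ->
        (finite_set (pb_orbit (conj_class rho)) <->
         exists2 zeta : R[i], 6.-primitive_root zeta &
           perm_eq (linear_part rho) [:: zeta; zeta; zeta; zeta; zeta; zeta])
    & n = 4%N ->
        ((exists2 p, PH lam p & finite_set (pb_orbit p)) <->
         exists (mu : seq R[i]) (L : seq (seq R[i] * nat)) (N : option nat),
           finite_table mu L N /\ perm_eq lam mu) /\
        (forall (L : seq (seq R[i] * nat)) (N : option nat),
           finite_table lam L N -> orbits_listed lam L N)].
Proof.
have lam_neq1 : all (fun x => x != 1) lam by rewrite all_count size_tuple; apply/eqP.
have lamS : size lam = n := size_tuple lam.
have fl (rho : affrep R[i] n) : PH lam (conj_class rho) ->
    finite_set (pb_orbit (conj_class rho)) -> fin_lin (linear_part rho).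
  move=> pP fin; have /PH_class[rl nc] := pP; rewrite linear_partE rl.
  by apply/fin_lin_PH; exists (conj_class rho).
have lrho (rho : affrep R[i] n) : PH lam (conj_class rho) -> linear_part rho = lam :> seq _.
  by move=> /PH_class[rl _]; rewrite linear_partE.
split.
- by move=> /fin_lin_PH fln; rewrite -lamS fin_lin_size.
- move=> n5 rho pP; split=> [fin|[zeta zP rl]].
    have [z zP] := prim_root_exists R[i] (isT : (0 < 120)%N).
    apply: (fin_lin5 zP _ _ (fl rho pP fin)); first by rewrite size_tuple.
    by rewrite lrho.
  apply: fin_orb_finite; apply: (fin_orb_five zP (prod_imgs rho)).
  by rewrite -linear_partE.
- move=> n6 rho pP; split=> [fin|[zeta zP rl]].
    by apply: (fin_lin6 _ _ (fl rho pP fin)); rewrite ?size_tuple ?lrho.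
  apply: fin_orb_finite; apply: (fin_orb_six zP); split.
  + by rewrite size_imgs.
  + by have := perm_all (fun c => c == zeta) rl; rewrite linear_partE all_map /= eqxx => ->.
  + exact: prod_imgs.
- move=> n4; move: lam lam_prod lam_neq1 lamS {lam_index fl lrho n_ge4}; rewrite n4.
  move=> lam lam_prod lam_neq1 lamS; split.
    by rewrite fin_lin_PH fin_lin4.
  by move=> L N; apply: table_listed.
Qed.
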